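(* Let $s\ge 1$ and let $h=h(z_1,y_2)$ be a real-valued function of class $C^3$ on $\mathbb{C}\times\mathbb{R}$ such that $\partial_{z_1}^j h=O\big(e^{-1/|y_1|^s}\big)$ for every $0\le j\le 2$. Let $\Omega\subset\mathbb{C}^2$ be the domain defined by $x_2>h(z_1,y_2)$. Let $L\subset\partial\Omega$ be any one of the lines defined by $y_1=0$, $x_2=0$, $y_2=\text{const}$. Then $L$ is a propagator of holomorphic extendibility: if $f$ is holomorphic on $\Omega$ and extends holomorphically to a full neighborhood of some point $z^1\in L$, then $f$ also extends holomorphically to a neighborhood of any other point $z^o\in L$.
   Context: Coordinates in $\mathbb{C}^2$ are $(z_1,z_2)$ with $z_j=x_j+iy_j$. The notation $g=O(e^{-1/|y_1|^s})$ means that $|g|\le C e^{-1/|y_1|^s}$ as $y_1\to0$, with $C$ locally uniform in $(x_1,y_2)$ (and $e^{-1/|y_1|^s}$ is understood to be $0$ at $y_1=0$); in particular $h=0$ on $\{y_1=0\}$, so that the lines $\{y_1=0,\ x_2=0,\ y_2=\text{const}\}$ lie in $\partial\Omega$. A function $f$ holomorphic on $\Omega$ ''extends holomorphically to a neighborhood of $p\in\partial\Omega$'' if there are an open neighborhood $U$ of $p$ in $\mathbb{C}^2$ and a holomorphic function $F$ on $U$ with $F=f$ on $U\cap\Omega$. *)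

(* Defs.v *)
From Stdlib Require Import Reals Lra.
From Coquelicot Require Import Coquelicot.
Open Scope R_scope.

Definition d_x1 (g : C * R -> R) (p : C * R) : R :=
  Derive (fun t => g ((t, Im (fst p)), snd p)) (Re (fst p)).
Definition d_y1 (g : C * R -> R) (p : C * R) : R :=
  Derive (fun t => g ((Re (fst p), t), snd p)) (Im (fst p)).
Definition d_y2 (g : C * R -> R) (p : C * R) : R :=
  Derive (fun t => g (fst p, t)) (snd p).

(* [Derive] is total, so existence of the partial derivatives is required
   separately. *)
Fixpoint class_C (n : nat) (g : C * R -> R) : Prop :=
  (forall p : C * R, continuous g p) /\
  match n with
  | O => True
  | S m =>
      (forall p : C * R,
         ex_derive (fun t => g ((t, Im (fst p)), snd p)) (Re (fst p)) /\
         ex_derive (fun t => g ((Re (fst p), t), snd p)) (Im (fst p)) /\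
         ex_derive (fun t => g (fst p, t)) (snd p)) /\
      class_C m (d_x1 g) /\ class_C m (d_y1 g) /\ class_C m (d_y2 g)
  end.

(* The Wirtinger derivative (1/2)(d/dx_1 - i d/dy_1) of a complex-valued
   function; real derivatives are taken componentwise. *)
Definition d_z1 (g : C * R -> C) (p : C * R) : C :=
  (/ 2 * ((d_x1 (fun q => Re (g q)) p, d_x1 (fun q => Im (g q)) p)
          - Ci * (d_y1 (fun q => Re (g q)) p, d_y1 (fun q => Im (g q)) p)))%C.

Fixpoint d_z1_iter (j : nat) (g : C * R -> C) : C * R -> C :=
  match j with
  | O => g
  | S k => d_z1 (d_z1_iter k g)
  end.

(* exp(-1/|y|^s), with value 0 at y = 0 (where [Rpower] is a junk value). *)
Definition exp_flat (s y : R) : R :=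
  if Req_dec_T y 0 then 0 else exp (- / Rpower (Rabs y) s).

(* g = O(exp(-1/|y_1|^s)) as y_1 -> 0, locally uniformly in (x_1, y_2). *)
Definition O_exp_flat (s : R) (g : C * R -> C) : Prop :=
  forall a b : R, exists (delta : posreal) (M : R),
    forall x1 y1 y2 : R,
      Rabs (x1 - a) < delta -> Rabs y1 < delta -> Rabs (y2 - b) < delta ->
      Cmod (g ((x1, y1), y2)) <= M * exp_flat s y1.

Definition epigraph_domain (h : C * R -> R) (z : C * C) : Prop :=
  h (fst z, Im (snd z)) < Re (snd z).

Definition real_line (c : R) (z : C * C) : Prop :=
  Im (fst z) = 0 /\ Re (snd z) = 0 /\ Im (snd z) = c.

(* Complex Frechet differentiability at each point of U; only the values of f
   near points of U matter, so for open U a total f is a function on U. *)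
Definition holomorphic_on (U : C * C -> Prop) (f : C * C -> C) : Prop :=
  forall z : C * C, U z -> ex_filterdiff (K := C_AbsRing) f (locally z).

Definition extends_holomorphically_near
    (Omega : C * C -> Prop) (f : C * C -> C) (p : C * C) : Prop :=
  exists (U : C * C -> Prop) (F : C * C -> C),
    open U /\ U p /\ holomorphic_on U F /\
    (forall z : C * C, U z -> Omega z -> F z = f z).

Definition propagator_of_holomorphic_extendibility
    (Omega L : C * C -> Prop) : Prop :=
  forall f : C * C -> C, holomorphic_on Omega f ->
  forall z1 : C * C, L z1 -> extends_holomorphically_near Omega f z1 ->
  forall zo : C * C, L zo -> extends_holomorphically_near Omega f zo.

(* Main.v *)
(* Since s >= 1, |h| <= M exp(-1/|y_1|) near the line. For z_1 near the line, expand
   f(z_1, .) in powers of z_2 - e - i c, with coefficients a_n(z_1). On a strip |y_1| <= eta the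
   coefficients satisfy |a_n|^(1/n) <= (1/e) (1 + O(exp(-1/eta))), while near a point of the line where
   f extends |a_n|^(1/n) <= (1/e) (1 - const). Harmonic measure decays in the strip like
   exp(-pi l / (2 eta)) at distance l, so for pi l / 2 < 1 and eta small enough the gain beats
   the loss at distance l: the series converges in a disc of radius larger than e there, and its sum is
   the extension. The admissible l does not depend on the size of the first extension,
   hence the set of points of the line where f extends is open and closed.

   Complex differentiability is not assumed continuous, so Cauchy's theory starts from Goursat's theorem,
   applied to f(c + exp z) on rectangles: circle means are independent of the radius. *)
Require Import Defs.
From Stdlib Require Import Reals Lra Lia Classical ClassicalEpsilon.
From Coquelicot Require Import Coquelicot.
Open Scope R_scope.

(** The obstacle: the discs on which f is controlled stop short of the line by about exp(-1/eta),
    while the extension at the first point may exceed radius e by arbitrarily little. A thinner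
    strip shrinks the deficit, but also the influence of that point at distance l. Both are
    exponential in 1/eta, with exponents 1 and pi l / 2, so the size of the first extension enters
    only as a constant factor: it decides how small eta must be, not how large l may be.
    Subharmonicity of log|a_n| is used through a_n exp(n beta exp(-k z)), which is holomorphic; Re
    exp(-k z), less its small maximum on the far side, is an explicit minorant of the harmonic
    measure of the near side. Derivatives are known only pointwise, so holomorphy of limits, of
    means depending on a parameter and of functions of two variables is derived from one inequality
    between values, the three-point inequality. Compactness and connectedness arguments are all
    instances of one bisection. *)

(** * Complex differentiability in one variable *)

Definition cderiv (f : C -> C) (z l : C) : Prop :=
  @is_derive C_AbsRing (AbsRing_NormedModule C_AbsRing) f z l.

Definition cdiff (f : C -> C) (z : C) : Prop := exists l, cderiv f z l.

(** In [AbsRing_NormedModule C_AbsRing] the balls are the discs of [Cmod], whereas those of the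
    product structure on [C] are squares; hence radii need no adjustment here. *)
Lemma cderiv_iff (f : C -> C) (z l : C) :
  cderiv f z l <->
  forall e, 0 < e -> exists d, 0 < d /\ forall w, Cmod (w - z)%C < d ->
    Cmod (f w - f z - l * (w - z))%C <= e * Cmod (w - z)%C.
Proof.
  split.
  - intros [_ H] e He.
    destruct (H z (fun P HP => HP) (mkposreal e He)) as [d Hd].
    exists d; split; [apply cond_pos|]. intros w Hw.
    replace (f w - f z - l * (w - z))%C
      with (f w - f z - (w - z) * l)%C by ring.
    exact (Hd w Hw).
  - intros H. split.
    + apply is_linear_scal_l.
    + intros x Hx.
      replace x with z by
        exact (@is_filter_lim_locally_unique C_AbsRing
                 (AbsRing_NormedModule C_AbsRing) z x Hx).
      intros e. destruct (H e (cond_pos e)) as [d [Hd H']].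
      exists (mkposreal d Hd). intros w Hw.
      specialize (H' w Hw).
      replace (f w - f z - l * (w - z))%C
        with (f w - f z - (w - z) * l)%C in H' by ring.
      exact H'.
Qed.

Lemma cdiff_const (a z : C) : cdiff (fun _ => a) z.
Proof. exists zero. exact (is_derive_const (V := AbsRing_NormedModule C_AbsRing) a z). Qed.

Lemma cdiff_id (z : C) : cdiff (fun w => w) z.
Proof. exists one. exact (is_derive_id (K := C_AbsRing) z). Qed.

Lemma cdiff_plus (f g : C -> C) (z : C) :
  cdiff f z -> cdiff g z -> cdiff (fun w => f w + g w)%C z.
Proof.
  intros [l Hl] [m Hm]. exists (plus l m).
  exact (is_derive_plus (V := AbsRing_NormedModule C_AbsRing) f g z l m Hl Hm).
Qed.

Lemma cdiff_mult (f g : C -> C) (z : C) :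
  cdiff f z -> cdiff g z -> cdiff (fun w => f w * g w)%C z.
Proof.
  intros [l Hl] [m Hm]. eexists.
  exact (is_derive_mult (K := C_AbsRing) f g z l m Hl Hm Cmult_comm).
Qed.

Lemma cdiff_comp (f g : C -> C) (z : C) :
  cdiff f (g z) -> cdiff g z -> cdiff (fun w => f (g w)) z.
Proof.
  intros [l Hl] [m Hm]. eexists.
  exact (is_derive_comp (K := C_AbsRing) (V := AbsRing_NormedModule C_AbsRing) f g z l m Hl Hm).
Qed.

Lemma cdiff_ext_loc (f g : C -> C) (z : C) (d : R) :
  0 < d -> (forall w, Cmod (w - z)%C < d -> f w = g w) -> cdiff f z -> cdiff g z.
Proof.
  intros Hd H [l Hl]. exists l.
  apply (is_derive_ext_loc (V := AbsRing_NormedModule C_AbsRing) f g z l); [|exact Hl].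
  exists (mkposreal d Hd). intros w Hw. apply H. exact Hw.
Qed.

Lemma cdiff_ext (f g : C -> C) (z : C) :
  (forall w, f w = g w) -> cdiff f z -> cdiff g z.
Proof. intros H. apply (cdiff_ext_loc f g z 1); auto; lra. Qed.

Lemma cdiff_minus (f g : C -> C) (z : C) :
  cdiff f z -> cdiff g z -> cdiff (fun w => f w - g w)%C z.
Proof.
  intros Hf Hg.
  apply (cdiff_ext (fun w => f w + (-(1)) * g w)%C).
  - intros w. ring.
  - apply cdiff_plus; auto. apply cdiff_mult; auto. apply cdiff_const.
Qed.

Lemma cdiff_pow (f : C -> C) (n : nat) (z : C) :
  cdiff f z -> cdiff (fun w => f w ^ n)%C z.
Proof.
  intros H. induction n as [|n IH].
  - apply (cdiff_ext (fun _ => RtoC 1)); [reflexivity|]. apply cdiff_const.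
  - apply (cdiff_ext (fun w => f w * f w ^ n)%C); [intros; now rewrite Cpow_S|].
    now apply cdiff_mult.
Qed.

Lemma cdiff_cont (f : C -> C) (z : C) :
  cdiff f z -> forall e, 0 < e -> exists d, 0 < d /\
    forall w, Cmod (w - z)%C < d -> Cmod (f w - f z)%C < e.
Proof.
  intros [l Hl] e He.
  destruct (proj1 (cderiv_iff f z l) Hl 1 Rlt_0_1) as [d [Hd H]].
  assert (0 < 1 + Cmod l) by (generalize (Cmod_ge_0 l); lra).
  exists (Rmin d (e / (1 + Cmod l))); split.
  - apply Rmin_pos; auto. now apply Rdiv_lt_0_compat.
  - intros w Hw.
    assert (H1 := H w (Rlt_le_trans _ _ _ Hw (Rmin_l _ _))).
    assert (H2 := Rlt_le_trans _ _ _ Hw (Rmin_r _ _)).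
    replace (f w - f z)%C with ((f w - f z - l * (w - z)) + l * (w - z))%C by ring.
    eapply Rle_lt_trans; [apply Cmod_triangle|]. rewrite Cmod_mult.
    apply Rle_lt_trans with ((1 + Cmod l) * Cmod (w - z)%C); [lra|].
    apply Rlt_le_trans with ((1 + Cmod l) * (e / (1 + Cmod l))).
    + now apply Rmult_lt_compat_l.
    + right. field. lra.
Qed.

Lemma Cmod_triangle_minus (a b : C) : Cmod (a - b)%C <= Cmod a + Cmod b.
Proof.
  unfold Cminus. eapply Rle_trans; [apply Cmod_triangle|]. rewrite Cmod_opp. lra.
Qed.

Lemma Cmod_minus_sym (a b : C) : Cmod (a - b)%C = Cmod (b - a)%C.
Proof. rewrite <- Cmod_opp. f_equal. ring. Qed.

Lemma Cmod_minus_ge (a b : C) : Cmod a - Cmod b <= Cmod (a - b)%C.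
Proof.
  assert (H := Cmod_triangle (a - b)%C b).
  replace (a - b + b)%C with a in H by ring. lra.
Qed.

Lemma cdiff_inv (z : C) : z <> 0 -> cdiff Cinv z.
Proof.
  intros Hz. exists (- (/ z * / z))%C. apply cderiv_iff. intros e He.
  assert (Hm : 0 < Cmod z) by now apply Cmod_gt_0.
  set (m := Cmod z) in *.
  assert (Hk : 0 < e * m ^ 3 / 2).
  { apply Rdiv_lt_0_compat; [|lra]. apply Rmult_lt_0_compat; auto. now apply pow_lt. }
  (* The remainder of 1/w is (w - z)^2 / (w z^2), and |w| > m / 2; so |w - z| < e m^3 / 2 bounds it
     by e |w - z|. *)
  exists (Rmin (m / 2) (e * m ^ 3 / 2)); split; [apply Rmin_pos; lra|].
  intros w Hw.
  assert (H1 := Rlt_le_trans _ _ _ Hw (Rmin_l _ _)).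
  assert (H2 := Rlt_le_trans _ _ _ Hw (Rmin_r _ _)).
  assert (Hw' : m / 2 < Cmod w).
  { assert (H := Cmod_minus_ge z w). rewrite Cmod_minus_sym in H. fold m in H. lra. }
  assert (Hw0 : w <> 0). { apply Cmod_gt_0. lra. }
  replace (/ w - / z - - (/ z * / z) * (w - z))%C
    with (/ w * (/ z * / z) * (w - z) * (w - z))%C by (field; auto).
  rewrite !Cmod_mult, !Cmod_inv; auto. fold m.
  apply Rmult_le_compat_r; [apply Cmod_ge_0|].
  apply Rle_trans with (/ (m / 2) * (/ m * / m) * (e * m ^ 3 / 2)).
  - apply Rmult_le_compat; try apply Cmod_ge_0; try lra.
    + apply Rmult_le_pos; [left; apply Rinv_0_lt_compat; lra|].
      apply Rmult_le_pos; left; now apply Rinv_0_lt_compat.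
    + apply Rmult_le_compat_r.
      * apply Rmult_le_pos; left; now apply Rinv_0_lt_compat.
      * apply Rinv_le_contravar; lra.
  - right. field. lra.
Qed.

Lemma cdiff_div (f g : C -> C) (z : C) :
  g z <> 0 -> cdiff f z -> cdiff g z -> cdiff (fun w => f w / g w)%C z.
Proof.
  intros Hg Hf Hg'. apply cdiff_mult; auto.
  apply (cdiff_comp Cinv g); auto. now apply cdiff_inv.
Qed.

(** * The complex exponential *)

Definition cexp (z : C) : C := (exp (Re z) * cos (Im z), exp (Re z) * sin (Im z)).

Lemma cexp_plus (z w : C) : cexp (z + w) = (cexp z * cexp w)%C.
Proof.
  destruct z as [a b], w as [u v]. unfold cexp, Cmult; simpl.
  rewrite exp_plus, cos_plus, sin_plus. f_equal; ring.
Qed.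

Lemma Cmod_cexp (z : C) : Cmod (cexp z) = exp (Re z).
Proof.
  unfold Cmod, cexp; simpl.
  replace (_ + _) with (exp (Re z) ^ 2 * ((sin (Im z))² + (cos (Im z))²)) by (unfold Rsqr; ring).
  rewrite sin2_cos2, Rmult_1_r. apply sqrt_pow2. left. apply exp_pos.
Qed.

Lemma cexp_nz (z : C) : cexp z <> 0.
Proof. apply Cmod_gt_0. rewrite Cmod_cexp. apply exp_pos. Qed.

(** Both bounds come from 1 + t <= exp t at t = x and t = -x: the second gives exp x - 1 <= x exp x,
    hence exp x - 1 - x <= x (exp x - 1), which is of order x^2. *)
Lemma exp_remainder (x : R) : Rabs x <= 1 -> Rabs (exp x - 1 - x) <= 3 * x ^ 2.
Proof.
  intros Hx.
  assert (H1 := exp_ineq1_le x). assert (H2 := exp_ineq1_le (- x)).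
  assert (H3 := exp_pos x).
  assert (-1 <= x <= 1) by (split; [|generalize (Rle_abs x); lra];
    generalize (Rle_abs (-x)); rewrite Rabs_Ropp; lra).
  assert (He : exp (- x) * exp x = 1).
  { rewrite <- exp_plus. replace (- x + x) with 0 by ring. apply exp_0. }
  assert (exp x * (1 - x) <= 1) by nra.
  assert (Hb : exp x <= 3).
  { apply Rle_trans with (exp 1); [|apply exp_le_3].
    destruct (Req_dec x 1) as [->|]; [lra|]. left. apply exp_increasing. lra. }
  rewrite Rabs_pos_eq by lra. nra.
Qed.

Lemma Cmod_le_abs (z : C) : Cmod z <= Rabs (Re z) + Rabs (Im z).
Proof.
  destruct z as [x y]. unfold Cmod; simpl.
  replace (Rabs x + Rabs y) with (sqrt ((Rabs x + Rabs y) ^ 2)).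
  - apply sqrt_le_1_alt. generalize (Rabs_pos x) (Rabs_pos y).
    assert (H1 := pow2_abs x). assert (H2 := pow2_abs y). nra.
  - apply sqrt_pow2. generalize (Rabs_pos x) (Rabs_pos y). lra.
Qed.

Lemma im_le_Cmod (z : C) : Rabs (Im z) <= Cmod z.
Proof. eapply Rle_trans; [|apply Rmax_Cmod]. apply Rmax_r. Qed.

Lemma cos_remainder (y : R) : Rabs (cos y - 1) <= y ^ 2.
Proof.
  assert (H := cos_2a_sin (y / 2)). replace (2 * (y / 2)) with y in H by field.
  rewrite H.
  assert (Hs : Rabs (sin (y / 2)) <= Rabs (y / 2)).
  { assert (K : forall t, 0 <= t -> Rabs (sin t) <= t).
    { intros t Ht. apply Rabs_le. split.
      - destruct (Rle_dec 2 t) as [|]; [generalize (SIN_bound t); lra|].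
        assert (0 <= sin t). { apply sin_ge_0; auto. generalize PI2_1; lra. } lra.
      - destruct (Req_dec t 0) as [->|]; [rewrite sin_0; lra|]. left. apply sin_lt_x. lra. }
    destruct (Rle_dec 0 (y / 2)).
    - rewrite (Rabs_pos_eq (y / 2)); auto.
    - rewrite <- (Rabs_Ropp (sin _)), <- sin_neg, <- (Rabs_Ropp (y / 2)),
        (Rabs_pos_eq (- (y / 2))) by lra. apply K. lra. }
  assert (H0 : Rabs (sin (y/2)) ^ 2 <= Rabs (y/2) ^ 2).
  { apply pow_incr. split; auto. apply Rabs_pos. }
  rewrite !pow2_abs in H0.
  apply Rabs_le. nra.
Qed.

Lemma sin_remainder (y : R) : Rabs y <= 1 -> Rabs (sin y - y) <= y ^ 2.
Proof.
  assert (K : forall t, 0 <= t <= 1 -> Rabs (sin t - t) <= t ^ 2).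
  { intros t Ht. destruct (Req_dec t 0) as [->|].
    { rewrite sin_0. rewrite Rminus_0_r, Rabs_R0. lra. }
    destruct (MVT_cor2 (fun u => sin u - u) (fun u => cos u - 1) 0 t) as [u [Hu1 Hu2]].
    - lra.
    - intros u _. apply is_derive_Reals. auto_derive; auto. ring.
    - rewrite sin_0 in Hu1. replace (sin t - t) with ((cos u - 1) * (t - 0)) by lra.
      rewrite Rabs_mult, (Rabs_pos_eq (t - 0)) by lra.
      assert (H1 := cos_remainder u). assert (u ^ 2 <= t) by nra.
      replace (t ^ 2) with (t * (t - 0)) by ring.
      apply Rmult_le_compat_r; lra. }
  intros Hy. destruct (Rle_dec 0 y).
  - apply K. rewrite Rabs_pos_eq in Hy; lra.
  - rewrite <- Rabs_Ropp. replace (- (sin y - y)) with (sin (- y) - (- y)) by (rewrite sin_neg; ring).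
    replace (y ^ 2) with ((- y) ^ 2) by ring. apply K.
    rewrite <- Rabs_Ropp, Rabs_pos_eq in Hy; lra.
Qed.

Lemma cexp_remainder (v : C) :
  Cmod v <= 1 -> Cmod (cexp v - 1 - v)%C <= 13 * Cmod v ^ 2.
Proof.
  destruct v as [x y]. intros Hv.
  assert (Hx : Rabs x <= Cmod (x, y)) by apply (re_le_Cmod (x, y)).
  assert (Hy : Rabs y <= Cmod (x, y)) by apply (im_le_Cmod (x, y)).
  set (m := Cmod (x, y)) in *.
  assert (Hx2 : x ^ 2 <= m ^ 2).
  { rewrite <- pow2_abs. apply pow_incr. split; auto. apply Rabs_pos. }
  assert (Hy2 : y ^ 2 <= m ^ 2).
  { rewrite <- (pow2_abs y). apply pow_incr. split; auto. apply Rabs_pos. }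
  assert (E1 := exp_remainder x ltac:(lra)).
  assert (E2 := cos_remainder y). assert (E3 := sin_remainder y ltac:(lra)).
  assert (Ex : exp x <= 3).
  { apply Rle_trans with (exp 1); [|apply exp_le_3].
    assert (x <= 1) by (generalize (Rle_abs x); lra).
    destruct (Req_dec x 1) as [->|]; [lra|]. left. apply exp_increasing. lra. }
  assert (Ep := exp_pos x).
  eapply Rle_trans; [apply Cmod_le_abs|]. unfold cexp; simpl.
  (* Regrouped so that each summand is quadratic: 3 + 3 for the real part and 3 + 1 + 3 for the
     imaginary part, hence the constant 13. *)
  replace (exp x * cos y + - (1) + - x) with ((exp x - 1 - x) + exp x * (cos y - 1)) by ring.
  replace (exp x * sin y + - 0 + - y) with ((exp x - 1 - x) * y + x * y + exp x * (sin y - y)) by ring.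
  assert (T1 : Rabs (exp x - 1 - x + exp x * (cos y - 1)) <= 6 * m ^ 2).
  { eapply Rle_trans; [apply Rabs_triang|]. rewrite Rabs_mult, (Rabs_pos_eq (exp x)) by lra.
    generalize (Rabs_pos (cos y - 1)). nra. }
  assert (T2 : Rabs ((exp x - 1 - x) * y + x * y + exp x * (sin y - y)) <= 7 * m ^ 2).
  { eapply Rle_trans; [apply Rabs_triang|].
    apply Rle_trans with (3 * m ^ 2 * 1 + m * m + 3 * m ^ 2); [|lra].
    apply Rplus_le_compat.
    - eapply Rle_trans; [apply Rabs_triang|]. rewrite !Rabs_mult.
      apply Rplus_le_compat; apply Rmult_le_compat; try apply Rabs_pos; lra.
    - rewrite Rabs_mult, (Rabs_pos_eq (exp x)) by lra.
      apply Rmult_le_compat; try apply Rabs_pos; lra. }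
  simpl in *. lra.
Qed.

Lemma cdiff_cexp (z : C) : cdiff cexp z.
Proof.
  exists (cexp z). apply cderiv_iff. intros e He.
  assert (Hp : 0 < Cmod (cexp z)) by (apply Cmod_gt_0, cexp_nz).
  set (m := Cmod (cexp z)) in *.
  exists (Rmin 1 (e / (13 * m))); split.
  { apply Rmin_pos; [lra|]. apply Rdiv_lt_0_compat; lra. }
  intros w Hw.
  assert (H1 := Rlt_le_trans _ _ _ Hw (Rmin_l _ _)).
  assert (H2 := Rlt_le_trans _ _ _ Hw (Rmin_r _ _)).
  replace (cexp w) with (cexp z * cexp (w - z))%C
    by (rewrite <- cexp_plus; f_equal; ring).
  replace (cexp z * cexp (w - z) - cexp z - cexp z * (w - z))%C
    with (cexp z * (cexp (w - z) - 1 - (w - z)))%C by ring.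
  rewrite Cmod_mult. fold m.
  assert (H3 := cexp_remainder (w - z)%C ltac:(lra)).
  assert (H4 := Cmod_ge_0 (w - z)%C). set (t := Cmod (w - z)%C) in *.
  apply Rle_trans with (m * (13 * t ^ 2)); [apply Rmult_le_compat_l; lra|].
  replace (m * (13 * t ^ 2)) with ((13 * m * t) * t) by ring.
  apply Rmult_le_compat_r; auto.
  apply Rle_trans with (13 * m * (e / (13 * m))).
  - apply Rmult_le_compat_l; lra.
  - right. field. lra.
Qed.

(** * Bisection *)

(* Compactness by bisection of the boxes [x, x + s A] x [y, y + s B]; A = 0 or B = 0 is
   allowed and gives the one-dimensional version. *)
Lemma box_bisection (P : R -> R -> R -> Prop) (A B x0 y0 : R) :
  0 <= A -> 0 <= B ->
  (forall x y s, 0 < s -> x0 <= x -> x + s * A <= x0 + A ->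
     y0 <= y -> y + s * B <= y0 + B ->
     P x y (s / 2) -> P (x + s / 2 * A) y (s / 2) ->
     P x (y + s / 2 * B) (s / 2) -> P (x + s / 2 * A) (y + s / 2 * B) (s / 2) ->
     P x y s) ->
  (forall p q, x0 <= p <= x0 + A -> y0 <= q <= y0 + B ->
     exists d, 0 < d /\ forall x y s, 0 < s < d ->
       x0 <= x -> x + s * A <= x0 + A -> y0 <= y -> y + s * B <= y0 + B ->
       x <= p <= x + s * A -> y <= q <= y + s * B -> P x y s) ->
  P x0 y0 1.
Proof.
  intros HA HB Hglue Hloc. apply NNPP. intros HN.
  set (bad := fun (s : R) (p : R * R) =>
    x0 <= fst p /\ fst p + s * A <= x0 + A /\ y0 <= snd p /\ snd p + s * B <= y0 + B
    /\ ~ P (fst p) (snd p) s).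
  assert (step : forall s (p : R * R), 0 < s -> bad s p -> exists p' : R * R, bad (s / 2) p' /\
     fst p <= fst p' /\ fst p' + s / 2 * A <= fst p + s * A /\
     snd p <= snd p' /\ snd p' + s / 2 * B <= snd p + s * B).
  { intros s [x y] Hs (H1 & H2 & H3 & H4 & H5). simpl in *.
    assert (0 <= s / 2 * A) by (apply Rmult_le_pos; lra).
    assert (0 <= s / 2 * B) by (apply Rmult_le_pos; lra).
    destruct (classic (P x y (s / 2))) as [Q1|Q1];
      [|exists (x, y); unfold bad; simpl; repeat split; auto; lra].
    destruct (classic (P (x + s / 2 * A) y (s / 2))) as [Q2|Q2];
      [|exists (x + s / 2 * A, y); unfold bad; simpl; repeat split; auto; lra].
    destruct (classic (P x (y + s / 2 * B) (s / 2))) as [Q3|Q3];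
      [|exists (x, y + s / 2 * B); unfold bad; simpl; repeat split; auto; lra].
    destruct (classic (P (x + s / 2 * A) (y + s / 2 * B) (s / 2))) as [Q4|Q4];
      [|exists (x + s / 2 * A, y + s / 2 * B); unfold bad; simpl; repeat split; auto; lra].
    exfalso. apply H5. now apply Hglue. }
  set (sz := fun n : nat => (/ 2) ^ n).
  assert (Hsz : forall n, 0 < sz n) by (intros n; apply pow_lt; lra).
  assert (HszS : forall n, sz (S n) = sz n / 2) by (intros n; unfold sz; simpl; field).
  set (next := fun n (q : {p | bad (sz n) p}) =>
    constructive_indefinite_description _ (step (sz n) (proj1_sig q) (Hsz n) (proj2_sig q))).
  assert (b0 : bad (sz 0%nat) (x0, y0)).
  { unfold bad, sz; simpl. repeat split; auto; lra. }
  (* Dependent choice: each box carries its proof of badness, since the next one is chosen only for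
     a bad box; [eq_ind_r] transports that proof along [HszS]. *)
  pose (sq := fix F (n : nat) : {p | bad (sz n) p} :=
     match n with
     | O => exist _ (x0, y0) b0
     | S n => exist (bad (sz (S n))) (proj1_sig (next n (F n)))
          (eq_ind_r (fun s => bad s (proj1_sig (next n (F n))))
             (proj1 (proj2_sig (next n (F n)))) (HszS n))
     end).
  set (X := fun n => fst (proj1_sig (sq n))). set (Y := fun n => snd (proj1_sig (sq n))).
  assert (Hbad : forall n, bad (sz n) (X n, Y n)).
  { intros n. unfold X, Y. rewrite <- surjective_pairing. apply (proj2_sig (sq n)). }
  assert (Hnext : forall n, X n <= X (S n) /\ X (S n) + sz (S n) * A <= X n + sz n * A /\
     Y n <= Y (S n) /\ Y (S n) + sz (S n) * B <= Y n + sz n * B).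
  { intros n. rewrite HszS. exact (proj2 (proj2_sig (next n (sq n)))). }
  assert (nest : forall (Z : nat -> R) (D : R), 0 <= D ->
     (forall n, Z n <= Z (S n) /\ Z (S n) + sz (S n) * D <= Z n + sz n * D) ->
     exists l, forall n, Z n <= l <= Z n + sz n * D).
  { intros Z D HD H.
    assert (M1 : forall n k, Z n <= Z (n + k)%nat).
    { intros n k. induction k; [rewrite Nat.add_0_r; lra|].
      rewrite Nat.add_succ_r. generalize (H (n + k)%nat). lra. }
    assert (M2 : forall n k, Z (n + k)%nat + sz (n + k)%nat * D <= Z n + sz n * D).
    { intros n k. induction k; [rewrite Nat.add_0_r; lra|].
      rewrite Nat.add_succ_r. generalize (H (n + k)%nat). lra. }
    assert (M3 : forall n m, Z m <= Z n + sz n * D).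
    { intros n m. assert (Q1 := M1 m n). assert (Q2 := M2 n m).
      rewrite (Nat.add_comm m n) in Q1.
      assert (0 <= sz (n + m)%nat * D) by (apply Rmult_le_pos; auto; left; auto). lra. }
    destruct (completeness (fun r => exists n, r = Z n)) as [l [Hl1 Hl2]].
    - exists (Z O + sz O * D). intros r [n ->]. apply M3.
    - exists (Z O). now exists O.
    - exists l. intros n. split.
      + apply Hl1. now exists n.
      + apply Hl2. intros r [m ->]. apply M3. }
  destruct (nest X A HA) as [p Hp]; [intros n; generalize (Hnext n); tauto|].
  destruct (nest Y B HB) as [q Hq]; [intros n; generalize (Hnext n); tauto|].
  assert (Hp0 := Hp O). assert (Hq0 := Hq O). unfold sz, X, Y in Hp0, Hq0; simpl in Hp0, Hq0.
  destruct (Hloc p q ltac:(lra) ltac:(lra)) as [d [Hd H]].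
  destruct (pow_lt_1_zero (/ 2) ltac:(rewrite Rabs_pos_eq; lra) d Hd) as [N HN'].
  specialize (HN' N (Nat.le_refl _)).
  rewrite Rabs_pos_eq in HN' by (left; apply Hsz).
  destruct (Hbad N) as (H1 & H2 & H3 & H4 & H5). simpl in *.
  apply H5, H; auto.
Qed.

(** Turns radii depending on the parameter into one common radius. Uniform continuity, bounds and
    neighbourhoods along circles are obtained from it, with t the angle. *)
Lemma tube (P : R -> R -> Prop) (a b : R) :
  a <= b ->
  (forall d d' t, 0 < d' <= d -> P d t -> P d' t) ->
  (forall t, a <= t <= b -> exists d, 0 < d /\ forall t', Rabs (t' - t) < d -> P d t') ->
  exists d, 0 < d /\ forall t, a <= t <= b -> P d t.
Proof.
  intros Hab Hmon Hloc.
  pose (Q := fun x (_ : R) s => exists d, 0 < d /\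
     forall t, x <= t <= x + s * (b - a) -> P d t).
  assert (H : Q a 0 1).
  { apply (box_bisection Q (b - a) 0 a 0); try lra.
    - intros x y s Hs Q5 Q6 Q7 Q8 [d1 [Hd1 H1]] [d2 [Hd2 H2]] Q3 Q4. clear Q3 Q4 Q5 Q6 Q7 Q8.
      exists (Rmin d1 d2); split; [now apply Rmin_pos|]. intros t Ht.
      destruct (Rle_dec t (x + s / 2 * (b - a))).
      + apply (Hmon d1); [split; [now apply Rmin_pos|apply Rmin_l]|]. apply H1. lra.
      + apply (Hmon d2); [split; [now apply Rmin_pos|apply Rmin_r]|]. apply H2. lra.
    - intros p q Hp Hq. destruct (Hloc p ltac:(lra)) as [d [Hd H]].
      (* The added 1 keeps the divisor positive for a = b; the same device recurs in the other uses
         of bisection. *)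
      exists (d / (b - a + 1)); split; [apply Rdiv_lt_0_compat; lra|].
      intros x y s Hs H1 H2 H3 H4 Hx H5. exists d; split; auto. intros t Ht. apply H.
      assert (s * (b - a + 1) < d).
      { apply Rlt_le_trans with (d / (b - a + 1) * (b - a + 1)).
        - apply Rmult_lt_compat_r; lra.
        - right. field. lra. }
      apply Rabs_def1; nra. }
  destruct H as [d [Hd H]]. exists d; split; auto. intros t Ht. apply H. lra.
Qed.

(** * Integrals of complex-valued paths *)

Definition CInt (f : R -> C) (a b : R) : C := @RInt C_R_CompleteNormedModule f a b.

(** The points t' are not restricted to [a, b]: continuity at the end points is two-sided, as the
    integrability criterion used in [is_CInt] requires. *)
Definition cont_on (f : R -> C) (a b : R) : Prop :=
  forall t, a <= t <= b -> forall e, 0 < e ->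
    exists d, 0 < d /\ forall t', Rabs (t' - t) < d -> Cmod (f t' - f t)%C < e.

Lemma is_CInt (f : R -> C) (a b : R) :
  a <= b -> cont_on f a b -> @is_RInt C_R_NormedModule f a b (CInt f a b).
Proof.
  intros Hab H. apply (@RInt_correct C_R_CompleteNormedModule).
  apply (@ex_RInt_continuous C_R_CompleteNormedModule). intros t Ht.
  rewrite Rmin_left, Rmax_right in Ht by auto.
  intros Q [e He]. destruct (H t Ht e (cond_pos e)) as [d [Hd H']].
  exists (mkposreal d Hd). intros u Hu. apply He.
  specialize (H' u Hu).
  split; unfold ball; simpl; unfold AbsRing_ball, abs, minus, plus, opp; simpl.
  - eapply Rle_lt_trans; [|exact H']. apply (re_le_Cmod (f u - f t)%C).
  - eapply Rle_lt_trans; [|exact H']. apply (im_le_Cmod (f u - f t)%C).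
Qed.

Lemma is_CInt_unique (f : R -> C) (a b : R) (l : C) :
  @is_RInt C_R_NormedModule f a b l -> CInt f a b = l.
Proof. apply (@is_RInt_unique C_R_CompleteNormedModule). Qed.

Lemma CInt_plus (f g : R -> C) (a b : R) :
  a <= b -> cont_on f a b -> cont_on g a b ->
  CInt (fun t => f t + g t)%C a b = (CInt f a b + CInt g a b)%C.
Proof.
  intros Hab Hf Hg. apply is_CInt_unique.
  exact (@is_RInt_plus C_R_NormedModule _ _ _ _ _ _ (is_CInt f a b Hab Hf) (is_CInt g a b Hab Hg)).
Qed.

(** The integral lives in a real normed module, where a complex k is not a scalar; the product is
    therefore expanded into components. *)
Lemma CInt_mult (f : R -> C) (k : C) (a b : R) :
  a <= b -> cont_on f a b -> CInt (fun t => k * f t)%C a b = (k * CInt f a b)%C.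
Proof.
  intros Hab Hf. apply is_CInt_unique.
  assert (H := is_CInt f a b Hab Hf).
  assert (H1 := is_RInt_fct_extend_fst (U := R_NormedModule) (V := R_NormedModule) _ _ _ _ H).
  assert (H2 := is_RInt_fct_extend_snd (U := R_NormedModule) (V := R_NormedModule) _ _ _ _ H).
  apply (is_RInt_fct_extend_pair (U := R_NormedModule) (V := R_NormedModule)); simpl.
  - apply (is_RInt_minus (V := R_NormedModule));
      apply (is_RInt_scal (V := R_NormedModule)); auto.
  - apply (is_RInt_plus (V := R_NormedModule));
      apply (is_RInt_scal (V := R_NormedModule)); auto.
Qed.

Lemma Cmod_norm_R (z : C) : @norm R_AbsRing C_R_NormedModule z = Cmod z.
Proof.
  destruct z as [x y]. unfold norm, Cmod; simpl. unfold prod_norm, norm; simpl.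
  unfold abs; simpl. f_equal. generalize (pow2_abs x) (pow2_abs y). simpl. lra.
Qed.

Lemma Cmod_CInt_le (f : R -> C) (a b M : R) :
  a <= b -> cont_on f a b -> (forall t, a <= t <= b -> Cmod (f t) <= M) ->
  Cmod (CInt f a b) <= (b - a) * M.
Proof.
  intros Hab Hf HM.
  rewrite <- Cmod_norm_R.
  apply (@norm_RInt_le_const C_R_NormedModule f a b _ M Hab).
  - intros t Ht. rewrite Cmod_norm_R. exact (HM t Ht).
  - now apply is_CInt.
Qed.

Lemma CInt_Chasles (f : R -> C) (a b c : R) :
  a <= b -> b <= c -> cont_on f a c -> CInt f a c = (CInt f a b + CInt f b c)%C.
Proof.
  intros Hab Hbc Hf. apply is_CInt_unique.
  apply (@is_RInt_Chasles C_R_NormedModule f a b c); apply is_CInt; auto;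
    intros t Ht; apply Hf; lra.
Qed.

Lemma CInt_ext (f g : R -> C) (a b : R) :
  a <= b -> (forall t, a <= t <= b -> f t = g t) -> CInt f a b = CInt g a b.
Proof.
  intros Hab H. apply (@RInt_ext C_R_CompleteNormedModule). intros t Ht.
  rewrite Rmin_left, Rmax_right in Ht by auto. apply H. lra.
Qed.

Lemma CInt_affine (u v : C) (a b : R) :
  CInt (fun t => u + v * t)%C a b = ((b - a) * (u + v * ((a + b) / 2)))%C.
Proof.
  apply is_CInt_unique. destruct u as [u1 u2], v as [v1 v2].
  assert (K : forall p q : R, is_RInt (fun t => p + q * t) a b ((b - a) * (p + q * ((a + b) / 2)))).
  { intros p q.
    evar_last.
    - apply (is_RInt_derive (fun t => p * t + q * t ^ 2 / 2) (fun t => p + q * t)).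
      + intros t _. auto_derive; auto. field.
      + intros t _. apply (ex_derive_continuous (fun t => p + q * t)). auto_derive; auto.
    - unfold minus, plus, opp; simpl. field. }
  replace ((b - a) * ((u1, u2) + (v1, v2) * ((a + b) / 2)))%C
    with ((b - a) * (u1 + v1 * ((a + b) / 2)), (b - a) * (u2 + v2 * ((a + b) / 2))).
  - apply (is_RInt_fct_extend_pair (U := R_NormedModule) (V := R_NormedModule)); simpl.
    + eapply is_RInt_ext; [|apply K]. intros t _. simpl. ring.
    + eapply is_RInt_ext; [|apply K]. intros t _. simpl. ring.
  - rewrite <- !RtoC_minus, <- RtoC_plus.
    replace (RtoC (a + b) / 2)%C with (RtoC ((a + b) / 2)) by (rewrite RtoC_div; auto; lra).
    unfold Cmult, Cplus, RtoC; simpl. f_equal; ring.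
Qed.

(** * Goursat's theorem *)

(** The counterclockwise contour integral of g(z) dz: bottom minus top, then right minus left with
    dz = i dt. *)
Definition rect_int (g : C -> C) (x1 x2 y1 y2 : R) : C :=
  (CInt (fun t => g (t, y1)) x1 x2 - CInt (fun t => g (t, y2)) x1 x2
   + Ci * (CInt (fun t => g (x2, t)) y1 y2 - CInt (fun t => g (x1, t)) y1 y2))%C.

Lemma pair_RtoC (x y : R) : ((x, y) : C) = (x + Ci * y)%C.
Proof. unfold Cplus, Cmult, RtoC; simpl. f_equal; ring. Qed.

Lemma cont_on_horizontal (g : C -> C) (y a b : R) :
  (forall t, a <= t <= b -> cdiff g (t, y)) -> cont_on (fun t => g (t, y)) a b.
Proof.
  intros H t Ht e He. destruct (cdiff_cont g (t, y) (H t Ht) e He) as [d [Hd H']].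
  exists d; split; auto. intros u Hu. apply H'.
  replace ((u, y) - (t, y))%C with (RtoC (u - t)).
  - now rewrite Cmod_R.
  - unfold Cminus, Cplus, Copp, RtoC; simpl. f_equal; ring.
Qed.

Lemma cont_on_vertical (g : C -> C) (x a b : R) :
  (forall t, a <= t <= b -> cdiff g (x, t)) -> cont_on (fun t => g (x, t)) a b.
Proof.
  intros H t Ht e He. destruct (cdiff_cont g (x, t) (H t Ht) e He) as [d [Hd H']].
  exists d; split; auto. intros u Hu. apply H'.
  replace ((x, u) - (x, t))%C with (Ci * RtoC (u - t))%C.
  - now rewrite Cmod_mult, Cmod_Ci, Cmod_R, Rmult_1_l.
  - unfold Cminus, Cplus, Copp, Cmult, RtoC; simpl. f_equal; ring.
Qed.

Definition cdiff_rect (g : C -> C) (x1 x2 y1 y2 : R) : Prop :=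
  forall x y, x1 <= x <= x2 -> y1 <= y <= y2 -> cdiff g (x, y).

Lemma rect_int_split (g : C -> C) (x1 xm x2 y1 ym y2 : R) :
  x1 <= xm -> xm <= x2 -> y1 <= ym -> ym <= y2 -> cdiff_rect g x1 x2 y1 y2 ->
  rect_int g x1 x2 y1 y2 =
  (rect_int g x1 xm y1 ym + rect_int g xm x2 y1 ym
   + rect_int g x1 xm ym y2 + rect_int g xm x2 ym y2)%C.
Proof.
  intros H1 H2 H3 H4 Hg. unfold rect_int.
  assert (HX : forall y, y1 <= y <= y2 -> CInt (fun t => g (t, y)) x1 x2 =
     (CInt (fun t => g (t, y)) x1 xm + CInt (fun t => g (t, y)) xm x2)%C).
  { intros y Hy. apply CInt_Chasles; auto. apply cont_on_horizontal. intros t Ht. now apply Hg. }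
  assert (HY : forall x, x1 <= x <= x2 -> CInt (fun t => g (x, t)) y1 y2 =
     (CInt (fun t => g (x, t)) y1 ym + CInt (fun t => g (x, t)) ym y2)%C).
  { intros x Hx. apply CInt_Chasles; auto. apply cont_on_vertical. intros t Ht. now apply Hg. }
  rewrite !HX, !HY by lra. ring.
Qed.

Lemma rect_int_ext (f g : C -> C) (x1 x2 y1 y2 : R) :
  x1 <= x2 -> y1 <= y2 -> (forall z, f z = g z) ->
  rect_int f x1 x2 y1 y2 = rect_int g x1 x2 y1 y2.
Proof.
  intros Hx Hy H. unfold rect_int.
  f_equal; [|f_equal]; f_equal; apply CInt_ext; auto.
Qed.

Lemma rect_int_plus (f g : C -> C) (x1 x2 y1 y2 : R) :
  x1 <= x2 -> y1 <= y2 -> cdiff_rect f x1 x2 y1 y2 -> cdiff_rect g x1 x2 y1 y2 ->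
  rect_int (fun z => f z + g z)%C x1 x2 y1 y2 =
  (rect_int f x1 x2 y1 y2 + rect_int g x1 x2 y1 y2)%C.
Proof.
  intros Hx Hy Hf Hg. unfold rect_int.
  rewrite !CInt_plus; auto; try ring;
    (apply cont_on_horizontal || apply cont_on_vertical);
    intros t Ht; (apply Hf || apply Hg); lra.
Qed.

(** On each side the integral is the length times the value at the midpoint, and the contributions
    of opposite sides cancel in total. *)
Lemma rect_int_affine (u v : C) (x1 x2 y1 y2 : R) :
  x1 <= x2 -> y1 <= y2 -> rect_int (fun z => u + v * z)%C x1 x2 y1 y2 = 0.
Proof.
  intros Hx Hy. unfold rect_int.
  assert (HX : forall y, CInt (fun t => u + v * (t, y))%C x1 x2 =
    ((x2 - x1) * (u + v * (Ci * y) + v * ((x1 + x2) / 2)))%C).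
  { intros y. rewrite <- CInt_affine. apply CInt_ext; auto. intros t _.
    rewrite pair_RtoC. ring. }
  assert (HY : forall x, CInt (fun t => u + v * (x, t))%C y1 y2 =
    ((y2 - y1) * (u + v * x + v * Ci * ((y1 + y2) / 2)))%C).
  { intros x. rewrite <- CInt_affine. apply CInt_ext; auto. intros t _.
    rewrite pair_RtoC. ring. }
  rewrite !HX, !HY. ring.
Qed.

Lemma Cmod_rect_int_le (g : C -> C) (x1 x2 y1 y2 M : R) :
  x1 <= x2 -> y1 <= y2 -> cdiff_rect g x1 x2 y1 y2 ->
  (forall x y, x1 <= x <= x2 -> y1 <= y <= y2 -> Cmod (g (x, y)) <= M) ->
  Cmod (rect_int g x1 x2 y1 y2) <= 2 * ((x2 - x1) + (y2 - y1)) * M.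
Proof.
  intros Hx Hy Hg HM. unfold rect_int.
  eapply Rle_trans; [apply Cmod_triangle|]. rewrite Cmod_mult, Cmod_Ci, Rmult_1_l.
  assert (HX : forall y, y1 <= y <= y2 -> Cmod (CInt (fun t => g (t, y)) x1 x2) <= (x2 - x1) * M).
  { intros y H. apply Cmod_CInt_le; auto. apply cont_on_horizontal. intros; now apply Hg. }
  assert (HY : forall x, x1 <= x <= x2 -> Cmod (CInt (fun t => g (x, t)) y1 y2) <= (y2 - y1) * M).
  { intros x H. apply Cmod_CInt_le; auto. apply cont_on_vertical. intros; now apply Hg. }
  eapply Rle_trans; [apply Rplus_le_compat; apply Cmod_triangle_minus|].
  assert (K1 := HX y1 ltac:(lra)). assert (K2 := HX y2 ltac:(lra)).
  assert (K3 := HY x1 ltac:(lra)). assert (K4 := HY x2 ltac:(lra)). lra.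
Qed.

(** The bound e s^2 is additive under quartering, so bisection reduces it to small rectangles around
    one point. There the affine part of g integrates to 0, and the error, small compared with s, is
    integrated over a perimeter of order s. *)
Lemma goursat (g : C -> C) (x0 y0 A B : R) :
  0 <= A -> 0 <= B -> cdiff_rect g x0 (x0 + A) y0 (y0 + B) ->
  rect_int g x0 (x0 + A) y0 (y0 + B) = 0.
Proof.
  intros HA HB Hg. apply Cmod_eq_0. apply Rle_antisym; [|apply Cmod_ge_0].
  apply le_epsilon. intros e He. rewrite Rplus_0_l.
  pose (P := fun x y s => Cmod (rect_int g x (x + s * A) y (y + s * B)) <= e * s ^ 2).
  assert (H : P x0 y0 1).
  2:{ unfold P in H. rewrite !Rmult_1_l in H. lra. }
  apply (box_bisection P A B); auto.
  - intros x y s Hs h1 h2 h3 h4 H1 H2 H3 H4. unfold P in *.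
    assert (0 <= s / 2 * A) by (apply Rmult_le_pos; lra).
    assert (0 <= s / 2 * B) by (apply Rmult_le_pos; lra).
    rewrite (rect_int_split g x (x + s / 2 * A) (x + s * A) y (y + s / 2 * B) (y + s * B));
      try lra.
    2:{ intros p q Hp Hq. apply Hg; lra. }
    replace (x + s / 2 * A + s / 2 * A) with (x + s * A) in * by field.
    replace (y + s / 2 * B + s / 2 * B) with (y + s * B) in * by field.
    eapply Rle_trans; [apply Cmod_triangle|].
    assert (T := Cmod_triangle (rect_int g x (x + s / 2 * A) y (y + s / 2 * B) +
       rect_int g (x + s / 2 * A) (x + s * A) y (y + s / 2 * B))%C
       (rect_int g x (x + s / 2 * A) (y + s / 2 * B) (y + s * B))).
    assert (T' := Cmod_triangle (rect_int g x (x + s / 2 * A) y (y + s / 2 * B))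
       (rect_int g (x + s / 2 * A) (x + s * A) y (y + s / 2 * B))).
    replace (e * s ^ 2) with (e * (s / 2) ^ 2 + e * (s / 2) ^ 2 + e * (s / 2) ^ 2 + e * (s / 2) ^ 2)
      by field.
    lra.
  - intros p q Hp Hq.
    destruct (Hg p q Hp Hq) as [l Hl].
    (* Perimeter 2 s (A + B) times error (e / k) s (A + B) is then at most e s^2; the added 1 keeps
       k positive for degenerate rectangles. *)
    set (k := 2 * (A + B) ^ 2 + 1).
    assert (Hk : 0 < k) by (unfold k; generalize (pow2_ge_0 (A + B)); lra).
    destruct (proj1 (cderiv_iff g (p, q) l) Hl (e / k) ltac:(now apply Rdiv_lt_0_compat))
      as [d [Hd H]].
    exists (d / (A + B + 1)); split; [apply Rdiv_lt_0_compat; lra|].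
    intros x y s [Hs Hsd] h1 h2 h3 h4 Hx Hy. unfold P.
    assert (Hsd' : s * (A + B) < d).
    { apply Rle_lt_trans with (s * (A + B + 1)); [apply Rmult_le_compat_l; lra|].
      apply Rlt_le_trans with (d / (A + B + 1) * (A + B + 1)).
      - apply Rmult_lt_compat_r; lra.
      - right. field. lra. }
    assert (Hsub : cdiff_rect g x (x + s * A) y (y + s * B)) by (intros a b Ha Hb; apply Hg; lra).
    pose (aff := fun z : C => ((g (p, q) - l * (p, q)) + l * z)%C).
    pose (err := fun z : C => (g z - aff z)%C).
    assert (Haff : cdiff_rect aff x (x + s * A) y (y + s * B)).
    { intros a b _ _. apply cdiff_plus; [apply cdiff_const|]. apply cdiff_mult;
        [apply cdiff_const|apply cdiff_id]. }
    assert (Herr : cdiff_rect err x (x + s * A) y (y + s * B)).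
    { intros a b Ha Hb. apply cdiff_minus; [now apply Hsub|now apply Haff]. }
    replace (rect_int g x (x + s * A) y (y + s * B))
      with (rect_int (fun z => aff z + err z)%C x (x + s * A) y (y + s * B)).
    2:{ apply rect_int_ext; try lra. intros z. unfold err. ring. }
    rewrite rect_int_plus by (auto; lra).
    unfold aff at 1. rewrite rect_int_affine by lra. rewrite Cplus_0_l.
    eapply Rle_trans; [apply (Cmod_rect_int_le _ _ _ _ _ (e / k * (s * (A + B)))); try lra; auto|].
    + intros a b Ha Hb.
      assert (Hab : Cmod ((a, b) - (p, q))%C <= s * (A + B)).
      { eapply Rle_trans; [apply Cmod_le_abs|]. simpl.
        assert (Rabs (a + - p) <= s * A) by (apply Rabs_le; lra).
        assert (Rabs (b + - q) <= s * B) by (apply Rabs_le; lra). lra. }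
      unfold err, aff.
      replace (g (a, b) - (g (p, q) - l * (p, q) + l * (a, b)))%C
        with (g (a, b) - g (p, q) - l * ((a, b) - (p, q)))%C by ring.
      eapply Rle_trans; [apply H; lra|]. apply Rmult_le_compat_l; auto.
      left. now apply Rdiv_lt_0_compat.
    + replace (2 * (x + s * A - x + (y + s * B - y)) * (e / k * (s * (A + B))))
        with ((e * s ^ 2) * ((2 * (A + B) ^ 2) / k)) by (field; lra).
      rewrite <- (Rmult_1_r (e * s ^ 2)) at 2. apply Rmult_le_compat_l.
      * apply Rmult_le_pos; [lra|apply pow2_ge_0].
      * apply Rmult_le_reg_r with k; auto. unfold Rdiv.
        rewrite Rmult_assoc, Rinv_l, Rmult_1_r, Rmult_1_l by lra. unfold k. lra.
Qed.

(** * Circle means and Cauchy's formula *)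

Definition ccont (f : C -> C) (z : C) : Prop :=
  forall e, 0 < e -> exists d, 0 < d /\
    forall w, Cmod (w - z)%C < d -> Cmod (f w - f z)%C < e.

Lemma cdiff_ccont (f : C -> C) (z : C) : cdiff f z -> ccont f z.
Proof. exact (cdiff_cont f z). Qed.

Definition circ (c : C) (r t : R) : C := (c + r * cexp (0%R, t))%C.

(** Since dz = i (z - c) dt on the circle, this is the integral of f(z) / (z - c) divided by 2 pi i.
    Cauchy's kernel therefore appears below as (z - c) / (z - w). *)
Definition cmean (f : C -> C) (c : C) (r : R) : C :=
  (RtoC (/ (2 * PI)) * CInt (fun t => f (circ c r t)) 0 (2 * PI))%C.

Lemma Cmod_circ (c : C) (r t : R) : 0 <= r -> Cmod (circ c r t - c)%C = r.
Proof.
  intros Hr. unfold circ. replace (c + r * cexp (0%R, t) - c)%C with (r * cexp (0%R, t))%C by ring.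
  rewrite Cmod_mult, Cmod_cexp, Cmod_R, Rabs_pos_eq; auto. simpl. rewrite exp_0. ring.
Qed.

Lemma circ_exp (c : C) (x t : R) : circ c (exp x) t = (c + cexp (x, t))%C.
Proof.
  unfold circ. f_equal. unfold cexp, Cmult, RtoC; simpl. rewrite exp_0. f_equal; ring.
Qed.

Lemma circ_cont (c : C) (r t : R) : forall e, 0 < e -> exists d, 0 < d /\
  forall t', Rabs (t' - t) < d -> Cmod (circ c r t' - circ c r t)%C < e.
Proof.
  intros e He.
  destruct (cdiff_cont (fun z => c + r * cexp z)%C (0, t)) with (e := e) as [d [Hd H]]; auto.
  { apply cdiff_plus; [apply cdiff_const|]. apply cdiff_mult; [apply cdiff_const|apply cdiff_cexp]. }
  exists d; split; auto. intros t' Ht'. apply (H (0, t')).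
  eapply Rle_lt_trans; [apply Cmod_le_abs|]. simpl.
  rewrite Rplus_opp_r, Rabs_R0, Rplus_0_l. exact Ht'.
Qed.

Lemma cont_on_circ (f : C -> C) (c : C) (r a b : R) :
  0 <= r -> (forall z, Cmod (z - c)%C = r -> ccont f z) ->
  cont_on (fun t => f (circ c r t)) a b.
Proof.
  intros Hr H t _ e He.
  destruct (H (circ c r t) (Cmod_circ c r t Hr) e He) as [d [Hd H']].
  destruct (circ_cont c r t d Hd) as [d' [Hd' H'']].
  exists d'; split; auto.
Qed.

Lemma two_PI_pos : 0 < 2 * PI.
Proof. generalize PI_RGT_0. lra. Qed.

Definition cont_circle (f : C -> C) (c : C) (r : R) : Prop :=
  forall z, Cmod (z - c)%C = r -> ccont f z.

Lemma cmean_ext (c : C) (r : R) (f g : C -> C) :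
  0 <= r -> (forall z, Cmod (z - c)%C = r -> f z = g z) -> cmean f c r = cmean g c r.
Proof.
  intros Hr H. unfold cmean. f_equal. apply CInt_ext; [left; apply two_PI_pos|].
  intros t _. apply H. now apply Cmod_circ.
Qed.

Lemma cmean_plus (c : C) (r : R) (f g : C -> C) :
  0 <= r -> cont_circle f c r -> cont_circle g c r ->
  cmean (fun z => f z + g z)%C c r = (cmean f c r + cmean g c r)%C.
Proof.
  intros Hr Hf Hg. unfold cmean. rewrite CInt_plus; [ring|left; apply two_PI_pos| |];
    now apply cont_on_circ.
Qed.

Lemma cmean_mult (c : C) (r : R) (f : C -> C) (k : C) :
  0 <= r -> cont_circle f c r -> cmean (fun z => k * f z)%C c r = (k * cmean f c r)%C.
Proof.
  intros Hr Hf. unfold cmean. rewrite CInt_mult; [ring|left; apply two_PI_pos|].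
  now apply cont_on_circ.
Qed.

Lemma cmean_const (c : C) (r : R) (k : C) : cmean (fun _ => k) c r = k.
Proof.
  unfold cmean.
  rewrite (CInt_ext _ (fun t => k + 0 * t)%C); [|left; apply two_PI_pos|intros; ring].
  rewrite CInt_affine, RtoC_inv by (generalize two_PI_pos; lra). field.
  intros E. apply RtoC_inj in E. generalize two_PI_pos; lra.
Qed.

Lemma Cmod_cmean_le (c : C) (r : R) (f : C -> C) (M : R) :
  0 <= r -> cont_circle f c r -> (forall z, Cmod (z - c)%C = r -> Cmod (f z) <= M) ->
  Cmod (cmean f c r) <= M.
Proof.
  intros Hr Hf HM. assert (H2 := two_PI_pos). unfold cmean.
  rewrite Cmod_mult, Cmod_R, Rabs_pos_eq by (left; now apply Rinv_0_lt_compat).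
  apply Rmult_le_reg_l with (2 * PI); auto.
  rewrite <- Rmult_assoc, Rinv_r, Rmult_1_l by lra.
  replace (2 * PI * M) with ((2 * PI - 0) * M) by ring.
  apply Cmod_CInt_le; [lra|now apply cont_on_circ|].
  intros t _. apply HM. now apply Cmod_circ.
Qed.

Lemma ccont_plus (f g : C -> C) (z : C) :
  ccont f z -> ccont g z -> ccont (fun w => f w + g w)%C z.
Proof.
  intros Hf Hg e He.
  destruct (Hf (e / 2) ltac:(lra)) as [d [Hd H]]. destruct (Hg (e / 2) ltac:(lra)) as [d' [Hd' H']].
  exists (Rmin d d'); split; [now apply Rmin_pos|]. intros w Hw.
  specialize (H w (Rlt_le_trans _ _ _ Hw (Rmin_l _ _))).
  specialize (H' w (Rlt_le_trans _ _ _ Hw (Rmin_r _ _))).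
  replace (f w + g w - (f z + g z))%C with ((f w - f z) + (g w - g z))%C by ring.
  eapply Rle_lt_trans; [apply Cmod_triangle|]. lra.
Qed.

Lemma ccont_mult (f g : C -> C) (z : C) :
  ccont f z -> ccont g z -> ccont (fun w => f w * g w)%C z.
Proof.
  intros Hf Hg e He.
  set (k := 1 + Cmod (f z) + Cmod (g z)).
  assert (Hk : 1 <= k) by (unfold k; generalize (Cmod_ge_0 (f z)) (Cmod_ge_0 (g z)); lra).
  assert (He2 : 0 < Rmin 1 (e / (2 * k))).
  { apply Rmin_pos; [lra|]. apply Rdiv_lt_0_compat; lra. }
  destruct (Hf _ He2) as [d [Hd H]]. destruct (Hg _ He2) as [d' [Hd' H']].
  exists (Rmin d d'); split; [now apply Rmin_pos|]. intros w Hw.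
  specialize (H w (Rlt_le_trans _ _ _ Hw (Rmin_l _ _))).
  specialize (H' w (Rlt_le_trans _ _ _ Hw (Rmin_r _ _))).
  replace (f w * g w - f z * g z)%C
    with ((f w - f z) * (g w - g z) + ((f w - f z) * g z + f z * (g w - g z)))%C by ring.
  set (m := Rmin 1 (e / (2 * k))) in *.
  assert (m1 : m <= 1) by apply Rmin_l. assert (m2 : m <= e / (2 * k)) by apply Rmin_r.
  eapply Rle_lt_trans; [apply Cmod_triangle|].
  eapply Rle_lt_trans; [apply Rplus_le_compat_l, Cmod_triangle|]. rewrite !Cmod_mult.
  assert (P1 := Cmod_ge_0 (f w - f z)%C). assert (P2 := Cmod_ge_0 (g w - g z)%C).
  assert (P3 := Cmod_ge_0 (f z)). assert (P4 := Cmod_ge_0 (g z)).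
  set (a := Cmod (f w - f z)%C) in *. set (b := Cmod (g w - g z)%C) in *.
  apply Rle_lt_trans with (m * k).
  - unfold k. assert (a * b <= m * 1) by (apply Rmult_le_compat; lra).
    assert (a * Cmod (g z) <= m * Cmod (g z)) by (apply Rmult_le_compat_r; lra).
    assert (Cmod (f z) * b <= m * Cmod (f z)) by (rewrite Rmult_comm; apply Rmult_le_compat_r; lra).
    lra.
  - apply Rle_lt_trans with (e / (2 * k) * k); [apply Rmult_le_compat_r; lra|].
    replace (e / (2 * k) * k) with (e / 2) by (field; lra). lra.
Qed.

(** The horizontal sides of [ln r1, ln r2] x [0, 2 pi] cancel by periodicity of the exponential; the
    vertical sides are the two circle means. *)
Lemma cmean_radius (f : C -> C) (c : C) (r1 r2 : R) :
  0 < r1 -> r1 <= r2 -> (forall z, r1 <= Cmod (z - c)%C <= r2 -> cdiff f z) ->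
  cmean f c r1 = cmean f c r2.
Proof.
  intros H1 H12 Hf.
  assert (Hln : ln r1 <= ln r2) by (apply ln_le; lra).
  pose (g := fun z => f (c + cexp z)%C).
  assert (Hg : cdiff_rect g (ln r1) (ln r1 + (ln r2 - ln r1)) 0 (0 + 2 * PI)).
  { intros x y Hx _. apply (cdiff_comp f (fun z => c + cexp z)%C).
    - apply Hf. replace (c + cexp (x, y) - c)%C with (cexp (x, y)) by ring.
      rewrite Cmod_cexp. simpl. rewrite <- (exp_ln r1), <- (exp_ln r2) by lra.
      split; apply Rnot_lt_le; intros Hc; apply exp_lt_inv in Hc; lra.
    - apply cdiff_plus; [apply cdiff_const|apply cdiff_cexp]. }
  assert (G := goursat g (ln r1) 0 (ln r2 - ln r1) (2 * PI) ltac:(lra)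
    ltac:(left; apply two_PI_pos) Hg).
  replace (ln r1 + (ln r2 - ln r1)) with (ln r2) in * by ring.
  rewrite Rplus_0_l in *.
  unfold rect_int in G.
  rewrite (CInt_ext (fun t => g (t, 0)) (fun t => g (t, 2 * PI)) (ln r1) (ln r2) Hln) in G.
  2:{ intros t _. unfold g. do 2 f_equal. unfold cexp; simpl.
      now rewrite cos_2PI, sin_2PI, cos_0, sin_0. }
  unfold cmean. f_equal.
  assert (E : forall r, 0 < r -> CInt (fun t => f (circ c r t)) 0 (2 * PI) =
     CInt (fun t => g (ln r, t)) 0 (2 * PI)).
  { intros r Hr. apply CInt_ext; [left; apply two_PI_pos|]. intros t _. unfold g.
    now rewrite <- circ_exp, exp_ln. }
  rewrite !E by lra.
  set (u := CInt (fun t => g (ln r1, t)) 0 (2 * PI)) in *.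
  set (v := CInt (fun t => g (ln r2, t)) 0 (2 * PI)) in *.
  assert (K : (Ci * (v - u))%C = 0) by (rewrite <- G; ring).
  assert (K' : (Ci * (Ci * (v - u)))%C = 0) by (rewrite K; ring).
  rewrite Cmult_assoc in K'. replace (Ci * Ci)%C with (- (1))%C in K'
    by (unfold Ci, Cmult, Copp, RtoC; simpl; f_equal; ring).
  replace v with (u - - (1) * (v - u))%C by ring. rewrite K'. ring.
Qed.

Lemma mean_value (f : C -> C) (c : C) (r : R) :
  0 < r -> (forall z, Cmod (z - c)%C <= r -> cdiff f z) -> cmean f c r = f c.
Proof.
  intros Hr Hf. apply Ceq_minus, Cmod_eq_0. apply Rle_antisym; [|apply Cmod_ge_0].
  apply le_epsilon. intros e He. rewrite Rplus_0_l.
  destruct (cdiff_cont f c (Hf c ltac:(replace (c - c)%C with (RtoC 0) by ring; rewrite Cmod_0; lra)) e He)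
    as [d [Hd H]].
  assert (Hm : 0 < Rmin (d / 2) r) by (apply Rmin_pos; lra).
  assert (Hm2 := Rmin_l (d / 2) r). assert (Hm3 := Rmin_r (d / 2) r).
  set (m := Rmin (d / 2) r) in *.
  rewrite <- (cmean_radius f c m r); auto; [|intros z Hz; apply Hf; lra].
  replace (cmean f c m - f c)%C with (cmean f c m + cmean (fun _ => - f c) c m)%C
    by (rewrite cmean_const; ring).
  rewrite <- cmean_plus; try lra.
  - apply Cmod_cmean_le; try lra.
    + intros z Hz. apply ccont_plus; apply cdiff_ccont; [apply Hf; lra|apply cdiff_const].
    + intros z Hz. left. apply H. lra.
  - intros z Hz. apply cdiff_ccont, Hf. lra.
  - intros z Hz. apply cdiff_ccont, cdiff_const.
Qed.

(** Compares means on the two sides of a circle passing through a point where f is only known to be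
    continuous. *)
Lemma cmean_cont (f : C -> C) (c : C) (r0 R0 : R) :
  0 < r0 < R0 -> (forall z, Cmod (z - c)%C <= R0 -> ccont f z) ->
  forall e, 0 < e -> exists d, 0 < d /\ forall r, Rabs (r - r0) < d ->
    Cmod (cmean f c r - cmean f c r0)%C <= e.
Proof.
  intros Hr Hf e He.
  destruct (tube (fun d t => forall r, Rabs (r - r0) < d ->
     Cmod (f (circ c r t) - f (circ c r0 t))%C <= e) 0 (2 * PI)) as [d [Hd H]].
  - left. apply two_PI_pos.
  - intros d d' t Hd H r Hr'. apply H. lra.
  - intros t Ht.
    destruct (Hf (circ c r0 t) ltac:(rewrite Cmod_circ; lra) (e / 2) ltac:(lra)) as [d [Hd H]].
    destruct (circ_cont c r0 t (d / 2) ltac:(lra)) as [d' [Hd' H']].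
    exists (Rmin (d / 2) d'); split; [apply Rmin_pos; lra|].
    intros t' Ht' r Hr'.
    assert (K1 : Cmod (circ c r0 t' - circ c r0 t)%C < d / 2).
    { apply H'. eapply Rlt_le_trans; [apply Ht'|apply Rmin_r]. }
    assert (K2 : Cmod (circ c r t' - circ c r0 t')%C < d / 2).
    { unfold circ. replace (c + r * cexp (0%R, t') - (c + r0 * cexp (0%R, t')))%C
        with (RtoC (r - r0) * cexp (0%R, t'))%C by (rewrite RtoC_minus; ring).
      rewrite Cmod_mult, Cmod_R, Cmod_cexp. simpl. rewrite exp_0, Rmult_1_r.
      eapply Rlt_le_trans; [apply Hr'|apply Rmin_l]. }
    replace (f (circ c r t') - f (circ c r0 t'))%C
      with ((f (circ c r t') - f (circ c r0 t)) - (f (circ c r0 t') - f (circ c r0 t)))%C by ring.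
    eapply Rle_trans; [apply Cmod_triangle_minus|].
    assert (J1 : Cmod (f (circ c r t') - f (circ c r0 t))%C < e / 2).
    { apply H. replace (circ c r t' - circ c r0 t)%C
        with ((circ c r t' - circ c r0 t') + (circ c r0 t' - circ c r0 t))%C by ring.
      eapply Rle_lt_trans; [apply Cmod_triangle|]. lra. }
    assert (J2 : Cmod (f (circ c r0 t') - f (circ c r0 t))%C < e / 2) by (apply H; lra).
    lra.
  - assert (Hm1 : 0 < Rmin d (Rmin r0 (R0 - r0))) by (repeat apply Rmin_pos; lra).
    exists (Rmin d (Rmin r0 (R0 - r0))); split; auto. intros r Hr'.
    assert (T1 := Rlt_le_trans _ _ _ Hr' (Rmin_l _ _)).
    assert (T2 := Rlt_le_trans _ _ _ Hr' (Rle_trans _ _ _ (Rmin_r _ _) (Rmin_l _ _))).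
    assert (T3 := Rlt_le_trans _ _ _ Hr' (Rle_trans _ _ _ (Rmin_r _ _) (Rmin_r _ _))).
    apply Rabs_def2 in T2. apply Rabs_def2 in T3.
    assert (C1 : cont_on (fun t => f (circ c r t)) 0 (2 * PI)).
    { apply cont_on_circ; [lra|]. intros z Hz. apply Hf. lra. }
    assert (C2 : cont_on (fun t => f (circ c r0 t)) 0 (2 * PI)).
    { apply cont_on_circ; [lra|]. intros z Hz. apply Hf. lra. }
    assert (H2 := two_PI_pos).
    assert (Cm : cont_on (fun t => - (1) * f (circ c r0 t))%C 0 (2 * PI)).
    { apply (cont_on_circ (fun z => - (1) * f z)%C); [lra|]. intros z Hz.
      apply ccont_mult; [apply cdiff_ccont, cdiff_const|apply Hf; lra]. }
    unfold cmean.
    replace (_ - _)%C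
      with (RtoC (/ (2 * PI)) * CInt (fun t => f (circ c r t) + - (1) * f (circ c r0 t))%C 0 (2 * PI))%C.
    2:{ rewrite CInt_plus, CInt_mult; auto; try lra. ring. }
    rewrite Cmod_mult, Cmod_R, Rabs_pos_eq by (left; now apply Rinv_0_lt_compat).
    apply Rmult_le_reg_l with (2 * PI); auto.
    rewrite <- Rmult_assoc, Rinv_r, Rmult_1_l by lra.
    replace (2 * PI * e) with ((2 * PI - 0) * e) by ring.
    apply Cmod_CInt_le; [lra| |].
    + intros t Ht e' He'.
      destruct (C1 t Ht (e' / 2) ltac:(lra)) as [a [Ha1 Ha2]].
      destruct (Cm t Ht (e' / 2) ltac:(lra)) as [b [Hb1 Hb2]].
      exists (Rmin a b); split; [now apply Rmin_pos|]. intros t' Ht'.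
      specialize (Ha2 t' (Rlt_le_trans _ _ _ Ht' (Rmin_l _ _))).
      specialize (Hb2 t' (Rlt_le_trans _ _ _ Ht' (Rmin_r _ _))).
      match goal with |- Cmod ?X < _ => replace X with
        ((f (circ c r t') - f (circ c r t)) +
         (- (1) * f (circ c r0 t') - - (1) * f (circ c r0 t)))%C by ring end.
      eapply Rle_lt_trans; [apply Cmod_triangle|]. lra.
    + intros t Ht. replace (f (circ c r t) + - (1) * f (circ c r0 t))%C
        with (f (circ c r t) - f (circ c r0 t))%C by ring. now apply H.
Qed.

Lemma Cmod_refl_0 (z : C) : Cmod (z - z)%C = 0.
Proof. replace (z - z)%C with (RtoC 0) by ring. apply Cmod_0. Qed.

Lemma Cmod_dist_triangle (a b c : C) : Cmod (a - c)%C <= Cmod (a - b)%C + Cmod (b - c)%C.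
Proof. replace (a - c)%C with ((a - b) + (b - c))%C by ring. apply Cmod_triangle. Qed.

Lemma cdiff_shift (z w : C) : cdiff (fun u => u - w)%C z.
Proof. apply cdiff_minus; [apply cdiff_id|apply cdiff_const]. Qed.

Lemma cdiff_kernel (w z : C) : (z - w)%C <> 0 -> cdiff (fun u => / (u - w))%C z.
Proof.
  intros H. apply (cdiff_comp Cinv (fun u => u - w)%C); [now apply cdiff_inv|apply cdiff_shift].
Qed.

(** One has (z - c) / (z - w) = 1 + (w - c) / (z - w), and the mean of 1 / (z - w) is the same for
    all larger radii, while it tends to 0 as the radius grows. *)
Lemma cmean_kernel (c w : C) (r : R) :
  Cmod (w - c)%C < r -> cmean (fun z => (z - c) / (z - w))%C c r = 1.
Proof.
  intros Hw. assert (Hs := Cmod_ge_0 (w - c)%C). set (s := Cmod (w - c)%C) in *.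
  assert (far : forall r' z, r <= r' -> Cmod (z - c)%C = r' -> r' - s <= Cmod (z - w)%C).
  { intros r' z _ Hz. assert (H := Cmod_dist_triangle z w c). fold s in H. lra. }
  assert (K : forall r' z, r <= r' -> Cmod (z - c)%C = r' -> (z - w)%C <> 0).
  { intros r' z Hr Hz. apply Cmod_gt_0. generalize (far r' z Hr Hz). lra. }
  assert (Z : cmean (fun z => / (z - w))%C c r = 0).
  { apply Cmod_eq_0. apply Rle_antisym; [|apply Cmod_ge_0].
    apply le_epsilon. intros e He. rewrite Rplus_0_l.
    (* On a circle of radius at least s + 1 / e one has |z - w| >= 1 / e. *)
    assert (Hr' := Rmax_l r (s + / e)). assert (Hr'' := Rmax_r r (s + / e)).
    set (r' := Rmax r (s + / e)) in *.
    rewrite (cmean_radius _ c r r'); try lra.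
    - apply Cmod_cmean_le; [lra| |].
      + intros z Hz. apply cdiff_ccont, cdiff_kernel. now apply (K r').
      + intros z Hz. rewrite Cmod_inv by now apply (K r').
        rewrite <- (Rinv_inv e). apply Rinv_le_contravar; [now apply Rinv_0_lt_compat|].
        generalize (far r' z Hr' Hz). lra.
    - intros z [Hz1 Hz2]. apply cdiff_kernel. now apply (K (Cmod (z - c)%C)). }
  rewrite (cmean_ext c r _ (fun z => 1 + (w - c) * / (z - w))%C); [|lra|].
  2:{ intros z Hz. field. now apply (K r); [lra|]. }
  rewrite cmean_plus; try lra.
  - rewrite cmean_mult, Z, cmean_const; [ring|lra|].
    intros z Hz. apply cdiff_ccont, cdiff_kernel. apply (K r); auto; lra.
  - intros z Hz. apply cdiff_ccont, cdiff_const.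
  - intros z Hz. apply cdiff_ccont. apply cdiff_mult; [apply cdiff_const|].
    apply cdiff_kernel. apply (K r); auto; lra.
Qed.

(* The difference quotient at w is only continuous at w, so its circle means are
   constant for radii on either side of |w - c|, and equal by continuity. *)
Lemma cauchy_formula (f : C -> C) (c w : C) (r : R) :
  Cmod (w - c)%C < r -> (forall z, Cmod (z - c)%C <= r -> cdiff f z) ->
  f w = cmean (fun z => f z * ((z - c) / (z - w)))%C c r.
Proof.
  intros Hw Hf. assert (Hs := Cmod_ge_0 (w - c)%C). set (s := Cmod (w - c)%C) in *.
  assert (nz : forall z, Cmod (z - c)%C <> s -> (z - w)%C <> 0).
  { intros z Hz E. apply Hz. unfold s. f_equal. apply Ceq_minus in E. now subst. }
  destruct (Hf w ltac:(fold s; lra)) as [l Hl].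
  pose (g := fun z => if Ceq_dec z w then l else ((f z - f w) / (z - w))%C).
  (* The mean of g(z) (z - c) is, up to a constant factor, the contour integral of g; moreover G
     vanishes at c, so its mean over small circles is 0. *)
  pose (G := fun z => (g z * (z - c))%C).
  assert (Gdiff : forall z, Cmod (z - c)%C <= r -> z <> w -> cdiff G z).
  { intros z Hz Hzw. apply cdiff_mult; [|apply cdiff_shift].
    assert (H : (z - w)%C <> 0) by now apply Cminus_eq_contra.
    apply (cdiff_ext_loc (fun z => (f z - f w) / (z - w))%C g z (Cmod (z - w)%C)).
    - now apply Cmod_gt_0.
    - intros u Hu. unfold g. destruct (Ceq_dec u w) as [->|]; auto.
      rewrite Cmod_minus_sym in Hu. lra.
    - apply cdiff_div; auto; [|apply cdiff_shift].
      apply cdiff_minus; [now apply Hf|apply cdiff_const]. }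
  assert (Gcont : forall z, Cmod (z - c)%C <= r -> ccont G z).
  { intros z Hz. destruct (Ceq_dec z w) as [->|Hzw]; [|now apply cdiff_ccont, Gdiff].
    apply ccont_mult; [|apply cdiff_ccont, cdiff_shift].
    intros e He. destruct (proj1 (cderiv_iff f w l) Hl (e / 2) ltac:(lra)) as [d [Hd H]].
    exists d; split; auto. intros u Hu. unfold g.
    destruct (Ceq_dec w w) as [_|]; [|congruence].
    destruct (Ceq_dec u w) as [_|Huw]; [rewrite Cmod_refl_0; auto|].
    assert (Hu0 : (u - w)%C <> 0) by now apply Cminus_eq_contra.
    assert (Hu1 := proj1 (Cmod_gt_0 _) Hu0).
    replace ((f u - f w) / (u - w) - l)%C with ((f u - f w - l * (u - w)) / (u - w))%C by (field; auto).
    rewrite Cmod_div by auto.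
    apply Rle_lt_trans with (e / 2); [|lra].
    apply Rmult_le_reg_r with (Cmod (u - w)%C); auto.
    unfold Rdiv at 1. rewrite Rmult_assoc, Rinv_l, Rmult_1_r by lra. now apply H. }
  assert (G0 : cmean G c r = 0).
  { destruct (Req_dec s 0) as [E|E].
    - assert (Ewc : w = c) by (apply Ceq_minus, Cmod_eq_0, E).
      assert (Gf : forall z, G z = (f z - f c)%C).
      { intros z. unfold G, g. rewrite Ewc. destruct (Ceq_dec z c) as [->|H].
        - ring.
        - field. now apply Cminus_eq_contra. }
      rewrite (mean_value G c r); [rewrite Gf; ring|lra|].
      intros z Hz. apply (cdiff_ext (fun z => f z - f c)%C); [auto|].
      apply cdiff_minus; [now apply Hf|apply cdiff_const].
    - apply Cmod_eq_0. apply Rle_antisym; [|apply Cmod_ge_0].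
      apply le_epsilon. intros e He. rewrite Rplus_0_l.
      destruct (cmean_cont G c s r ltac:(lra) Gcont (e / 2) ltac:(lra)) as [d [Hd H]].
      assert (Hm : 0 < Rmin (d / 2) (Rmin s (r - s))) by (repeat apply Rmin_pos; lra).
      assert (m1 := Rmin_l (d / 2) (Rmin s (r - s))).
      assert (m2 := Rle_trans _ _ _ (Rmin_r (d / 2) (Rmin s (r - s))) (Rmin_l _ _)).
      assert (m3 := Rle_trans _ _ _ (Rmin_r (d / 2) (Rmin s (r - s))) (Rmin_r _ _)).
      set (m := Rmin (d / 2) (Rmin s (r - s))) in *.
      assert (K1 := H (s - m / 2) ltac:(apply Rabs_def1; lra)).
      assert (K2 := H (s + m / 2) ltac:(apply Rabs_def1; lra)).
      rewrite (cmean_radius G c (s + m / 2) r) in K2; try lra.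
      2:{ intros z Hz. apply Gdiff; [lra|]. intros ->. fold s in Hz. lra. }
      rewrite (mean_value G c (s - m / 2)) in K1; try lra.
      2:{ intros z Hz. apply Gdiff; [lra|]. intros ->. fold s in Hz. lra. }
      replace (G c) with (RtoC 0) in K1 by (unfold G; ring).
      rewrite Cmod_minus_sym in K1.
      replace (cmean G c r) with ((cmean G c r - cmean G c s) + (cmean G c s - 0))%C by ring.
      eapply Rle_trans; [apply Cmod_triangle|]. lra. }
  assert (Hr : 0 <= r) by lra.
  assert (Kz : forall z, Cmod (z - c)%C = r -> (z - w)%C <> 0) by (intros z Hz; apply nz; lra).
  assert (Kd : forall z, Cmod (z - c)%C = r -> cdiff (fun z => (z - c) / (z - w))%C z).
  { intros z Hz. apply cdiff_div; auto; apply cdiff_shift. }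
  assert (E : cmean G c r = (cmean (fun z => f z * ((z - c) / (z - w)))%C c r
      + - f w * cmean (fun z => (z - c) / (z - w))%C c r)%C).
  { rewrite <- cmean_mult, <- cmean_plus; auto.
    - apply cmean_ext; auto. intros z Hz. unfold G, g.
      destruct (Ceq_dec z w) as [->|]; [fold s in Hz; lra|]. field. now apply Kz.
    - intros z Hz. apply cdiff_ccont. apply cdiff_mult; [apply Hf; lra|now apply Kd].
    - intros z Hz. apply cdiff_ccont. apply cdiff_mult; [apply cdiff_const|now apply Kd].
    - intros z Hz. apply cdiff_ccont. now apply Kd. }
  rewrite G0, cmean_kernel in E by (fold s; lra).
  replace (f w) with (0 + f w)%C by ring. rewrite E. ring.
Qed.

(* Division-free form of the Lipschitz continuity of the difference quotient; as an
   inequality between values it survives pointwise limits and integration. *)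
Definition three_point (f : C -> C) (c : C) (rho K : R) : Prop :=
  forall v v', Cmod v <= rho -> Cmod v' <= rho ->
    Cmod (v' * (f (c + v) - f c) - v * (f (c + v') - f c))%C
    <= K * (Cmod v * Cmod v' * Cmod (v - v')%C).

(** By Cauchy's formula f(c + v) - f(c) is v times the mean of f(z) / (z - c - v). Subtracting two
    such means produces the factor v - v', and each kernel is at most 2 / r because |z - c - v| >= r
    / 2. *)
Lemma holomorphic_three_point (f : C -> C) (c : C) (r B : R) :
  0 < r -> (forall z, Cmod (z - c)%C <= r -> cdiff f z) ->
  (forall z, Cmod (z - c)%C = r -> Cmod (f z) <= B) ->
  three_point f c (r / 2) (4 * B / r ^ 2).
Proof.
  intros Hr Hf HB v v' Hv Hv'.
  assert (Kv : forall v z, Cmod v <= r / 2 -> Cmod (z - c)%C = r -> r / 2 <= Cmod (z - c - v)%C).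
  { intros u z Hu Hz. generalize (Cmod_minus_ge (z - c)%C u). lra. }
  assert (Kn : forall v z, Cmod v <= r / 2 -> Cmod (z - c)%C = r -> (z - c - v)%C <> 0).
  { intros u z Hu Hz. apply Cmod_gt_0. generalize (Kv u z Hu Hz). lra. }
  assert (Kc : forall z, Cmod (z - c)%C = r -> (z - c)%C <> 0).
  { intros z Hz. apply Cmod_gt_0. lra. }
  assert (Kd : forall v z, Cmod v <= r / 2 -> Cmod (z - c)%C = r ->
     cdiff (fun z => / (z - c - v))%C z).
  { intros u z Hu Hz. apply (cdiff_comp Cinv (fun z => z - c - u)%C).
    - apply cdiff_inv. now apply Kn.
    - apply cdiff_minus; [apply cdiff_shift|apply cdiff_const]. }
  assert (D : forall v, Cmod v <= r / 2 -> (f (c + v) - f c)%C =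
     (v * cmean (fun z => f z * / (z - c - v))%C c r)%C).
  { intros u Hu.
    rewrite (cauchy_formula f c (c + u)%C r); auto.
    2:{ replace (c + u - c)%C with u by ring. lra. }
    rewrite <- (mean_value f c r) at 1; auto.
    rewrite <- cmean_mult; [|lra|].
    2:{ intros z Hz. apply cdiff_ccont, cdiff_mult; [apply Hf; lra|now apply Kd]. }
    replace (cmean (fun z => f z * ((z - c) / (z - (c + u))))%C c r - cmean f c r)%C
      with (cmean (fun z => f z * ((z - c) / (z - (c + u))))%C c r + - (1) * cmean f c r)%C by ring.
    rewrite <- cmean_mult, <- cmean_plus; try lra.
    - apply cmean_ext; [lra|]. intros z Hz.
      replace (z - (c + u))%C with (z - c - u)%C by ring. field. now apply Kn.
    - intros z Hz. apply cdiff_ccont, cdiff_mult; [apply Hf; lra|].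
      apply cdiff_div; try apply cdiff_shift.
      replace (z - (c + u))%C with (z - c - u)%C by ring. now apply Kn.
    - intros z Hz. apply cdiff_ccont, cdiff_mult; [apply cdiff_const|apply Hf; lra].
    - intros z Hz. apply cdiff_ccont, Hf; lra. }
  rewrite !D by auto.
  replace (_ - _)%C with (v * v' * (cmean (fun z => f z * / (z - c - v))%C c r +
     - (1) * cmean (fun z => f z * / (z - c - v'))%C c r))%C by ring.
  assert (C1 : forall u, Cmod u <= r / 2 -> cont_circle (fun z => f z * / (z - c - u))%C c r).
  { intros u Hu z Hz. apply cdiff_ccont, cdiff_mult; [apply Hf; lra|now apply Kd]. }
  rewrite <- cmean_mult, <- cmean_plus; auto; try lra.
  2:{ intros z Hz. apply ccont_mult; [apply cdiff_ccont, cdiff_const|now apply C1]. }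
  rewrite (cmean_ext c r _ (fun z => (v - v') * (f z * / (z - c - v) * / (z - c - v')))%C); [|lra|].
  2:{ intros z Hz. field. split; apply Kn; auto. }
  assert (C2 : cont_circle (fun z => f z * / (z - c - v) * / (z - c - v'))%C c r).
  { intros z Hz. apply ccont_mult; [now apply C1|apply cdiff_ccont; now apply Kd]. }
  rewrite cmean_mult; auto; [|lra]. rewrite !Cmod_mult.
  replace (4 * B / r ^ 2 * (Cmod v * Cmod v' * Cmod (v - v')%C))
    with (Cmod v * Cmod v' * (Cmod (v - v')%C * (4 * B / r ^ 2))) by ring.
  apply Rmult_le_compat_l; [apply Rmult_le_pos; apply Cmod_ge_0|].
  apply Rmult_le_compat_l; [apply Cmod_ge_0|].
  apply Cmod_cmean_le; auto; [lra|]. intros z Hz.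
  rewrite !Cmod_mult, !Cmod_inv by (apply Kn; auto).
  assert (HB0 : 0 <= B) by (eapply Rle_trans; [apply Cmod_ge_0|apply (HB z Hz)]).
  assert (I : forall u, Cmod u <= r / 2 -> 0 <= / Cmod (z - c - u)%C <= 2 / r).
  { intros u Hu. assert (H := Kv u z Hu Hz). split.
    - left. apply Rinv_0_lt_compat. lra.
    - replace (2 / r) with (/ (r / 2)) by (field; lra). apply Rinv_le_contravar; lra. }
  replace (4 * B / r ^ 2) with (B * (2 / r) * (2 / r)) by (field; lra).
  destruct (I v Hv). destruct (I v' Hv').
  apply Rmult_le_compat; auto.
  - apply Rmult_le_pos; auto. apply Cmod_ge_0.
  - apply Rmult_le_compat; auto. apply Cmod_ge_0.
Qed.

Lemma C_cauchy_lim (u : nat -> C) (e : nat -> R) :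
  (forall eps, 0 < eps -> exists N, forall n, (N <= n)%nat -> e n < eps) ->
  (forall n m, (n <= m)%nat -> Cmod (u m - u n)%C <= e n) ->
  exists l, forall n, Cmod (u n - l)%C <= e n.
Proof.
  intros He Hu.
  assert (A : forall p : C -> R, (forall a b, Rabs (p a - p b) <= Cmod (a - b)%C) ->
     exists l, Un_cv (fun n => p (u n)) l).
  { intros p Hp. destruct (Rcomplete.R_complete (fun n => p (u n))) as [l Hl]; [|now exists l].
    intros eps Heps. destruct (He (eps / 2) ltac:(lra)) as [N HN].
    exists N. intros n m Hn Hm. unfold Rdist. eapply Rle_lt_trans; [apply Hp|].
    eapply Rle_lt_trans; [apply (Cmod_dist_triangle _ (u N))|].
    rewrite (Cmod_minus_sym (u N)).
    assert (h1 := Hu N n ltac:(lia)). assert (h2 := Hu N m ltac:(lia)). assert (h3 := HN N (le_n _)). lra. }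
  destruct (A Re) as [a Ha]; [intros x y; apply (re_le_Cmod (x - y)%C)|].
  destruct (A Im) as [b Hb]; [intros x y; apply (im_le_Cmod (x - y)%C)|].
  exists (a, b). intros n. apply le_epsilon. intros eps Heps.
  destruct (Ha (eps / 2) ltac:(lra)) as [N1 H1]. destruct (Hb (eps / 2) ltac:(lra)) as [N2 H2].
  set (m := (n + N1 + N2)%nat).
  assert (h1 := H1 m ltac:(lia)). assert (h2 := H2 m ltac:(lia)). unfold Rdist in *.
  eapply Rle_trans; [apply (Cmod_dist_triangle _ (u m))|].
  rewrite (Cmod_minus_sym (u n)).
  assert (h3 := Hu n m ltac:(lia)).
  assert (h4 := Cmod_le_abs (u m - (a, b))%C). simpl in h4.
  unfold Re, Im, Rminus in *. lra.
Qed.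

(** Divided by v v', the inequality says that the difference quotient is K-Lipschitz on the
    punctured disc. It thus converges along rho / (n + 1), to a limit within K |v| of the quotient
    at v. *)
Lemma three_point_derivative (f : C -> C) (c : C) (rho K : R) :
  0 < rho -> three_point f c rho K ->
  exists l, forall v, Cmod v <= rho ->
    Cmod (f (c + v) - f c - l * v)%C <= K * Cmod v ^ 2.
Proof.
  intros Hrho H.
  pose (v := fun n : nat => RtoC (rho / (INR n + 1))).
  assert (Hn : forall n, 0 < INR n + 1) by (intros n; generalize (pos_INR n); lra).
  assert (Hvp : forall n, 0 < rho / (INR n + 1)) by (intros n; now apply Rdiv_lt_0_compat).
  assert (Hvm : forall n, Cmod (v n) = rho / (INR n + 1)).
  { intros n. unfold v. rewrite Cmod_R, Rabs_pos_eq; auto. now left. }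
  assert (Hvle : forall n, Cmod (v n) <= rho).
  { intros n. rewrite Hvm. apply Rmult_le_reg_r with (INR n + 1); auto.
    unfold Rdiv. rewrite Rmult_assoc, Rinv_l, Rmult_1_r by (generalize (Hn n); lra).
    generalize (pos_INR n). nra. }
  assert (Hvn : forall n, v n <> 0) by (intros n; apply Cmod_gt_0; rewrite Hvm; auto).
  pose (D := fun u : C => ((f (c + u) - f c) / u)%C).
  assert (HD : forall a b, Cmod a <= rho -> Cmod b <= rho -> a <> 0 -> b <> 0 ->
     Cmod (D a - D b)%C <= K * Cmod (a - b)%C).
  { intros a b Ha Hb Ha0 Hb0. specialize (H a b Ha Hb).
    assert (pa := proj1 (Cmod_gt_0 a) Ha0). assert (pb := proj1 (Cmod_gt_0 b) Hb0).
    apply Rmult_le_reg_l with (Cmod a * Cmod b); [now apply Rmult_lt_0_compat|].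
    rewrite <- !Cmod_mult.
    replace (a * b * (D a - D b))%C with (b * (f (c + a) - f c) - a * (f (c + b) - f c))%C
      by (unfold D; field; auto).
    rewrite Cmod_mult. lra. }
  (* The sign of K follows from the Lipschitz bound at two distinct increments. *)
  assert (HK : 0 <= K).
  { assert (h := HD (v 0%nat) (v 1%nat) (Hvle _) (Hvle _) (Hvn _) (Hvn _)).
    assert (0 < Cmod (v 0%nat - v 1%nat)%C).
    { unfold v. rewrite <- RtoC_minus, Cmod_R. simpl.
      replace (rho / (0 + 1) - rho / (1 + 1)) with (rho / 2) by field.
      rewrite Rabs_pos_eq; lra. }
    generalize (Cmod_ge_0 (D (v 0%nat) - D (v 1%nat))%C). nra. }
  assert (Harch : forall eps, 0 < eps -> exists N, forall n, (N <= n)%nat -> K * (rho / (INR n + 1)) < eps).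
  { intros eps Heps. destruct (INR_unbounded (K * rho / eps)) as [N HN]. exists N.
    intros n Hle. apply le_INR in Hle.
    apply Rmult_lt_reg_r with (INR n + 1); auto.
    replace (K * (rho / (INR n + 1)) * (INR n + 1)) with (K * rho)
      by (field; generalize (Hn n); lra).
    apply Rmult_lt_compat_l with (r := eps) in HN; auto.
    replace (eps * (K * rho / eps)) with (K * rho) in HN by (field; lra). nra. }
  destruct (C_cauchy_lim (fun n => D (v n)) (fun n => K * (rho / (INR n + 1)))) as [l Hl]; auto.
  { intros n m Hnm. eapply Rle_trans; [apply HD; auto|]. apply Rmult_le_compat_l; auto.
    unfold v. rewrite <- RtoC_minus, Cmod_R.
    assert (rho / (INR m + 1) <= rho / (INR n + 1)).
    { apply Rmult_le_compat_l; [lra|]. apply Rinv_le_contravar; auto. apply le_INR in Hnm. lra. }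
    rewrite Rabs_minus_sym, Rabs_pos_eq by lra. generalize (Hvp m). lra. }
  exists l. intros u Hu.
  destruct (Ceq_dec u 0) as [->|Hu0].
  { replace (f (c + 0) - f c - l * 0)%C with (RtoC 0) by (rewrite Cplus_0_r; ring).
    rewrite Cmod_0. lra. }
  assert (pu := proj1 (Cmod_gt_0 u) Hu0).
  replace (f (c + u) - f c - l * u)%C with (u * (D u - l))%C by (unfold D; field; auto).
  rewrite Cmod_mult. replace (K * Cmod u ^ 2) with (Cmod u * (K * Cmod u)) by ring.
  apply Rmult_le_compat_l; [lra|].
  apply le_epsilon. intros eps Heps.
  destruct (Harch (eps / 2) ltac:(lra)) as [n HN]. specialize (HN n (le_n _)).
  eapply Rle_trans; [apply (Cmod_dist_triangle _ (D (v n)))|].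
  assert (h1 := Hl n). cbv beta in h1.
  assert (h2 := HD u (v n) Hu (Hvle n) Hu0 (Hvn n)).
  assert (h3 := Cmod_triangle_minus u (v n)). rewrite Hvm in h3.
  apply Rmult_le_compat_l with (r := K) in h3; auto. lra.
Qed.

Lemma three_point_cdiff (f : C -> C) (c : C) (rho K : R) :
  0 < rho -> three_point f c rho K -> cdiff f c.
Proof.
  intros Hrho H. destruct (three_point_derivative f c rho K Hrho H) as [l Hl].
  exists l. apply cderiv_iff. intros e He.
  exists (Rmin rho (e / (Rabs K + 1))); split.
  { apply Rmin_pos; auto. apply Rdiv_lt_0_compat; auto. generalize (Rabs_pos K). lra. }
  intros w Hw.
  assert (h1 := Rlt_le_trans _ _ _ Hw (Rmin_l _ _)).
  assert (h2 := Rlt_le_trans _ _ _ Hw (Rmin_r _ _)).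
  specialize (Hl (w - c)%C ltac:(lra)).
  replace (c + (w - c))%C with w in Hl by ring.
  eapply Rle_trans; [apply Hl|].
  replace (K * Cmod (w - c)%C ^ 2) with (K * Cmod (w - c)%C * Cmod (w - c)%C) by ring.
  apply Rmult_le_compat_r; [apply Cmod_ge_0|].
  assert (hk := Rabs_pos K). assert (hk' := Rle_abs K). assert (hp := Cmod_ge_0 (w - c)%C).
  apply Rle_trans with ((Rabs K + 1) * Cmod (w - c)%C).
  - apply Rmult_le_compat_r; lra.
  - apply Rle_trans with ((Rabs K + 1) * (e / (Rabs K + 1))); [apply Rmult_le_compat_l; lra|].
    right. field. lra.
Qed.

(** * Taylor coefficients, identity theorem, maximum principle *)

Fixpoint csum (u : nat -> C) (n : nat) : C :=
  match n with O => RtoC 0 | S m => (csum u m + u m)%C end.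

(** Cauchy's integral for the n-th Taylor coefficient at c, in the normalization of [cmean]. *)
Definition coef (f : C -> C) (c : C) (r : R) (n : nat) : C :=
  cmean (fun z => f z * (/ (z - c)) ^ n)%C c r.

Lemma cdiff_inv_pow (c z : C) (n : nat) : (z - c)%C <> 0 -> cdiff (fun z => (/ (z - c)) ^ n)%C z.
Proof. intros H. apply (cdiff_pow (fun z => / (z - c))%C). now apply cdiff_kernel. Qed.

Lemma coef_radius (f : C -> C) (c : C) (r1 r2 : R) (n : nat) :
  0 < r1 -> r1 <= r2 -> (forall z, r1 <= Cmod (z - c)%C <= r2 -> cdiff f z) ->
  coef f c r1 n = coef f c r2 n.
Proof.
  intros H1 H12 Hf. apply cmean_radius; auto. intros z Hz.
  apply cdiff_mult; auto. apply cdiff_inv_pow, Cmod_gt_0. lra.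
Qed.

Lemma Cmod_coef_le (f : C -> C) (c : C) (r B : R) (n : nat) :
  0 < r -> cont_circle f c r -> (forall z, Cmod (z - c)%C = r -> Cmod (f z) <= B) ->
  Cmod (coef f c r n) <= B * (/ r) ^ n.
Proof.
  intros Hr Hf HB. apply Cmod_cmean_le; [lra| |].
  - intros z Hz. apply ccont_mult; auto. apply cdiff_ccont, cdiff_inv_pow, Cmod_gt_0. lra.
  - intros z Hz. rewrite Cmod_mult, Cmod_pow, Cmod_inv by (apply Cmod_gt_0; lra).
    rewrite Hz. apply Rmult_le_compat_r; auto. apply pow_le. left. now apply Rinv_0_lt_compat.
Qed.

(** Iterating (z - c) / (z - w) = 1 + ((w - c) / (z - c)) (z - c) / (z - w) in Cauchy's formula
    leaves the mean of [rem N] as remainder; on the circle its factors are bounded by B, q^N and 1 /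
    (1 - q). *)
Lemma taylor (f : C -> C) (c w : C) (r B q : R) (N : nat) :
  0 < r -> 0 <= q < 1 -> Cmod (w - c)%C <= q * r ->
  (forall z, Cmod (z - c)%C <= r -> cdiff f z) ->
  (forall z, Cmod (z - c)%C = r -> Cmod (f z) <= B) ->
  Cmod (f w - csum (fun n => coef f c r n * (w - c) ^ n) N)%C <= B * q ^ N / (1 - q).
Proof.
  intros Hr Hq Hw Hf HB.
  assert (Hwr : Cmod (w - c)%C < r) by nra.
  pose (rem := fun N z => (f z * ((w - c) ^ N * (/ (z - c)) ^ N * ((z - c) / (z - w))))%C).
  assert (far : forall z, Cmod (z - c)%C = r -> r * (1 - q) <= Cmod (z - w)%C).
  { intros z Hz. generalize (Cmod_dist_triangle z w c). lra. }
  assert (Hrq : 0 < r * (1 - q)) by (apply Rmult_lt_0_compat; lra).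
  assert (K1 : forall z, Cmod (z - c)%C = r -> (z - w)%C <> 0).
  { intros z Hz. apply Cmod_gt_0. generalize (far z Hz). lra. }
  assert (K2 : forall z, Cmod (z - c)%C = r -> (z - c)%C <> 0).
  { intros z Hz. apply Cmod_gt_0. lra. }
  assert (Rc : forall N, cont_circle (rem N) c r).
  { intros n z Hz. apply cdiff_ccont. apply cdiff_mult; [apply Hf; lra|].
    apply cdiff_mult; [apply cdiff_mult; [apply cdiff_const|apply cdiff_inv_pow; auto]|].
    apply cdiff_div; auto; apply cdiff_shift. }
  assert (E : forall N, f w = (csum (fun n => coef f c r n * (w - c) ^ n) N + cmean (rem N) c r)%C).
  { intros n. induction n as [|n IH].
    - simpl. rewrite Cplus_0_l. rewrite (cauchy_formula f c w r) at 1; auto.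
      apply cmean_ext; [lra|]. intros z Hz. unfold rem. simpl. field. now apply K1.
    - rewrite IH at 1. simpl. rewrite <- Cplus_assoc. f_equal.
      unfold coef. rewrite Cmult_comm, <- cmean_mult, <- cmean_plus; try lra; auto.
      + apply cmean_ext; [lra|]. intros z Hz. unfold rem. simpl. field. auto.
      + intros z Hz. apply cdiff_ccont, cdiff_mult; [apply cdiff_const|].
        apply cdiff_mult; [apply Hf; lra|apply cdiff_inv_pow; auto].
      + intros z Hz. apply cdiff_ccont, cdiff_mult; [apply Hf; lra|apply cdiff_inv_pow; auto]. }
  rewrite (E N) at 1.
  replace (_ - _)%C with (cmean (rem N) c r) by ring.
  apply Cmod_cmean_le; [lra|apply Rc|]. intros z Hz. unfold rem.
  rewrite !Cmod_mult, !Cmod_pow, Cmod_div, Cmod_inv, Hz by auto.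
  assert (HB0 := Rle_trans _ _ _ (Cmod_ge_0 _) (HB z Hz)).
  replace (B * q ^ N / (1 - q)) with (B * (q ^ N * / (1 - q))) by (field; lra).
  apply Rmult_le_compat; [apply Cmod_ge_0| |now apply HB|].
  - apply Rmult_le_pos.
    + apply Rmult_le_pos; apply pow_le; [apply Cmod_ge_0|left; now apply Rinv_0_lt_compat].
    + apply Rmult_le_pos; [lra|]. left. apply Rinv_0_lt_compat. generalize (far z Hz); lra.
  - rewrite <- Rpow_mult_distr. apply Rmult_le_compat.
    + apply pow_le. apply Rmult_le_pos; [apply Cmod_ge_0|left; now apply Rinv_0_lt_compat].
    + apply Rmult_le_pos; [lra|]. left. apply Rinv_0_lt_compat. generalize (far z Hz); lra.
    + apply pow_incr. split.
      * apply Rmult_le_pos; [apply Cmod_ge_0|left; now apply Rinv_0_lt_compat].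
      * apply Rmult_le_reg_r with r; auto. rewrite Rmult_assoc, Rinv_l by lra. lra.
    + replace (/ (1 - q)) with (r * / (r * (1 - q))) by (field; lra).
      apply Rmult_le_compat_l; [lra|]. apply Rinv_le_contravar; auto.
Qed.

Lemma circle_param (c z : C) (r : R) :
  0 < r -> Cmod (z - c)%C = r -> exists t, 0 <= t <= 2 * PI /\ z = circ c r t.
Proof.
  intros Hr Hz.
  destruct (z - c)%C as [x y] eqn:E.
  assert (Hxy : x ^ 2 + y ^ 2 = r ^ 2).
  { rewrite <- Hz. rewrite Cmod2_alt. reflexivity. }
  assert (Hx : -1 <= x / r <= 1).
  { assert (-r <= x <= r) by (split; nra). split.
    - apply Rmult_le_reg_r with r; auto. unfold Rdiv. rewrite Rmult_assoc, Rinv_l; lra.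
    - apply Rmult_le_reg_r with r; auto. unfold Rdiv. rewrite Rmult_assoc, Rinv_l; lra. }
  assert (Ha := acos_bound (x / r)).
  assert (Hc := cos_acos _ Hx). assert (Hs := sin_acos _ Hx).
  assert (Hs' : r * sin (acos (x / r)) = Rabs y).
  { rewrite Hs. rewrite <- sqrt_Rsqr_abs.
    rewrite <- (sqrt_Rsqr r) at 1 by lra. rewrite <- sqrt_mult_alt by apply Rle_0_sqr.
    f_equal. unfold Rsqr. field_simplify; [|lra]. lra. }
  replace z with (c + (x, y))%C by (rewrite <- E; ring).
  destruct (Rle_dec 0 y) as [Hy|Hy].
  - exists (acos (x / r)). split; [lra|]. unfold circ. f_equal.
    unfold cexp, Cmult, RtoC; simpl. rewrite exp_0.
    rewrite Rabs_pos_eq in Hs' by auto. f_equal; [rewrite Hc; field; lra|lra].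
  - exists (2 * PI - acos (x / r)). split; [lra|]. unfold circ. f_equal.
    unfold cexp, Cmult, RtoC; simpl. rewrite exp_0.
    rewrite cos_minus, sin_minus, cos_2PI, sin_2PI.
    rewrite Rabs_left in Hs' by lra. f_equal; [rewrite Hc; field; lra|lra].
Qed.

Lemma circle_bound (f : C -> C -> C) (z0 c : C) (r : R) :
  0 < r ->
  (forall w, Cmod (w - c)%C = r -> exists d M, 0 < d /\
     forall z' w', Cmod (z' - z0)%C < d -> Cmod (w' - w)%C < d -> Cmod (f z' w') <= M) ->
  exists d M, 0 < d /\ forall z w, Cmod (z - z0)%C < d -> Cmod (w - c)%C = r -> Cmod (f z w) <= M.
Proof.
  intros Hr H.
  (* One parameter serves as radius d and as bound 1 / d, which makes the property stable under
     shrinking d, as [tube] requires. *)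
  destruct (tube (fun d t => forall z, Cmod (z - z0)%C < d -> Cmod (f z (circ c r t)) <= / d)
     0 (2 * PI)) as [d [Hd H']].
  - left. apply two_PI_pos.
  - intros d d' t Hd Ht z Hz. eapply Rle_trans; [apply Ht; lra|].
    apply Rinv_le_contravar; lra.
  - intros t _. destruct (H (circ c r t) ltac:(apply Cmod_circ; lra)) as (d & M & Hd & HM).
    destruct (circ_cont c r t d Hd) as [d' [Hd' Hc]].
    assert (HM0 := Rle_trans _ _ _ (Cmod_ge_0 _)
      (HM z0 (circ c r t) ltac:(rewrite Cmod_refl_0; auto) ltac:(rewrite Cmod_refl_0; auto))).
    assert (Hi : 0 < / (M + 1)) by (apply Rinv_0_lt_compat; lra).
    assert (Hm : 0 < Rmin (Rmin d d') (/ (M + 1))) by (repeat apply Rmin_pos; auto).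
    exists (Rmin (Rmin d d') (/ (M + 1))); split; auto.
    intros t' Ht' z Hz. apply Rle_trans with M.
    + apply HM.
      * eapply Rlt_le_trans; [apply Hz|]. eapply Rle_trans; [apply Rmin_l|apply Rmin_l].
      * apply Hc. eapply Rlt_le_trans; [apply Ht'|]. eapply Rle_trans; [apply Rmin_l|apply Rmin_r].
    + apply Rle_trans with (/ / (M + 1)); [rewrite Rinv_inv; lra|].
      apply Rinv_le_contravar; auto. apply Rmin_r.
  - exists d, (/ d). split; auto. intros z w Hz Hw.
    destruct (circle_param c w r Hr Hw) as [t [Ht ->]]. auto.
Qed.

Lemma ccont_locally_bounded (f : C -> C) (z : C) :
  ccont f z -> exists d M, 0 < d /\ forall w, Cmod (w - z)%C < d -> Cmod (f w) <= M.
Proof.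
  intros H. destruct (H 1 Rlt_0_1) as [d [Hd H']]. exists d, (Cmod (f z) + 1). split; auto.
  intros w Hw. generalize (H' w Hw) (Cmod_minus_ge (f w) (f z)). lra.
Qed.

(** The Taylor coefficients can be computed on a circle inside the small disc, so they vanish, and
    the remainder estimate forces f = 0 on the large one. *)
Lemma zero_disc (f : C -> C) (c : C) (r d : R) :
  0 < r -> 0 < d -> (forall z, Cmod (z - c)%C <= r -> cdiff f z) ->
  (forall z, Cmod (z - c)%C < d -> f z = 0) ->
  forall w, Cmod (w - c)%C < r -> f w = 0.
Proof.
  intros Hr Hd Hf H0 w Hw.
  assert (Hm : 0 < Rmin (d / 2) r) by (apply Rmin_pos; lra).
  assert (m1 := Rmin_l (d / 2) r). assert (m2 := Rmin_r (d / 2) r).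
  set (m := Rmin (d / 2) r) in *.
  assert (Hc : forall n, coef f c r n = 0).
  { intros n. rewrite <- (coef_radius f c m r n); auto; [|intros; apply Hf; lra].
    unfold coef. rewrite (cmean_ext c m _ (fun _ => RtoC 0)); [apply cmean_const|lra|].
    intros z Hz. rewrite H0 by lra. ring. }
  destruct (circle_bound (fun _ => f) c c r Hr) as (d' & B & Hd' & HB).
  { intros z Hz. destruct (ccont_locally_bounded f z) as (a & M & Ha & HM).
    { apply cdiff_ccont, Hf. lra. } exists a, M. split; auto. }
  assert (HB' : forall z, Cmod (z - c)%C = r -> Cmod (f z) <= B).
  { intros z Hz. apply (HB c); auto. now rewrite Cmod_refl_0. }
  assert (HB0 : 0 <= B).
  { eapply Rle_trans; [apply Cmod_ge_0|apply (HB' (circ c r 0))]. apply Cmod_circ. lra. }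
  assert (Hq : 0 <= Cmod (w - c)%C / r < 1).
  { split; [apply Rmult_le_pos; [apply Cmod_ge_0|left; now apply Rinv_0_lt_compat]|].
    apply Rmult_lt_reg_r with r; auto. unfold Rdiv. rewrite Rmult_assoc, Rinv_l; lra. }
  set (q := Cmod (w - c)%C / r) in *.
  assert (Hwq : Cmod (w - c)%C <= q * r) by (right; unfold q; field; lra).
  assert (Hs : forall N, csum (fun n => coef f c r n * (w - c) ^ n)%C N = 0).
  { induction N as [|N IH]; simpl; auto. rewrite IH, Hc. ring. }
  apply Cmod_eq_0. apply Rle_antisym; [|apply Cmod_ge_0].
  apply le_epsilon. intros e He. rewrite Rplus_0_l.
  destruct (pow_lt_1_zero q ltac:(rewrite Rabs_pos_eq; lra) (e * (1 - q) / (B + 1))) as [N HN].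
  { apply Rdiv_lt_0_compat; [apply Rmult_lt_0_compat|]; lra. }
  specialize (HN N (le_n _)). rewrite Rabs_pos_eq in HN by (apply pow_le; lra).
  assert (T := taylor f c w r B q N Hr Hq Hwq Hf HB'). rewrite Hs in T.
  replace (f w - 0)%C with (f w) in T by ring.
  eapply Rle_trans; [apply T|].
  apply Rmult_le_reg_r with (1 - q); [lra|].
  replace (B * q ^ N / (1 - q) * (1 - q)) with (B * q ^ N) by (field; lra).
  apply Rle_trans with ((B + 1) * (e * (1 - q) / (B + 1))).
  - apply Rmult_le_compat; try lra. apply pow_le; lra.
  - right. field. lra.
Qed.

(** Connectedness in bisection form: on a short enough subinterval, vanishing near one point passes
    to every other point by [zero_disc]. *)
Lemma identity_segment (f : C -> C) (y x1 x2 : R) :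
  x1 <= x2 ->
  (forall t, x1 <= t <= x2 -> exists d, 0 < d /\ forall z, Cmod (z - (t, y))%C < d -> cdiff f z) ->
  (exists d, 0 < d /\ forall z, Cmod (z - (x2, y))%C < d -> f z = 0) ->
  f (x1, y) = 0.
Proof.
  intros H12 Hf H0.
  pose (zero_near := fun t => exists d, 0 < d /\ forall z, Cmod (z - (t, y))%C < d -> f z = 0).
  pose (Q := fun x (_ : R) s => forall t t', x <= t <= x + s * (x2 - x1) ->
     x <= t' <= x + s * (x2 - x1) -> zero_near t -> zero_near t').
  assert (H : Q x1 0 1).
  { apply (box_bisection Q (x2 - x1) 0 x1 0); try lra.
    - intros x y0 s Hs h1 h2 h3 h4 H1 H2 h5 h6 t t' Ht Ht' Hz. unfold Q in *.
      assert (0 <= s / 2 * (x2 - x1)) by (apply Rmult_le_pos; lra).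
      set (m := x + s / 2 * (x2 - x1)) in *.
      replace (m + s / 2 * (x2 - x1)) with (x + s * (x2 - x1)) in * by (unfold m; field).
      assert (zero_near m).
      { destruct (Rle_dec t m); [apply (H1 t)|apply (H2 t)]; auto; unfold m in *; lra. }
      destruct (Rle_dec t' m); [apply (H1 m)|apply (H2 m)]; auto; unfold m in *; lra.
    - intros p q Hp Hq. destruct (Hf p ltac:(lra)) as [d [Hd H]].
      (* With quarters of d, the disc of radius d / 2 about t stays within d of p and contains the
         disc of radius d / 4 about t'. *)
      exists (d / 4 / (x2 - x1 + 1)); split; [apply Rdiv_lt_0_compat; lra|].
      intros x y' s Hs h1 h2 h3 h4 Hx h5 t t' Ht Ht' [e [He Hz]].
      assert (Hsd : s * (x2 - x1) < d / 4).
      { apply Rle_lt_trans with (s * (x2 - x1 + 1)); [apply Rmult_le_compat_l; lra|].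
        apply Rlt_le_trans with (d / 4 / (x2 - x1 + 1) * (x2 - x1 + 1)).
        - apply Rmult_lt_compat_r; lra.
        - right. field. lra. }
      assert (Hdist : forall a b, Cmod ((a, y) - (b, y))%C = Rabs (a - b)).
      { intros a b. rewrite <- Cmod_R. f_equal. unfold Cminus, Cplus, Copp, RtoC; simpl. f_equal; ring. }
      exists (d / 4). split; [lra|]. intros z Hzt'.
      apply (zero_disc f (t, y) (d / 2) e); try lra; auto.
      + intros u Hu. apply H.
        eapply Rle_lt_trans; [apply (Cmod_dist_triangle _ (t, y))|]. rewrite Hdist.
        assert (Rabs (t - p) < d / 4) by (apply Rabs_def1; lra). lra.
      + eapply Rle_lt_trans; [apply (Cmod_dist_triangle _ (t', y))|]. rewrite Hdist.
        assert (Rabs (t' - t) < d / 4) by (apply Rabs_def1; lra). lra. }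
  destruct (H x2 x1 ltac:(lra) ltac:(lra) H0) as [d [Hd Hz]].
  apply Hz. now rewrite Cmod_refl_0.
Qed.

(** If no value were maximal, each point would be beaten by some value of u, which by upper
    semicontinuity dominates u near that point; bisection would yield one value dominating all. *)
Lemma rect_max (u : C -> R) (x0 y0 A B : R) :
  0 <= A -> 0 <= B ->
  (forall x y, x0 <= x <= x0 + A -> y0 <= y <= y0 + B -> forall e, 0 < e ->
     exists d, 0 < d /\ forall z, Cmod (z - (x, y))%C < d -> u z < u (x, y) + e) ->
  exists p q, x0 <= p <= x0 + A /\ y0 <= q <= y0 + B /\
    forall x y, x0 <= x <= x0 + A -> y0 <= y <= y0 + B -> u (x, y) <= u (p, q).
Proof.
  intros HA HB Hu. apply NNPP. intros HN.
  pose (P := fun x y s => exists p q, x0 <= p <= x0 + A /\ y0 <= q <= y0 + B /\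
    forall x' y', x <= x' <= x + s * A -> y <= y' <= y + s * B -> u (x', y') <= u (p, q)).
  assert (H : P x0 y0 1).
  2:{ apply HN. destruct H as (p & q & Hp & Hq & H). exists p, q. split; [|split]; auto.
      intros x y Hx Hy. apply H; lra. }
  apply (box_bisection P A B); auto.
  - intros x y s Hs h1 h2 h3 h4 H1 H2 H3 H4.
    assert (join : forall (S1 S2 : R * R -> Prop),
       (exists p q, x0 <= p <= x0 + A /\ y0 <= q <= y0 + B /\ forall z, S1 z -> u z <= u (p, q)) ->
       (exists p q, x0 <= p <= x0 + A /\ y0 <= q <= y0 + B /\ forall z, S2 z -> u z <= u (p, q)) ->
       (exists p q, x0 <= p <= x0 + A /\ y0 <= q <= y0 + B /\ forall z, S1 z \/ S2 z -> u z <= u (p, q))).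
    { intros S1 S2 (p & q & Hp & Hq & K) (p' & q' & Hp' & Hq' & K').
      destruct (Rle_dec (u (p, q)) (u (p', q'))).
      - exists p', q'. split; [|split]; auto. intros z [Hz|Hz]; [specialize (K z Hz); lra|auto].
      - exists p, q. split; [|split]; auto. intros z [Hz|Hz]; [auto|specialize (K' z Hz); lra]. }
    assert (conv : forall a b t, P a b t -> exists p q, x0 <= p <= x0 + A /\ y0 <= q <= y0 + B /\
       forall z : R * R, (a <= fst z <= a + t * A /\ b <= snd z <= b + t * B) -> u z <= u (p, q)).
    { intros a b t (p & q & Hp & Hq & K). exists p, q. split; [|split]; auto.
      intros [z1 z2] [Ha Hb]. now apply K. }
    destruct (join _ _ (join _ _ (conv _ _ _ H1) (conv _ _ _ H2))
      (join _ _ (conv _ _ _ H3) (conv _ _ _ H4))) as (p & q & Hp & Hq & K).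
    exists p, q. split; [|split]; auto. intros a b Ha Hb. apply K. simpl.
    assert (s / 2 * A + s / 2 * A = s * A) by field.
    assert (s / 2 * B + s / 2 * B = s * B) by field.
    destruct (Rle_dec a (x + s / 2 * A)); destruct (Rle_dec b (y + s / 2 * B)).
    + left; left; split; lra.
    + right; left; split; lra.
    + left; right; split; lra.
    + right; right; split; lra.
  - intros p q Hp Hq.
    destruct (classic (exists x y, x0 <= x <= x0 + A /\ y0 <= y <= y0 + B /\ u (p, q) < u (x, y)))
      as [(p' & q' & Hp' & Hq' & Hlt)|Hn].
    2:{ exfalso. apply HN. exists p, q. split; [|split]; auto. intros x y Hx Hy.
        apply Rnot_lt_le. intros Hlt. apply Hn. exists x, y. auto. }
    destruct (Hu p q Hp Hq (u (p', q') - u (p, q)) ltac:(lra)) as [d [Hd H]].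
    exists (d / (A + B + 1)); split; [apply Rdiv_lt_0_compat; lra|].
    intros x y s Hs h1 h2 h3 h4 Hx Hy. exists p', q'. split; [|split]; auto.
    intros a b Ha Hb.
    assert (Hsd' : s * (A + B) < d).
    { apply Rle_lt_trans with (s * (A + B + 1)); [apply Rmult_le_compat_l; lra|].
      apply Rlt_le_trans with (d / (A + B + 1) * (A + B + 1)).
      - apply Rmult_lt_compat_r; lra.
      - right. field. lra. }
    assert (Hab : Cmod ((a, b) - (p, q))%C <= s * (A + B)).
    { eapply Rle_trans; [apply Cmod_le_abs|]. simpl.
      assert (Rabs (a + - p) <= s * A) by (apply Rabs_le; lra).
      assert (Rabs (b + - q) <= s * B) by (apply Rabs_le; lra). lra. }
    specialize (H (a, b) ltac:(lra)). lra.
Qed.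

(* At an interior maximum p of |G| + delta |z - z0|^2, the function exp of
   k G + 2 delta conj(p - z0) (z - p), with k G(p) = |G(p)|, violates the mean value property. *)
Lemma max_principle (G : C -> C) (x0 y0 A B M : R) :
  0 <= A -> 0 <= B -> cdiff_rect G x0 (x0 + A) y0 (y0 + B) ->
  (forall x y, x0 <= x <= x0 + A -> y0 <= y <= y0 + B ->
     x = x0 \/ x = x0 + A \/ y = y0 \/ y = y0 + B -> Cmod (G (x, y)) <= M) ->
  forall x y, x0 <= x <= x0 + A -> y0 <= y <= y0 + B -> Cmod (G (x, y)) <= M.
Proof.
  intros HA HB HG Hedge x y Hx Hy.
  apply le_epsilon. intros e He.
  set (D := (A + B) ^ 2 + 1).
  assert (HD : 0 < D) by (unfold D; generalize (pow2_ge_0 (A + B)); lra).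
  (* Scaled so that the quadratic perturbation is at most e on the whole rectangle. *)
  set (dl := e / D). assert (Hdl : 0 < dl) by now apply Rdiv_lt_0_compat.
  set (z0 := (x0, y0) : C).
  pose (u := fun z => Cmod (G z) + dl * Cmod (z - z0)%C ^ 2).
  assert (HDb : forall x y, x0 <= x <= x0 + A -> y0 <= y <= y0 + B -> dl * Cmod ((x, y) - z0)%C ^ 2 <= e).
  { intros a b Ha Hb. apply Rle_trans with (dl * D).
    - apply Rmult_le_compat_l; [lra|]. unfold D.
      assert (Cmod ((a, b) - z0)%C <= A + B).
      { eapply Rle_trans; [apply Cmod_le_abs|]. simpl.
        assert (Rabs (a + - x0) <= A) by (apply Rabs_le; lra).
        assert (Rabs (b + - y0) <= B) by (apply Rabs_le; lra). lra. }
      assert (Cmod ((a, b) - z0)%C ^ 2 <= (A + B) ^ 2) by (apply pow_incr; split; auto; apply Cmod_ge_0).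
      lra.
    - right. unfold dl. field. lra. }
  destruct (rect_max u x0 y0 A B HA HB) as (p & q & Hp & Hq & Hmax).
  { intros a b Ha Hb e' He'.
    destruct (cdiff_ccont _ _ (HG a b Ha Hb) (e' / 2) ltac:(lra)) as [d [Hd H]].
    destruct (ccont_mult (fun z => z - z0)%C (fun z => z - z0)%C (a, b)
      (cdiff_ccont _ _ (cdiff_shift _ _)) (cdiff_ccont _ _ (cdiff_shift _ _))
      (e' / 2 / dl)) as [d' [Hd' H']].
    { apply Rdiv_lt_0_compat; lra. }
    exists (Rmin d d'); split; [now apply Rmin_pos|]. intros z Hz.
    specialize (H z (Rlt_le_trans _ _ _ Hz (Rmin_l _ _))).
    specialize (H' z (Rlt_le_trans _ _ _ Hz (Rmin_r _ _))). cbv beta in H'.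
    assert (h1 := Cmod_minus_ge (G z) (G (a, b))).
    assert (h2 := Cmod_minus_ge ((z - z0) * (z - z0))%C (((a, b) - z0) * ((a, b) - z0))%C).
    rewrite !Cmod_mult in h2. unfold u.
    assert (h3 : dl * (Cmod (z - z0)%C * Cmod (z - z0)%C - Cmod ((a, b) - z0)%C * Cmod ((a, b) - z0)%C)
      < dl * (e' / 2 / dl)) by (apply Rmult_lt_compat_l; lra).
    replace (dl * (e' / 2 / dl)) with (e' / 2) in h3 by (field; lra).
    simpl. lra. }
  assert (Hfin : u (p, q) <= M + e -> Cmod (G (x, y)) <= M + e).
  { intros H. specialize (Hmax x y Hx Hy). unfold u in *.
    assert (0 <= dl * Cmod ((x, y) - z0)%C ^ 2) by (apply Rmult_le_pos; [lra|apply pow2_ge_0]). lra. }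
  apply Hfin.
  destruct (classic (p = x0 \/ p = x0 + A \/ q = y0 \/ q = y0 + B)) as [Hb|Hb].
  { unfold u. generalize (Hedge p q Hp Hq Hb) (HDb p q Hp Hq). lra. }
  exfalso.
  assert (Hp' : x0 < p < x0 + A).
  { split; [destruct (proj1 Hp)|destruct (proj2 Hp)]; auto; subst; tauto. }
  assert (Hq' : y0 < q < y0 + B).
  { split; [destruct (proj1 Hq)|destruct (proj2 Hq)]; auto; subst; tauto. }
  set (r := Rmin (Rmin (p - x0) (x0 + A - p)) (Rmin (q - y0) (y0 + B - q))).
  assert (Hr : 0 < r) by (unfold r; repeat apply Rmin_pos; lra).
  assert (Hr1 : r <= p - x0 /\ r <= x0 + A - p /\ r <= q - y0 /\ r <= y0 + B - q).
  { unfold r. assert (t1 := Rmin_l (Rmin (p - x0) (x0 + A - p)) (Rmin (q - y0) (y0 + B - q))).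
    assert (t2 := Rmin_r (Rmin (p - x0) (x0 + A - p)) (Rmin (q - y0) (y0 + B - q))).
    assert (t3 := Rmin_l (p - x0) (x0 + A - p)). assert (t4 := Rmin_r (p - x0) (x0 + A - p)).
    assert (t5 := Rmin_l (q - y0) (y0 + B - q)). assert (t6 := Rmin_r (q - y0) (y0 + B - q)).
    lra. }
  assert (Hin : forall a b, Cmod ((a, b) - (p, q))%C <= r -> x0 <= a <= x0 + A /\ y0 <= b <= y0 + B).
  { intros a b H.
    assert (h1 := Rle_trans _ _ _ (re_le_Cmod ((a, b) - (p, q))%C) H).
    assert (h2 := Rle_trans _ _ _ (im_le_Cmod ((a, b) - (p, q))%C) H). simpl in h1, h2.
    apply Rabs_le_between in h1. apply Rabs_le_between in h2. lra. }
  assert (Hk : exists k, Cmod k = 1 /\ (k * G (p, q))%C = RtoC (Cmod (G (p, q)))).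
  { destruct (Ceq_dec (G (p, q)) 0) as [E|E].
    - exists 1. rewrite Cmod_1, E, Cmod_0. split; auto. ring.
    - assert (E' := proj1 (Cmod_gt_0 _) E).
      assert (E'' : RtoC (Cmod (G (p, q))) <> 0) by (intros h; apply RtoC_inj in h; lra).
      exists (RtoC (Cmod (G (p, q))) / G (p, q))%C. split.
      + rewrite Cmod_div, Cmod_R, Rabs_pos_eq by (auto; lra). field. lra.
      + field. auto. }
  destruct Hk as [k [Hk1 Hk2]].
  pose (H := fun z => (k * G z + 2 * dl * Cconj ((p, q) - z0) * (z - (p, q)))%C).
  assert (HHd : forall z, Cmod (z - (p, q))%C <= r -> cdiff (fun z => cexp (H z)) z).
  { intros [a b] Hz. apply (cdiff_comp cexp H); [apply cdiff_cexp|].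
    destruct (Hin a b Hz) as [Ha Hb'].
    apply (cdiff_plus (fun z => k * G z)%C (fun z => 2 * dl * Cconj ((p, q) - z0) * (z - (p, q)))%C).
    - apply (cdiff_mult (fun _ => k) G); [apply cdiff_const|now apply HG].
    - apply (cdiff_mult (fun _ => 2 * dl * Cconj ((p, q) - z0))%C); [apply cdiff_const|apply cdiff_shift]. }
  assert (MV := mean_value (fun z => cexp (H z)) (p, q) r Hr HHd). cbv beta in MV.
  assert (Hle : Cmod (cexp (H (p, q))) <= exp (Cmod (G (p, q)) - dl * r ^ 2)).
  { rewrite <- MV. apply Cmod_cmean_le; [lra| |].
    - intros z Hz. apply cdiff_ccont, HHd. lra.
    - intros [a b] Hz. rewrite Cmod_cexp.
      (* With z = (a, b) and p read as the point (p, q), |z - z0|^2 = |p - z0|^2 + 2 Re(conj(p - z0)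
         (z - p)) + |z - p|^2. The linear term of H thus reproduces the perturbation up to dl r^2,
         and maximality of u at p gives the bound. *)
      assert (HRe : Re (H (a, b)) <= Cmod (G (p, q)) - dl * r ^ 2).
      { destruct (Hin a b ltac:(lra)) as [Ha Hb'].
        assert (h := Hmax a b Ha Hb'). unfold u in h.
        assert (h1 : Re (k * G (a, b))%C <= Cmod (G (a, b))).
        { eapply Rle_trans; [apply Rle_abs|]. eapply Rle_trans; [apply re_le_Cmod|].
          rewrite Cmod_mult, Hk1. lra. }
        assert (h2 : Re (H (a, b)) = Re (k * G (a, b))%C
           + 2 * dl * ((p - x0) * (a - p) + (q - y0) * (b - q))).
        { unfold H, z0. rewrite re_plus. f_equal. unfold Cmult, Cconj, Cminus, Cplus, Copp, RtoC; simpl. ring. }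
        rewrite <- Hz.
        rewrite !Cmod2_alt in *. unfold z0, Re, Im in *. simpl in *.
        match type of h with ?l <= ?rr => assert (h3 : l - rr <= 0) by lra end.
        rewrite h2. clear h2 h.
        replace (dl * _) with (dl * ((a - p) ^ 2 + (b - q) ^ 2)) by (simpl; ring).
        ring_simplify in h3. ring_simplify. ring_simplify in h1. nra. }
      destruct HRe as [HRe|HRe]; [left; now apply exp_increasing|right; now rewrite HRe]. }
  rewrite Cmod_cexp in Hle.
  replace (Re (H (p, q))) with (Cmod (G (p, q))) in Hle.
  2:{ unfold H. rewrite Hk2. replace ((p, q) - (p, q))%C with (RtoC 0) by ring.
      rewrite Cmult_0_r, Cplus_0_r. reflexivity. }
  assert (0 < dl * r ^ 2) by (apply Rmult_lt_0_compat; auto; now apply pow_lt).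
  assert (exp (Cmod (G (p, q)) - dl * r ^ 2) < exp (Cmod (G (p, q)))) by (apply exp_increasing; lra).
  lra.
Qed.

(** * Limits and means of holomorphic functions *)

(** The three-point inequality involves only three values, and its constant depends only on B and r;
    it therefore survives a pointwise limit. *)
Lemma cdiff_limit (F : nat -> C -> C) (f : C -> C) (c : C) (r B : R) :
  0 < r -> (forall n z, Cmod (z - c)%C <= r -> cdiff (F n) z) ->
  (forall n z, Cmod (z - c)%C <= r -> Cmod (F n z) <= B) ->
  (forall z, Cmod (z - c)%C <= r -> forall e, 0 < e ->
     exists N, forall n, (N <= n)%nat -> Cmod (F n z - f z)%C <= e) ->
  cdiff f c.
Proof.
  intros Hr Hd HB Hlim. apply (three_point_cdiff f c (r / 2) (4 * B / r ^ 2)); [lra|].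
  intros v v' Hv Hv'. apply le_epsilon. intros e He.
  set (k := 2 * (Cmod v + Cmod v' + 1)).
  assert (Hv0 := Cmod_ge_0 v). assert (Hv0' := Cmod_ge_0 v').
  assert (Hk : 0 < k) by (unfold k; lra).
  assert (Hek : 0 < e / k) by now apply Rdiv_lt_0_compat.
  destruct (Hlim c ltac:(rewrite Cmod_refl_0; lra) (e / k) Hek) as [N0 H0].
  destruct (Hlim (c + v)%C ltac:(replace (c + v - c)%C with v by ring; lra) (e / k) Hek) as [N1 H1].
  destruct (Hlim (c + v')%C ltac:(replace (c + v' - c)%C with v' by ring; lra) (e / k) Hek) as [N2 H2].
  set (n := (N0 + N1 + N2)%nat).
  specialize (H0 n ltac:(lia)). specialize (H1 n ltac:(lia)). specialize (H2 n ltac:(lia)).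
  assert (T := holomorphic_three_point (F n) c r B Hr (Hd n)
    (fun z Hz => HB n z (Req_le _ _ Hz)) v v' Hv Hv').
  replace (v' * (f (c + v) - f c) - v * (f (c + v') - f c))%C
    with ((v' * (F n (c + v) - F n c) - v * (F n (c + v') - F n c))
      - (v' * ((F n (c + v) - f (c + v)) - (F n c - f c))
         - v * ((F n (c + v') - f (c + v')) - (F n c - f c))))%C by ring.
  eapply Rle_trans; [apply Cmod_triangle_minus|]. apply Rplus_le_compat; [exact T|].
  eapply Rle_trans; [apply Cmod_triangle_minus|]. rewrite !Cmod_mult.
  assert (t1 := Cmod_triangle_minus (F n (c + v) - f (c + v))%C (F n c - f c)%C).
  assert (t2 := Cmod_triangle_minus (F n (c + v') - f (c + v'))%C (F n c - f c)%C).
  apply Rle_trans with (Cmod v' * (2 * (e / k)) + Cmod v * (2 * (e / k))).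
  - apply Rplus_le_compat; apply Rmult_le_compat_l; lra.
  - apply Rle_trans with (k * (e / k)); [|right; field; lra].
    clear - Hek Hv0 Hv0'. unfold k at 3. set (t := e / k) in *. clearbody t. nra.
Qed.

(** The three-point inequality holds for all functions F(., w) with the same constant, so it can be
    averaged over w; this takes the place of differentiation under the integral. *)
Lemma cdiff_cmean (F : C -> C -> C) (z0 c : C) (r rho B : R) :
  0 <= r -> 0 < rho ->
  (forall z w, Cmod (z - z0)%C <= rho -> Cmod (w - c)%C = r ->
     cdiff (fun u => F u w) z /\ ccont (F z) w /\ Cmod (F z w) <= B) ->
  cdiff (fun z => cmean (F z) c r) z0.
Proof.
  intros Hr Hrho H. apply (three_point_cdiff _ z0 (rho / 2) (4 * B / rho ^ 2)); [lra|].
  intros v v' Hv Hv'.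
  assert (C0 : cont_circle (F z0) c r) by (intros w Hw; apply H; auto; rewrite Cmod_refl_0; lra).
  assert (C1 : forall v, Cmod v <= rho / 2 -> cont_circle (F (z0 + v)%C) c r).
  { intros u Hu w Hw. apply H; auto. replace (z0 + u - z0)%C with u by ring. lra. }
  assert (C2 : forall (k : C) f, cont_circle f c r -> cont_circle (fun w => k * f w)%C c r).
  { intros k f Hf w Hw. apply ccont_mult; [apply cdiff_ccont, cdiff_const|now apply Hf]. }
  replace (_ - _)%C with ((v' * cmean (F (z0 + v)%C) c r + - v * cmean (F (z0 + v')%C) c r)
     + (v - v') * cmean (F z0) c r)%C by ring.
  assert (C3 : cont_circle (fun w => v' * F (z0 + v) w + - v * F (z0 + v') w)%C c r).
  { intros w Hw. apply ccont_plus; apply C2; auto. }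
  rewrite <- !cmean_mult, <- !cmean_plus; auto.
  apply Cmod_cmean_le; auto.
  - intros w Hw. apply ccont_plus; [now apply C3|now apply C2].
  - intros w Hw.
    replace (_ + _)%C with (v' * (F (z0 + v) w - F z0 w) - v * (F (z0 + v') w - F z0 w))%C by ring.
    apply (holomorphic_three_point (fun z => F z w) z0 rho B); auto.
    + intros z Hz. apply H; auto.
    + intros z Hz. apply H; auto. lra.
Qed.

(** The three-point inequality with one increment frozen at h = r / 2, where |f(c + h) - f(c)| <= 2
    B. *)
Lemma holomorphic_lipschitz (f : C -> C) (c v : C) (r B : R) :
  0 < r -> (forall z, Cmod (z - c)%C <= r -> cdiff f z) ->
  (forall z, Cmod (z - c)%C <= r -> Cmod (f z) <= B) -> Cmod v <= r / 2 ->
  Cmod (f (c + v) - f c)%C <= 8 * B / r * Cmod v.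
Proof.
  intros Hr Hf HB Hv.
  set (h := RtoC (r / 2)). assert (Hh : Cmod h = r / 2) by (unfold h; rewrite Cmod_R, Rabs_pos_eq; lra).
  assert (T := holomorphic_three_point f c r B Hr Hf (fun z Hz => HB z (Req_le _ _ Hz)) v h Hv ltac:(lra)).
  assert (B1 : Cmod (f (c + h) - f c)%C <= 2 * B).
  { eapply Rle_trans; [apply Cmod_triangle_minus|].
    assert (a1 := HB (c + h)%C ltac:(replace (c + h - c)%C with h by ring; lra)).
    assert (a2 := HB c ltac:(rewrite Cmod_refl_0; lra)). lra. }
  assert (HB0 := Rle_trans _ _ _ (Cmod_ge_0 _) (HB c ltac:(rewrite Cmod_refl_0; lra))).
  assert (Hvh : Cmod (v - h)%C <= r) by (eapply Rle_trans; [apply Cmod_triangle_minus|]; lra).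
  assert (Hv0 := Cmod_ge_0 v).
  apply Rmult_le_reg_l with (r / 2); [lra|]. rewrite <- Hh at 1. rewrite <- Cmod_mult.
  replace (h * (f (c + v) - f c))%C
    with ((h * (f (c + v) - f c) - v * (f (c + h) - f c)) + v * (f (c + h) - f c))%C by ring.
  eapply Rle_trans; [apply Cmod_triangle|]. rewrite Cmod_mult with (x := v).
  apply Rle_trans with (2 * B * Cmod v + 2 * B * Cmod v).
  - apply Rplus_le_compat.
    + eapply Rle_trans; [apply T|]. rewrite Hh.
      replace (2 * B * Cmod v) with (4 * B / r ^ 2 * (Cmod v * (r / 2) * r)) by (field; lra).
      apply Rmult_le_compat_l.
      * apply Rmult_le_pos; [lra|]. left. apply Rinv_0_lt_compat. now apply pow_lt.
      * apply Rmult_le_compat_l; auto. apply Rmult_le_pos; lra.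
    + rewrite Rmult_comm. apply Rmult_le_compat_r; auto.
  - right. field. lra.
Qed.

(** * Complex differentiability in two variables *)

(** A complex linear form on C x C is given by two coefficients, and the product norm lies between
    (|a| + |b|) / 2 and |a| + |b|, so it can be traded for the sum. *)
Lemma ex_filterdiff_C2 (f : C * C -> C) (z w : C) :
  ex_filterdiff (K := C_AbsRing) f (locally (z, w)) <->
  exists l1 l2, forall e, 0 < e -> exists d, 0 < d /\ forall a b, Cmod a < d -> Cmod b < d ->
    Cmod (f ((z + a)%C, (w + b)%C) - f (z, w) - l1 * a - l2 * b)%C <= e * (Cmod a + Cmod b).
Proof.
  assert (Nle : forall a b : C, @norm C_AbsRing (prod_NormedModule C_AbsRing C_NormedModule C_NormedModule) (a, b)
     <= Cmod a + Cmod b).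
  { intros a b. change (sqrt (Cmod a ^ 2 + Cmod b ^ 2) <= Cmod a + Cmod b).
    generalize (Cmod_ge_0 a) (Cmod_ge_0 b). intros.
    rewrite <- (sqrt_pow2 (Cmod a + Cmod b)) by lra. apply sqrt_le_1_alt. nra. }
  assert (Nge : forall a b : C, Cmod a + Cmod b <= 2 *
     @norm C_AbsRing (prod_NormedModule C_AbsRing C_NormedModule C_NormedModule) (a, b)).
  { intros a b. change (Cmod a + Cmod b <= 2 * sqrt (Cmod a ^ 2 + Cmod b ^ 2)).
    generalize (Cmod_ge_0 a) (Cmod_ge_0 b). intros.
    assert (Cmod a <= sqrt (Cmod a ^ 2 + Cmod b ^ 2)).
    { rewrite <- (sqrt_pow2 (Cmod a)) at 1 by lra. apply sqrt_le_1_alt. nra. }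
    assert (Cmod b <= sqrt (Cmod a ^ 2 + Cmod b ^ 2)).
    { rewrite <- (sqrt_pow2 (Cmod b)) at 1 by lra. apply sqrt_le_1_alt. nra. }
    lra. }
  split.
  - intros [l [Hl H]].
    exists (l (RtoC 1, RtoC 0)), (l (RtoC 0, RtoC 1)). intros e He.
    destruct (H (z, w) (fun P HP => HP) (mkposreal e He)) as [d Hd].
    exists d. split; [apply cond_pos|]. intros a b Ha Hb.
    assert (Bl : forall u v : C, Cmod v < d -> @ball C_UniformSpace u d (u + v)%C).
    { intros u v Hv. apply (C_NormedModule_mixin_compat1 u (u + v)%C d).
      change (Cmod (u + v - u)%C < d). now replace (u + v - u)%C with v by ring. }
    specialize (Hd ((z + a)%C, (w + b)%C) (conj (Bl z a Ha) (Bl w b Hb))).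
    eapply Rle_trans; [|apply Rmult_le_compat_l; [lra|apply (Nle a b)]].
    assert (Em : @minus (prod_AbelianGroup C_AbelianGroup C_AbelianGroup) ((z + a)%C, (w + b)%C) (z, w) = (a, b)).
    { change ((z + a - z, w + b - w)%C = (a, b)). f_equal; ring. }
    assert (El : l (a, b) = (l (RtoC 1, RtoC 0) * a + l (RtoC 0, RtoC 1) * b)%C).
    { assert (s1 : l ((a * 1)%C, (a * 0)%C) = (a * l (RtoC 1, RtoC 0))%C)
        by exact (linear_scal l Hl a (RtoC 1, RtoC 0)).
      assert (s2 : l ((b * 0)%C, (b * 1)%C) = (b * l (RtoC 0, RtoC 1))%C)
        by exact (linear_scal l Hl b (RtoC 0, RtoC 1)).
      assert (s3 : l ((a * 1 + b * 0)%C, (a * 0 + b * 1)%C) =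
          (l ((a * 1)%C, (a * 0)%C) + l ((b * 0)%C, (b * 1)%C))%C)
        by exact (linear_plus l Hl ((a * 1)%C, (a * 0)%C) ((b * 0)%C, (b * 1)%C)).
      rewrite s1, s2 in s3.
      replace (a * 1 + b * 0)%C with a in s3 by ring. replace (a * 0 + b * 1)%C with b in s3 by ring.
      rewrite s3, (Cmult_comm a), (Cmult_comm b). reflexivity. }
    simpl pos in Hd.
    replace (f ((z + a)%C, (w + b)%C) - f (z, w) - l (RtoC 1, RtoC 0) * a - l (RtoC 0, RtoC 1) * b)%C
      with (f ((z + a)%C, (w + b)%C) - f (z, w) - l (a, b))%C by (rewrite El; ring).
    rewrite <- Em. exact Hd.
  - intros (l1 & l2 & H). exists (fun p => (l1 * fst p + l2 * snd p)%C). split.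
    + constructor.
      * intros [a b] [a' b']. change (l1 * (a + a') + l2 * (b + b') = (l1 * a + l2 * b) + (l1 * a' + l2 * b'))%C. ring.
      * intros k [a b]. change (l1 * (k * a) + l2 * (k * b) = k * (l1 * a + l2 * b))%C. ring.
      * exists (2 * (Cmod l1 + Cmod l2 + 1)). assert (h1 := Cmod_ge_0 l1). assert (h2 := Cmod_ge_0 l2).
        split; [lra|]. intros [a b].
        change (Cmod (l1 * a + l2 * b)%C <= 2 * (Cmod l1 + Cmod l2 + 1) *
          @norm C_AbsRing (prod_NormedModule C_AbsRing C_NormedModule C_NormedModule) (a, b)).
        assert (h3 := Cmod_ge_0 a). assert (h4 := Cmod_ge_0 b).
        apply Rle_trans with ((Cmod l1 + Cmod l2 + 1) * (Cmod a + Cmod b)).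
        -- eapply Rle_trans; [apply Cmod_triangle|]. rewrite !Cmod_mult. nra.
        -- rewrite (Rmult_comm 2), Rmult_assoc. apply Rmult_le_compat_l; [lra|apply Nge].
    + intros x Hx. replace x with (z, w) by
        exact (@is_filter_lim_locally_unique C_AbsRing
          (prod_NormedModule C_AbsRing C_NormedModule C_NormedModule) _ x Hx).
      (* Here e / 2 pays for the comparison of norms, and the radius d / 2 below for the balls of
         [C] being squares. *)
      intros [e He]. destruct (H (e / 2) ltac:(lra)) as [d [Hd H']].
      exists (mkposreal (d / 2) ltac:(lra)). intros [z' w'] [Hz Hw].
      simpl in Hz, Hw.
      assert (Bl : forall u v : C, @ball C_UniformSpace u (d / 2) v -> Cmod (v - u)%C < d).
      { intros u v [h1 h2]. eapply Rle_lt_trans; [apply Cmod_le_abs|].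
        change (Rabs (fst v - fst u) < d / 2) in h1. change (Rabs (snd v - snd u) < d / 2) in h2.
        change (Rabs (fst v - fst u) + Rabs (snd v - snd u) < d). lra. }
      assert (K := H' (z' - z)%C (w' - w)%C (Bl _ _ Hz) (Bl _ _ Hw)).
      assert (Ez : forall u v : C, (u + (v - u))%C = v) by (intros; ring).
      rewrite !Ez in K.
      assert (Es : forall u v s t : C, (u - v - s - t)%C = (u - v - (s + t))%C) by (intros; ring).
      rewrite Es in K.
      change (Cmod (f (z', w') - f (z, w) - (l1 * (z' - z) + l2 * (w' - w)))%C <= e *
         @norm C_AbsRing (prod_NormedModule C_AbsRing C_NormedModule C_NormedModule) ((z' - z)%C, (w' - w)%C)).
      eapply Rle_trans; [exact K|].
      change (e / 2 * (Cmod (z' - z)%C + Cmod (w' - w)%C) <= e *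
         @norm C_AbsRing (prod_NormedModule C_AbsRing C_NormedModule C_NormedModule) ((z' - z)%C, (w' - w)%C)).
      assert (N := Nge (z' - z)%C (w' - w)%C).
      apply Rmult_le_compat_l with (r := e / 2) in N; [|lra]. lra.
Qed.

(** The increment splits into two one-variable increments, with quadratic linearization errors, and
    a mixed second difference. The latter is O(|a| |b|): the difference in w is holomorphic in z and
    of size O(|b|), so the Lipschitz estimate applies to it again. *)
Lemma osgood (f : C * C -> C) (z w : C) (r B : R) :
  0 < r ->
  (forall z' w', Cmod (z' - z)%C <= r -> Cmod (w' - w)%C <= r ->
     cdiff (fun u => f (u, w')) z' /\ cdiff (fun u => f (z', u)) w' /\ Cmod (f (z', w')) <= B) ->
  ex_filterdiff (K := C_AbsRing) f (locally (z, w)).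
Proof.
  intros Hr H. apply ex_filterdiff_C2.
  assert (Hz : Cmod (z - z)%C <= r) by (rewrite Cmod_refl_0; lra).
  assert (Hw : Cmod (w - w)%C <= r) by (rewrite Cmod_refl_0; lra).
  assert (D1 : forall w', Cmod (w' - w)%C <= r -> forall z', Cmod (z' - z)%C <= r ->
    cdiff (fun u => f (u, w')) z') by (intros w' h z' h'; exact (proj1 (H z' w' h' h))).
  assert (D2 : forall z', Cmod (z' - z)%C <= r -> forall w', Cmod (w' - w)%C <= r ->
    cdiff (fun u => f (z', u)) w') by (intros z' h w' h'; exact (proj1 (proj2 (H z' w' h h')))).
  assert (D3 : forall z' w', Cmod (z' - z)%C <= r -> Cmod (w' - w)%C <= r -> Cmod (f (z', w')) <= B)
    by (intros z' w' h h'; exact (proj2 (proj2 (H z' w' h h')))).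
  destruct (three_point_derivative (fun u => f (u, w)) z (r / 2) (4 * B / r ^ 2)) as [l1 H1].
  { lra. }
  { apply (holomorphic_three_point (fun u => f (u, w)) z r B Hr (D1 w Hw)).
    intros u Hu. apply D3; auto. lra. }
  destruct (three_point_derivative (fun u => f (z, u)) w (r / 2) (4 * B / r ^ 2)) as [l2 H2].
  { lra. }
  { apply (holomorphic_three_point (fun u => f (z, u)) w r B Hr (D2 z Hz)).
    intros u Hu. apply D3; auto. lra. }
  assert (HB0 : 0 <= B) by (eapply Rle_trans; [apply Cmod_ge_0|apply (D3 z w Hz Hw)]).
  assert (H3 : forall a b, Cmod a <= r / 2 -> Cmod b <= r / 2 ->
     Cmod ((f ((z + a)%C, (w + b)%C) - f ((z + a)%C, w)) - (f (z, (w + b)%C) - f (z, w)))%C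
       <= 8 * (8 * B / r * Cmod b) / r * Cmod a).
  { intros a b Ha Hb.
    assert (Hb' : Cmod (w + b - w)%C <= r) by (replace (w + b - w)%C with b by ring; lra).
    apply (holomorphic_lipschitz (fun u => f (u, (w + b)%C) - f (u, w))%C z a r); auto.
    - intros u Hu. exact (cdiff_minus _ _ u (D1 _ Hb' u Hu) (D1 _ Hw u Hu)).
    - intros u Hu. apply (holomorphic_lipschitz (fun t => f (u, t)) w b r B Hr (D2 u Hu)); auto. }
  exists l1, l2. intros e He.
  (* The 64 is 8 times 8, from the two Lipschitz estimates; the one-variable constant 4 B / r^2
     equals K / 16. *)
  set (K := 64 * B / r ^ 2).
  assert (Hr2 : 0 < / r ^ 2) by (apply Rinv_0_lt_compat; now apply pow_lt).
  assert (HK : 0 <= K) by (apply Rmult_le_pos; lra).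
  exists (Rmin (r / 2) (e / (K + 1))); split.
  { apply Rmin_pos; [lra|]. apply Rdiv_lt_0_compat; lra. }
  intros a b Ha Hb.
  assert (Ha1 := Rlt_le_trans _ _ _ Ha (Rmin_l _ _)). assert (Ha2 := Rlt_le_trans _ _ _ Ha (Rmin_r _ _)).
  assert (Hb1 := Rlt_le_trans _ _ _ Hb (Rmin_l _ _)). assert (Hb2 := Rlt_le_trans _ _ _ Hb (Rmin_r _ _)).
  specialize (H1 a ltac:(lra)). specialize (H2 b ltac:(lra)). specialize (H3 a b ltac:(lra) ltac:(lra)).
  cbv beta in H1, H2.
  replace (_ - _ - _ - _)%C with
    (((f ((z + a)%C, (w + b)%C) - f ((z + a)%C, w)) - (f (z, (w + b)%C) - f (z, w)))
     + ((f ((z + a)%C, w) - f (z, w) - l1 * a) + (f (z, (w + b)%C) - f (z, w) - l2 * b)))%C by ring.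
  eapply Rle_trans; [apply Cmod_triangle|].
  eapply Rle_trans; [apply Rplus_le_compat; [exact H3|]; eapply Rle_trans;
    [apply Cmod_triangle|apply Rplus_le_compat; [exact H1|exact H2]]|].
  assert (a0 := Cmod_ge_0 a). assert (b0 := Cmod_ge_0 b).
  set (x := Cmod a) in *. set (y := Cmod b) in *.
  replace (8 * (8 * B / r * y) / r * x) with (K * (x * y)) by (unfold K; field; lra).
  replace (4 * B / r ^ 2) with (K / 16) by (unfold K; field; lra).
  assert (Hx : (K + 1) * x <= e).
  { apply Rle_trans with ((K + 1) * (e / (K + 1))); [apply Rmult_le_compat_l; lra|right; field; lra]. }
  assert (Hy : (K + 1) * y <= e).
  { apply Rle_trans with ((K + 1) * (e / (K + 1))); [apply Rmult_le_compat_l; lra|right; field; lra]. }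
  assert (t1 : (K + 1) * x * y <= e * y) by (apply Rmult_le_compat_r; auto).
  assert (t2 : (K + 1) * y * x <= e * x) by (apply Rmult_le_compat_r; auto).
  assert (t3 : (K + 1) * x * x <= e * x) by (apply Rmult_le_compat_r; auto).
  assert (t4 : (K + 1) * y * y <= e * y) by (apply Rmult_le_compat_r; auto).
  assert (0 <= x * y) by (apply Rmult_le_pos; auto).
  assert (0 <= x * x) by (apply Rmult_le_pos; auto).
  assert (0 <= y * y) by (apply Rmult_le_pos; auto).
  assert (0 <= e * x) by (apply Rmult_le_pos; lra).
  assert (0 <= e * y) by (apply Rmult_le_pos; lra).
  simpl. lra.
Qed.

(** * Holomorphic functions of two variables *)

Lemma open_C2 (W : C * C -> Prop) (z w : C) :
  open W -> W (z, w) -> exists d, 0 < d /\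
    forall z' w', Cmod (z' - z)%C < d -> Cmod (w' - w)%C < d -> W (z', w').
Proof.
  intros HW H. destruct (HW _ H) as [d Hd]. exists d. split; [apply cond_pos|].
  intros z' w' Hz Hw. apply Hd.
  split; [apply (C_NormedModule_mixin_compat1 z z' d Hz)|apply (C_NormedModule_mixin_compat1 w w' d Hw)].
Qed.

Lemma holomorphic_cdiff1 (W : C * C -> Prop) (f : C * C -> C) (z w : C) :
  holomorphic_on W f -> W (z, w) -> cdiff (fun u => f (u, w)) z.
Proof.
  intros Hf H. destruct (proj1 (ex_filterdiff_C2 f z w) (Hf _ H)) as (l1 & l2 & K).
  exists l1. apply cderiv_iff. intros e He. destruct (K e He) as [d [Hd Hd']].
  exists d. split; auto. intros u Hu.
  specialize (Hd' (u - z)%C (RtoC 0) Hu ltac:(rewrite Cmod_0; auto)).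
  rewrite Cmod_0, Rplus_0_r, Cplus_0_r in Hd'.
  replace (z + (u - z))%C with u in Hd' by ring.
  replace (f (u, w) - f (z, w) - l1 * (u - z) - l2 * 0)%C
    with (f (u, w) - f (z, w) - l1 * (u - z))%C in Hd' by ring. exact Hd'.
Qed.

Lemma holomorphic_cdiff2 (W : C * C -> Prop) (f : C * C -> C) (z w : C) :
  holomorphic_on W f -> W (z, w) -> cdiff (fun u => f (z, u)) w.
Proof.
  intros Hf H. destruct (proj1 (ex_filterdiff_C2 f z w) (Hf _ H)) as (l1 & l2 & K).
  exists l2. apply cderiv_iff. intros e He. destruct (K e He) as [d [Hd Hd']].
  exists d. split; auto. intros u Hu.
  specialize (Hd' (RtoC 0) (u - w)%C ltac:(rewrite Cmod_0; auto) Hu).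
  rewrite Cmod_0, Rplus_0_l, Cplus_0_r in Hd'.
  replace (w + (u - w))%C with u in Hd' by ring.
  replace (f (z, u) - f (z, w) - l1 * 0 - l2 * (u - w))%C
    with (f (z, u) - f (z, w) - l2 * (u - w))%C in Hd' by ring. exact Hd'.
Qed.

Lemma holomorphic_locally_bounded (W : C * C -> Prop) (f : C * C -> C) (z w : C) :
  holomorphic_on W f -> W (z, w) -> exists d M, 0 < d /\
    forall z' w', Cmod (z' - z)%C < d -> Cmod (w' - w)%C < d -> Cmod (f (z', w')) <= M.
Proof.
  intros Hf H. destruct (proj1 (ex_filterdiff_C2 f z w) (Hf _ H)) as (l1 & l2 & K).
  destruct (K 1 Rlt_0_1) as [d [Hd Hd']].
  exists d, (Cmod (f (z, w)) + (Cmod l1 + Cmod l2 + 2) * d). split; auto.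
  intros z' w' Hz Hw. specialize (Hd' (z' - z)%C (w' - w)%C Hz Hw).
  replace (z + (z' - z))%C with z' in Hd' by ring. replace (w + (w' - w))%C with w' in Hd' by ring.
  replace (f (z', w')) with ((f (z', w') - f (z, w) - l1 * (z' - z) - l2 * (w' - w))
    + (f (z, w) + (l1 * (z' - z) + l2 * (w' - w))))%C by ring.
  eapply Rle_trans; [apply Cmod_triangle|].
  eapply Rle_trans; [apply Rplus_le_compat; [exact Hd'|]; eapply Rle_trans;
    [apply Cmod_triangle|apply Rplus_le_compat_l, Cmod_triangle]|].
  rewrite !Cmod_mult.
  assert (Cmod l1 * Cmod (z' - z)%C <= Cmod l1 * d) by (apply Rmult_le_compat_l; [apply Cmod_ge_0|lra]).
  assert (Cmod l2 * Cmod (w' - w)%C <= Cmod l2 * d) by (apply Rmult_le_compat_l; [apply Cmod_ge_0|lra]).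
  lra.
Qed.

Lemma circle_uniform (P : C -> C -> Prop) (z0 c : C) (r : R) :
  0 < r ->
  (forall w, Cmod (w - c)%C = r -> exists d, 0 < d /\
     forall z' w', Cmod (z' - z0)%C < d -> Cmod (w' - w)%C < d -> P z' w') ->
  exists d, 0 < d /\ forall z w, Cmod (z - z0)%C < d -> Cmod (w - c)%C = r -> P z w.
Proof.
  intros Hr H.
  destruct (tube (fun d t => forall z, Cmod (z - z0)%C < d -> P z (circ c r t)) 0 (2 * PI))
    as [d [Hd H']].
  - left. apply two_PI_pos.
  - intros d d' t Hd Ht z Hz. apply Ht. lra.
  - intros t _. destruct (H (circ c r t) ltac:(apply Cmod_circ; lra)) as (d & Hd & HM).
    destruct (circ_cont c r t d Hd) as [d' [Hd' Hc]].
    exists (Rmin d d'); split; [now apply Rmin_pos|].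
    intros t' Ht' z Hz. apply HM.
    + eapply Rlt_le_trans; [apply Hz|apply Rmin_l].
    + apply Hc. eapply Rlt_le_trans; [apply Ht'|apply Rmin_r].
  - exists d. split; auto. intros z w Hz Hw.
    destruct (circle_param c w r Hr Hw) as [t [Ht ->]]. auto.
Qed.

Lemma rect_bound (P : C -> R -> Prop) (x0 y0 A B : R) :
  0 <= A -> 0 <= B -> (forall z M M', P z M -> M <= M' -> P z M') ->
  (forall x y, x0 <= x <= x0 + A -> y0 <= y <= y0 + B -> exists d M, 0 < d /\
     forall z, Cmod (z - (x, y))%C < d -> P z M) ->
  exists M, forall x y, x0 <= x <= x0 + A -> y0 <= y <= y0 + B -> P (x, y) M.
Proof.
  intros HA HB Hmon Hloc.
  pose (Q := fun x y s => exists M, forall x' y', x <= x' <= x + s * A -> y <= y' <= y + s * B -> P (x', y') M).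
  assert (H : Q x0 y0 1).
  2:{ destruct H as [M HM]. exists M. intros x y Hx Hy. apply HM; lra. }
  apply (box_bisection Q A B); auto.
  - intros x y s Hs h1 h2 h3 h4 [M1 H1] [M2 H2] [M3 H3] [M4 H4].
    exists (Rmax (Rmax M1 M2) (Rmax M3 M4)). intros a b Ha Hb.
    assert (s / 2 * A + s / 2 * A = s * A) by field.
    assert (s / 2 * B + s / 2 * B = s * B) by field.
    assert (m1 := Rle_trans _ _ _ (Rmax_l M1 M2) (Rmax_l _ (Rmax M3 M4))).
    assert (m2 := Rle_trans _ _ _ (Rmax_r M1 M2) (Rmax_l _ (Rmax M3 M4))).
    assert (m3 := Rle_trans _ _ _ (Rmax_l M3 M4) (Rmax_r (Rmax M1 M2) _)).
    assert (m4 := Rle_trans _ _ _ (Rmax_r M3 M4) (Rmax_r (Rmax M1 M2) _)).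
    destruct (Rle_dec a (x + s / 2 * A)); destruct (Rle_dec b (y + s / 2 * B)).
    + apply (Hmon _ M1); auto. apply H1; lra.
    + apply (Hmon _ M3); auto. apply H3; lra.
    + apply (Hmon _ M2); auto. apply H2; lra.
    + apply (Hmon _ M4); auto. apply H4; lra.
  - intros p q Hp Hq. destruct (Hloc p q Hp Hq) as (d & M & Hd & H).
    exists (d / (A + B + 1)); split; [apply Rdiv_lt_0_compat; lra|].
    intros x y s Hs h1 h2 h3 h4 Hx Hy. exists M. intros a b Ha Hb. apply H.
    assert (Hsd' : s * (A + B) < d).
    { apply Rle_lt_trans with (s * (A + B + 1)); [apply Rmult_le_compat_l; lra|].
      apply Rlt_le_trans with (d / (A + B + 1) * (A + B + 1)).
      - apply Rmult_lt_compat_r; lra.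
      - right. field. lra. }
    eapply Rle_lt_trans; [apply Cmod_le_abs|]. simpl.
    assert (Rabs (a + - p) <= s * A) by (apply Rabs_le; lra).
    assert (Rabs (b + - q) <= s * B) by (apply Rabs_le; lra). lra.
Qed.

(** * Power series with holomorphic coefficients *)

Lemma csum_tail (u : nat -> C) (K q : R) (n m : nat) :
  0 <= q < 1 -> 0 <= K -> (forall n, Cmod (u n) <= K * q ^ n) -> (n <= m)%nat ->
  Cmod (csum u m - csum u n)%C <= K * q ^ n / (1 - q).
Proof.
  intros Hq HK Hu Hnm.
  (* This sharper bound telescopes, so the induction on m goes through. *)
  apply Rle_trans with ((K * q ^ n - K * q ^ m) / (1 - q)).
  - induction Hnm as [|m Hnm IH].
    + rewrite Cmod_refl_0. right. field. lra.
    + simpl. replace (csum u m + u m - csum u n)%C with ((csum u m - csum u n) + u m)%C by ring.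
      eapply Rle_trans; [apply Cmod_triangle|].
      replace ((K * q ^ n - K * (q * q ^ m)) / (1 - q)) with
        ((K * q ^ n - K * q ^ m) / (1 - q) + K * q ^ m) by (field; lra).
      apply Rplus_le_compat; auto.
  - apply Rmult_le_compat_r; [left; apply Rinv_0_lt_compat; lra|].
    assert (0 <= K * q ^ m) by (apply Rmult_le_pos; auto; apply pow_le; lra). lra.
Qed.

Lemma cdiff_csum (u : nat -> C -> C) (z : C) (N : nat) :
  (forall n, cdiff (u n) z) -> cdiff (fun t => csum (fun n => u n t) N) z.
Proof.
  intros H. induction N as [|N IH]; simpl; [apply cdiff_const|]. now apply cdiff_plus.
Qed.

Lemma geometric_small (K q : R) : 0 <= q < 1 -> 0 <= K ->
  forall e, 0 < e -> exists N, forall n, (N <= n)%nat -> K * q ^ n / (1 - q) < e.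
Proof.
  intros Hq HK e He.
  destruct (pow_lt_1_zero q ltac:(rewrite Rabs_pos_eq; lra) (e * (1 - q) / (K + 1))) as [N HN].
  { apply Rdiv_lt_0_compat; [apply Rmult_lt_0_compat|]; lra. }
  exists N. intros n Hn. specialize (HN n Hn). rewrite Rabs_pos_eq in HN by (apply pow_le; lra).
  apply Rmult_lt_reg_r with (1 - q); [lra|].
  replace (K * q ^ n / (1 - q) * (1 - q)) with (K * q ^ n) by (field; lra).
  apply Rle_lt_trans with ((K + 1) * q ^ n).
  - apply Rmult_le_compat_r; [apply pow_le|]; lra.
  - apply Rlt_le_trans with ((K + 1) * (e * (1 - q) / (K + 1))).
    + apply Rmult_lt_compat_l; lra.
    + right. field. lra.
Qed.

(** Convergence with ratio R0 / R1 bounds the partial sums uniformly, so the sum is holomorphic in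
    each variable and [osgood] applies. The second clause, over all limits L of the partial sums,
    serves to identify the sum with f. *)
Lemma power_series_holomorphic (a : nat -> C -> C) (z0 c : C) (r R0 R1 K : R) :
  0 < R0 < R1 -> 0 <= K ->
  (forall n z, Cmod (z - z0)%C < r -> cdiff (a n) z /\ Cmod (a n z) <= K * (/ R1) ^ n) ->
  exists F : C * C -> C,
    (forall z w, Cmod (z - z0)%C < r -> Cmod (w - c)%C < R0 ->
       ex_filterdiff (K := C_AbsRing) F (locally (z, w))) /\
    (forall z w, Cmod (z - z0)%C < r -> Cmod (w - c)%C < R0 ->
       forall L, (forall e, 0 < e -> exists N, forall n, (N <= n)%nat ->
         Cmod (L - csum (fun n => a n z * (w - c) ^ n) n)%C <= e) -> F (z, w) = L).
Proof.
  intros HR HK Ha.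
  set (q := R0 / R1).
  assert (HR1i : 0 < / R1) by (apply Rinv_0_lt_compat; lra).
  assert (Hq : 0 <= q < 1).
  { unfold q. split; [apply Rmult_le_pos; lra|].
    apply Rmult_lt_reg_r with R1; [lra|]. unfold Rdiv. rewrite Rmult_assoc, Rinv_l; lra. }
  pose (S := fun (p : C * C) N => csum (fun n => a n (fst p) * (snd p - c) ^ n)%C N).
  (* The sum is selected by its error bound; where no number satisfies that bound the value is
     arbitrary. *)
  pose (F := fun p : C * C => epsilon (inhabits (RtoC 0))
     (fun L => forall N, Cmod (S p N - L)%C <= K * q ^ N / (1 - q))).
  assert (term : forall z w, Cmod (z - z0)%C < r -> Cmod (w - c)%C <= R0 -> forall n,
     Cmod (a n z * (w - c) ^ n)%C <= K * q ^ n).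
  { intros z w Hz Hw n. rewrite Cmod_mult, Cmod_pow.
    replace (K * q ^ n) with ((K * (/ R1) ^ n) * R0 ^ n)
      by (unfold q, Rdiv; rewrite Rpow_mult_distr; ring).
    apply Rmult_le_compat; try apply Cmod_ge_0.
    - apply pow_le, Cmod_ge_0.
    - now apply Ha.
    - apply pow_incr. split; auto. apply Cmod_ge_0. }
  assert (HF : forall z w, Cmod (z - z0)%C < r -> Cmod (w - c)%C <= R0 ->
     forall N, Cmod (S (z, w) N - F (z, w))%C <= K * q ^ N / (1 - q)).
  { intros z w Hz Hw. apply (epsilon_spec (inhabits (RtoC 0))
      (fun L => forall N, Cmod (S (z, w) N - L)%C <= K * q ^ N / (1 - q))).
    apply (C_cauchy_lim (S (z, w)) (fun N => K * q ^ N / (1 - q))).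
    - now apply geometric_small.
    - intros n m Hnm. apply csum_tail; auto. }
  assert (HSb : forall z w, Cmod (z - z0)%C < r -> Cmod (w - c)%C <= R0 ->
     forall N, Cmod (S (z, w) N) <= K / (1 - q)).
  { intros z w Hz Hw N.
    assert (T := csum_tail (fun n => a n z * (w - c) ^ n)%C K q 0 N Hq HK (term z w Hz Hw) (Nat.le_0_l _)).
    simpl in T. unfold S. simpl.
    replace (csum _ N) with (csum (fun n => a n z * (w - c) ^ n)%C N - 0)%C by ring.
    eapply Rle_trans; [exact T|]. right. field. lra. }
  assert (Hlim : forall z w, Cmod (z - z0)%C < r -> Cmod (w - c)%C <= R0 ->
     forall e, 0 < e -> exists N, forall n, (N <= n)%nat -> Cmod (S (z, w) n - F (z, w))%C <= e).
  { intros z w Hz Hw e He. destruct (geometric_small K q Hq HK e He) as [N HN].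
    exists N. intros n Hn. eapply Rle_trans; [now apply HF|]. left. now apply HN. }
  exists F. split.
  - intros z w Hz Hw.
    set (t := Rmin (r - Cmod (z - z0)%C) (R0 - Cmod (w - c)%C) / 2).
    assert (Ht : 0 < Rmin (r - Cmod (z - z0)%C) (R0 - Cmod (w - c)%C)) by (apply Rmin_pos; lra).
    assert (t1 := Rmin_l (r - Cmod (z - z0)%C) (R0 - Cmod (w - c)%C)).
    assert (t2 := Rmin_r (r - Cmod (z - z0)%C) (R0 - Cmod (w - c)%C)).
    assert (Ht1 : r - Cmod (z - z0)%C >= 2 * t) by (unfold t; lra).
    assert (Ht2 : R0 - Cmod (w - c)%C >= 2 * t) by (unfold t; lra).
    assert (Ht0 : 0 < t) by (unfold t; lra).
    apply (osgood F z w (t / 2) (K / (1 - q) + 2 * K / (1 - q))); [lra|].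
    intros z' w' Hz' Hw'.
    assert (near : forall u v, Cmod (u - z')%C <= t / 2 -> Cmod (v - w')%C <= t / 2 ->
       Cmod (u - z0)%C < r /\ Cmod (v - c)%C <= R0).
    { intros u v Hu Hv. generalize (Cmod_dist_triangle u z' z0) (Cmod_dist_triangle z' z z0)
       (Cmod_dist_triangle v w' c) (Cmod_dist_triangle w' w c). lra. }
    destruct (near z' w') as [Nz Nw]; try (rewrite Cmod_refl_0; lra).
    split; [|split].
    + apply (cdiff_limit (fun N u => S (u, w') N) _ z' (t / 2) (K / (1 - q))); [lra| | |].
      * intros n u Hu. unfold S. simpl.
        apply (cdiff_csum (fun n u => a n u * (w' - c) ^ n)%C). intros m.
        apply cdiff_mult; [|apply cdiff_const]. apply Ha.
        apply (near u w'); auto. rewrite Cmod_refl_0; lra.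
      * intros n u Hu. apply HSb; auto. apply (near u w'); auto. rewrite Cmod_refl_0; lra.
      * intros u Hu. apply Hlim; auto. apply (near u w'); auto. rewrite Cmod_refl_0; lra.
    + apply (cdiff_limit (fun N v => S (z', v) N) _ w' (t / 2) (K / (1 - q))); [lra| | |].
      * intros n v Hv. unfold S. simpl.
        apply (cdiff_csum (fun n v => a n z' * (v - c) ^ n)%C). intros m.
        apply cdiff_mult; [apply cdiff_const|]. apply (cdiff_pow (fun v => v - c)%C), cdiff_shift.
      * intros n v Hv. apply HSb; auto. apply (near z' v); auto. rewrite Cmod_refl_0; lra.
      * intros v Hv. apply Hlim; auto. apply (near z' v); auto. rewrite Cmod_refl_0; lra.
    (* For N = 0 the partial sum is empty, so the error bound is a bound for F itself. *)
    + assert (h := HF z' w' Nz Nw 0%nat). unfold S in h. simpl in h.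
      rewrite Cmod_minus_sym in h. replace (F (z', w') - 0)%C with (F (z', w')) in h by ring.
      eapply Rle_trans; [exact h|].
      assert (0 <= K / (1 - q)) by (apply Rmult_le_pos; auto; left; apply Rinv_0_lt_compat; lra).
      unfold Rdiv in *. lra.
  - intros z w Hz Hw L HL. apply Ceq_minus, Cmod_eq_0. apply Rle_antisym; [|apply Cmod_ge_0].
    apply le_epsilon. intros e He. rewrite Rplus_0_l.
    destruct (HL (e / 2) ltac:(lra)) as [N1 H1].
    destruct (Hlim z w Hz (Rlt_le _ _ Hw) (e / 2) ltac:(lra)) as [N2 H2].
    specialize (H1 (N1 + N2)%nat ltac:(lia)). specialize (H2 (N1 + N2)%nat ltac:(lia)).
    eapply Rle_trans; [apply (Cmod_dist_triangle _ (S (z, w) (N1 + N2)%nat))|].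
    rewrite (Cmod_minus_sym (F (z, w))). rewrite (Cmod_minus_sym L) in H1.
    unfold S in *. simpl in *. lra.
Qed.

(** By compactness of the circle, one disc of parameters u works for the whole circle: over it W
    contains the circle and f is bounded, so [cdiff_cmean] applies. *)
Lemma coef_cdiff (W : C * C -> Prop) (f : C * C -> C) (z c : C) (r : R) (n : nat) :
  open W -> holomorphic_on W f -> 0 < r ->
  (forall w, Cmod (w - c)%C = r -> W (z, w)) ->
  cdiff (fun u => coef (fun w => f (u, w)) c r n) z.
Proof.
  intros HW Hf Hr H.
  destruct (circle_uniform (fun u w => W (u, w)) z c r Hr) as [d1 [Hd1 H1]].
  { intros w Hw. apply open_C2; auto. }
  destruct (circle_bound (fun u w => f (u, w)) z c r Hr) as (d2 & M & Hd2 & H2).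
  { intros w Hw. apply (holomorphic_locally_bounded W); auto. }
  assert (Hd : 0 < Rmin d1 d2) by now apply Rmin_pos.
  assert (m1 := Rmin_l d1 d2). assert (m2 := Rmin_r d1 d2).
  apply (cdiff_cmean (fun u w => f (u, w) * (/ (w - c)) ^ n)%C z c r (Rmin d1 d2 / 2) (M * (/ r) ^ n));
    try lra.
  intros u w Hu Hw.
  assert (Wuw : W (u, w)) by (apply H1; auto; lra).
  assert (Hnz : (w - c)%C <> 0) by (apply Cmod_gt_0; lra).
  split; [|split].
  - apply (cdiff_mult (fun u => f (u, w))); [now apply (holomorphic_cdiff1 W)|apply cdiff_const].
  - apply (ccont_mult (fun w => f (u, w))).
    + apply cdiff_ccont. now apply (holomorphic_cdiff2 W).
    + apply cdiff_ccont. now apply cdiff_inv_pow.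
  - rewrite Cmod_mult, Cmod_pow, Cmod_inv, Hw by auto. apply Rmult_le_compat_r.
    + apply pow_le. left. now apply Rinv_0_lt_compat.
    + apply H2; auto. lra.
Qed.

Lemma rect_circle_bound (W : C * C -> Prop) (f : C * C -> C) (x0 y0 A B : R) (c : C) (r : R) :
  holomorphic_on W f -> 0 <= A -> 0 <= B -> 0 < r ->
  (forall x y w, x0 <= x <= x0 + A -> y0 <= y <= y0 + B -> Cmod (w - c)%C = r -> W ((x, y), w)) ->
  exists M, forall x y, x0 <= x <= x0 + A -> y0 <= y <= y0 + B -> forall w, Cmod (w - c)%C = r ->
    Cmod (f ((x, y), w)) <= M.
Proof.
  intros Hf HA HB Hr H.
  apply (rect_bound (fun z M => forall w, Cmod (w - c)%C = r -> Cmod (f (z, w)) <= M)); auto.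
  - intros z M M' H1 HM w Hw. eapply Rle_trans; [now apply H1|auto].
  - intros x y Hx Hy.
    destruct (circle_bound (fun u w => f (u, w)) (x, y) c r Hr) as (d & M & Hd & HM).
    + intros w Hw. apply (holomorphic_locally_bounded W); auto.
    + exists d, M. split; auto.
Qed.

(** * Gain in the radius of convergence *)

Lemma Re_scaled_cexp (b k x y : R) :
  Re (RtoC b * cexp (RtoC (- k) * (x, y))) = b * (exp (- (k * x)) * cos (k * y)).
Proof.
  rewrite re_scal_l. f_equal. unfold cexp. rewrite re_scal_l, im_scal_l. simpl.
  rewrite <- (cos_neg (k * y)). f_equal; f_equal; ring.
Qed.

(* The coefficients a_n of f(z, .) at e are at most of size (e exp(-alpha))^-n on the
   rectangle [0, 2l] x [-eta, eta] and (e exp beta)^-n on its left side. With k = pi / (2 eta), the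
   weight beta Re exp(-k z) vanishes for |Im z| = eta and is at most beta on the left
   side, so the maximum principle for a_n exp(n beta exp(-k z)) transports a gain of
   order beta exp(-k l) to the centre z = l. *)
Lemma radius_gain (W : C * C -> Prop) (f : C * C -> C) (l eta e alpha beta : R) :
  open W -> holomorphic_on W f -> 0 < l -> 0 < eta -> 0 < e -> 0 <= alpha -> 0 < beta ->
  (forall x y w, 0 <= x <= 2 * l -> - eta <= y <= eta ->
     Cmod (w - e)%C <= e * exp (- alpha) -> W ((x, y), w)) ->
  (forall y w, - eta <= y <= eta -> Cmod (w - e)%C <= e * exp beta -> W ((0, y), w)) ->
  alpha + beta * exp (- (PI / (2 * eta) * (2 * l))) < beta / 2 * exp (- (PI / (2 * eta) * l)) ->
  exists (r R0 : R) (F : C * C -> C), 0 < r /\ e < R0 /\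
    (forall z w, Cmod (z - l)%C < r -> Cmod (w - e)%C < R0 ->
       ex_filterdiff (K := C_AbsRing) F (locally (z, w))) /\
    (forall z w, Cmod (z - l)%C < r -> Cmod (w - e)%C < e * exp (- alpha) ->
       F (z, w) = f (z, w)).
Proof.
  intros HW Hf Hl Heta He Ha Hb H1 H2 H3.
  set (k := PI / (2 * eta)) in *. set (rho := e * exp (- alpha)) in *.
  set (R1 := e * exp beta) in *.
  set (E1 := exp (- (k * l))) in *. set (E2 := exp (- (k * (2 * l)))) in *.
  assert (HE1 : 0 < E1) by apply exp_pos. assert (HE2 : 0 < E2) by apply exp_pos.
  assert (Hrho : 0 < rho) by (apply Rmult_lt_0_compat; auto; apply exp_pos).
  assert (HrhoR : rho <= R1).
  { apply Rmult_le_compat_l; [lra|]. left. apply exp_increasing. lra. }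
  assert (Irho : / rho = / e * exp alpha).
  { unfold rho. rewrite exp_Ropp, Rinv_mult, Rinv_inv. reflexivity. }
  assert (IR1 : / R1 = / e * exp (- beta)).
  { unfold R1. rewrite exp_Ropp, Rinv_mult. reflexivity. }
  assert (Hie : 0 < / e) by now apply Rinv_0_lt_compat.
  pose (a := fun n z => coef (fun w => f (z, w)) e rho n).
  assert (aD : forall n x y, 0 <= x <= 2 * l -> - eta <= y <= eta -> cdiff (a n) (x, y)).
  { intros n x y Hx Hy. apply (coef_cdiff W f (x, y) e rho n HW Hf Hrho). intros w Hw. apply H1; auto. lra. }
  destruct (rect_circle_bound W f 0 (- eta) (2 * l) (2 * eta) e rho) as [K1 HK1]; auto; try lra.
  { intros x y w Hx Hy Hw. apply H1; lra. }
  destruct (rect_circle_bound W f 0 (- eta) 0 (2 * eta) e R1) as [K2 HK2]; auto; try lra.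
  { intros x y w Hx Hy Hw. replace x with 0 by lra. apply H2; lra. }
  set (K := Rmax K1 K2).
  assert (K1K := Rmax_l K1 K2). assert (K2K := Rmax_r K1 K2). fold K in K1K, K2K.
  assert (HK : 0 <= K).
  { eapply Rle_trans; [apply Cmod_ge_0|]. eapply Rle_trans; [|apply K1K].
    apply (HK1 0 0 ltac:(lra) ltac:(lra) (circ e rho 0)). apply Cmod_circ. lra. }
  assert (aB : forall n x y, 0 <= x <= 2 * l -> - eta <= y <= eta -> Cmod (a n (x, y)) <= K * (/ rho) ^ n).
  { intros n x y Hx Hy. apply (Cmod_coef_le (fun w => f ((x, y), w)) e rho K n Hrho).
    - intros w Hw. apply cdiff_ccont, (holomorphic_cdiff2 W f (x, y) w Hf). apply H1; auto. lra.
    - intros w Hw. eapply Rle_trans; [apply HK1; auto; lra|auto]. }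
  assert (aL : forall n y, - eta <= y <= eta -> Cmod (a n (0, y)) <= K * (/ R1) ^ n).
  { intros n y Hy. unfold a. rewrite (coef_radius (fun w => f ((0, y), w)) e rho R1); auto.
    2:{ intros w Hw. apply (holomorphic_cdiff2 W f (0, y) w Hf). apply H2; auto. lra. }
    apply (Cmod_coef_le (fun w => f ((0, y), w))); [lra| |].
    - intros w Hw. apply cdiff_ccont, (holomorphic_cdiff2 W f (0, y) w Hf). apply H2; auto. lra.
    - intros w Hw. eapply Rle_trans; [apply HK2; auto; lra|auto]. }
  pose (weight := fun z : C => cexp (RtoC beta * cexp (RtoC (- k) * z))%C).
  assert (wD : forall z, cdiff weight z).
  { intros z. apply (cdiff_comp cexp (fun z => RtoC beta * cexp (RtoC (- k) * z))%C); [apply cdiff_cexp|].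
    apply (cdiff_mult (fun _ => RtoC beta)); [apply cdiff_const|].
    apply (cdiff_comp cexp (fun z => RtoC (- k) * z)%C); [apply cdiff_cexp|].
    apply (cdiff_mult (fun _ => RtoC (- k)) (fun z => z)); [apply cdiff_const|apply cdiff_id]. }
  assert (wM : forall x y, Cmod (weight (x, y)) = exp (beta * (exp (- (k * x)) * cos (k * y)))).
  { intros x y. unfold weight. now rewrite Cmod_cexp, Re_scaled_cexp. }
  (* A common bound on all four sides: on the left the weight at most compensates exp(-beta), on the
     horizontal sides it has modulus 1 and only alpha is left, and on the right it adds at most beta
     E2. *)
  set (T := / e * exp (alpha + beta * E2)).
  assert (bound : forall n x y, 0 <= x <= 2 * l -> - eta <= y <= eta ->
     Cmod (a n (x, y)) * Cmod (weight (x, y)) ^ n <= K * T ^ n).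
  { intros n x y Hx Hy. rewrite <- Cmod_pow, <- Cmod_mult.
    apply (max_principle (fun z => a n z * weight z ^ n)%C 0 (- eta) (2 * l) (2 * eta)); try lra.
    - intros p q Hp Hq. apply (cdiff_mult (a n) (fun z => weight z ^ n)%C).
      + apply aD; lra.
      + apply (cdiff_pow weight), wD.
    - clear x y Hx Hy. intros x y Hx Hy Hedge. rewrite Rplus_0_l in *.
      replace (- eta + 2 * eta) with eta in * by ring.
      rewrite Cmod_mult, Cmod_pow, wM.
      assert (fin : forall b, 0 <= b -> Cmod (a n (x, y)) <= K * b ^ n ->
        b * exp (beta * (exp (- (k * x)) * cos (k * y))) <= T ->
        Cmod (a n (x, y)) * exp (beta * (exp (- (k * x)) * cos (k * y))) ^ n <= K * T ^ n).
      { intros b Hb0 Hb1 Hb2.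
        set (Z := exp (beta * (exp (- (k * x)) * cos (k * y)))) in *.
        apply Rle_trans with (K * (b * Z) ^ n).
        - replace (K * (b * Z) ^ n) with (K * b ^ n * Z ^ n) by (rewrite Rpow_mult_distr; ring).
          apply Rmult_le_compat_r; auto.
          apply pow_le. left. apply exp_pos.
        - apply Rmult_le_compat_l; auto. apply pow_incr. split; auto.
          apply Rmult_le_pos; auto. left. apply exp_pos. }
      assert (HbE2 : 0 < beta * E2) by now apply Rmult_lt_0_compat.
      destruct Hedge as [E|E].
      + subst x. apply (fin (/ R1)); [left; apply Rinv_0_lt_compat; lra|now apply aL|].
        rewrite IR1. unfold T. rewrite Rmult_assoc, <- exp_plus. apply Rmult_le_compat_l; [lra|].
        assert (c1 := proj2 (COS_bound (k * y))).
        rewrite Rmult_0_r, Ropp_0, exp_0, Rmult_1_l.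
        assert (beta * cos (k * y) <= beta * 1) by (apply Rmult_le_compat_l; lra).
        left. apply exp_increasing. lra.
      + apply (fin (/ rho)); [left; now apply Rinv_0_lt_compat|now apply aB|].
        rewrite Irho. unfold T. rewrite Rmult_assoc, <- exp_plus. apply Rmult_le_compat_l; [lra|].
        assert (Hle : exp (- (k * x)) * cos (k * y) <= E2).
        { destruct E as [E|E].
          - rewrite E. fold E2. rewrite <- (Rmult_1_r E2) at 2. apply Rmult_le_compat_l; [lra|].
            apply COS_bound.
          - assert (Hcos : cos (k * y) = 0).
            { destruct E as [E|E]; rewrite E.
              - replace (k * - eta) with (- (PI / 2)) by (unfold k; field; lra).
                rewrite cos_neg. apply cos_PI2.
              - replace (k * eta) with (PI / 2) by (unfold k; field; lra). apply cos_PI2. }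
            rewrite Hcos, Rmult_0_r. lra. }
        apply Rmult_le_compat_l with (r := beta) in Hle; [|lra].
        destruct Hle as [Hle|Hle]; [left; apply exp_increasing; lra|right; rewrite Hle; reflexivity]. }
  (* Near z = l continuity gives Re exp(-k z) >= E1 / 2. Dividing by the weight there leaves |a_n|
     <= K (e exp gam)^-n, and the last hypothesis says exactly that gam > 0. *)
  set (gam := beta / 2 * E1 - alpha - beta * E2).
  assert (Hgam : 0 < gam) by (unfold gam; lra).
  destruct (cdiff_cont (fun z => cexp (RtoC (- k) * z)%C) (RtoC l)) with (e := E1 / 2) as [d [Hd Hnear]].
  { apply (cdiff_comp cexp (fun z => RtoC (- k) * z)%C); [apply cdiff_cexp|].
    apply (cdiff_mult (fun _ => RtoC (- k)) (fun z => z)); [apply cdiff_const|apply cdiff_id]. }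
  { lra. }
  set (r := Rmin d (Rmin l eta)).
  assert (Hr : 0 < r) by (unfold r; repeat apply Rmin_pos; auto).
  assert (r1 : r <= d) by apply Rmin_l.
  assert (r2 : r <= l) by (eapply Rle_trans; [apply Rmin_r|apply Rmin_l]).
  assert (r3 : r <= eta) by (eapply Rle_trans; [apply Rmin_r|apply Rmin_r]).
  assert (inQ : forall x y, Cmod ((x, y) - RtoC l)%C < r -> 0 <= x <= 2 * l /\ - eta <= y <= eta).
  { intros x y Hxy.
    assert (h1 := Rle_lt_trans _ _ _ (re_le_Cmod _) Hxy). assert (h2 := Rle_lt_trans _ _ _ (im_le_Cmod _) Hxy).
    simpl in h1, h2. apply Rabs_def2 in h1. apply Rabs_def2 in h2. lra. }
  (* Passing from gam to gam / 2 leaves room for geometric convergence while the radius still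
     exceeds e. *)
  destruct (power_series_holomorphic a (RtoC l) (RtoC e) r (e * exp (gam / 2)) (e * exp gam) K)
    as (F & HF1 & HF2); auto.
  { split; [apply Rmult_lt_0_compat; auto; apply exp_pos|].
    apply Rmult_lt_compat_l; auto. apply exp_increasing. lra. }
  { intros n [x y] Hz. destruct (inQ x y Hz) as [Hx Hy]. split; [now apply aD|].
    assert (B := bound n x y Hx Hy). rewrite wM in B.
    set (E := exp (- (k * x)) * cos (k * y)) in *.
    assert (HE : E1 / 2 <= E).
    { assert (h := Hnear (x, y) ltac:(lra)). cbv beta in h.
      assert (h1 := Rle_lt_trans _ _ _ (re_le_Cmod _) h).
      assert (e1 := Re_scaled_cexp 1 k x y). assert (e2 := Re_scaled_cexp 1 k l 0).
      rewrite re_scal_l in e1, e2. rewrite Rmult_0_r, cos_0 in e2. fold E in e1. fold E1 in e2.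
      unfold Cminus in h1. rewrite re_plus, re_opp in h1.
      change ((l, 0) : C) with (RtoC l) in e2.
      apply Rabs_def2 in h1. lra. }
    set (X := exp (beta * E) ^ n) in *.
    assert (HX : 0 < X) by (apply pow_lt, exp_pos).
    apply Rmult_le_reg_r with X; auto. eapply Rle_trans; [exact B|].
    rewrite Rmult_assoc. apply Rmult_le_compat_l; auto. unfold X. rewrite <- Rpow_mult_distr.
    apply pow_incr. split.
    - unfold T. apply Rmult_le_pos; [lra|left; apply exp_pos].
    - rewrite Rinv_mult, <- exp_Ropp. unfold T. rewrite Rmult_assoc, <- exp_plus.
      apply Rmult_le_compat_l; [lra|].
      assert (beta * (E1 / 2) <= beta * E) by (apply Rmult_le_compat_l; lra).
      assert (Hle : alpha + beta * E2 <= - gam + beta * E) by (unfold gam; lra).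
      destruct Hle as [Hle|Hle]; [left; now apply exp_increasing|right; now rewrite Hle]. }
  assert (HR0 : e < e * exp (gam / 2)).
  { rewrite <- (Rmult_1_r e) at 1. apply Rmult_lt_compat_l; auto.
    rewrite <- exp_0. apply exp_increasing. lra. }
  assert (Hrhoe : rho <= e).
  { unfold rho. rewrite <- (Rmult_1_r e) at 2. apply Rmult_le_compat_l; [lra|].
    rewrite <- exp_0. destruct (Req_dec alpha 0) as [->|]; [rewrite Ropp_0; lra|].
    left. apply exp_increasing. lra. }
  exists r, (e * exp (gam / 2)), F. split; [|split; [|split]]; auto.
  intros [x y] w Hz Hw. destruct (inQ x y Hz) as [Hx Hy].
  apply HF2; auto; [lra|].
  intros eps Heps.
  set (q := Cmod (w - e)%C / rho).
  assert (Hq : 0 <= q < 1).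
  { unfold q. split; [apply Rmult_le_pos; [apply Cmod_ge_0|left; now apply Rinv_0_lt_compat]|].
    apply Rmult_lt_reg_r with rho; auto. unfold Rdiv. rewrite Rmult_assoc, Rinv_l; lra. }
  destruct (geometric_small K q Hq HK eps Heps) as [N HN].
  exists N. intros n Hn. eapply Rle_trans; [|left; apply (HN n Hn)].
  apply (taylor (fun w => f ((x, y), w)) (RtoC e) w rho K q n); auto.
  - unfold q. right. field. lra.
  - intros v Hv. apply (holomorphic_cdiff2 W f (x, y) v Hf), H1; auto.
  - intros v Hv. eapply Rle_trans; [apply HK1; auto; lra|auto].
Qed.

(** * Propagation *)

Lemma open_C2_intro (W : C * C -> Prop) :
  (forall z w, W (z, w) -> exists d, 0 < d /\
     forall z' w', Cmod (z' - z)%C < d -> Cmod (w' - w)%C < d -> W (z', w')) -> open W.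
Proof.
  intros H [z w] Hzw. destruct (H z w Hzw) as [d [Hd H']].
  exists (mkposreal (d / 2) ltac:(lra)). intros [z' w'] [Hz Hw]. simpl in Hz, Hw.
  assert (Bl : forall u v : C, @ball C_UniformSpace u (d / 2) v -> Cmod (v - u)%C < d).
  { intros u v [h1 h2]. eapply Rle_lt_trans; [apply Cmod_le_abs|].
    change (Rabs (fst v - fst u) < d / 2) in h1. change (Rabs (snd v - snd u) < d / 2) in h2.
    change (Rabs (fst v - fst u) + Rabs (snd v - snd u) < d). lra. }
  apply H'; now apply Bl.
Qed.

Lemma ex_filterdiff_ext_loc (f g : C * C -> C) (z w : C) (r : R) :
  0 < r ->
  (forall z' w', Cmod (z' - z)%C < r -> Cmod (w' - w)%C < r -> f (z', w') = g (z', w')) ->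
  ex_filterdiff (K := C_AbsRing) f (locally (z, w)) ->
  ex_filterdiff (K := C_AbsRing) g (locally (z, w)).
Proof.
  intros Hr E H. apply ex_filterdiff_C2 in H. apply ex_filterdiff_C2.
  destruct H as (l1 & l2 & H). exists l1, l2. intros e He. destruct (H e He) as [d [Hd Hd']].
  assert (m1 := Rmin_l d r). assert (m2 := Rmin_r d r).
  exists (Rmin d r). split; [now apply Rmin_pos|]. intros a b Ha Hb.
  rewrite <- !E; try (rewrite Cmod_refl_0; lra).
  - apply Hd'; lra.
  - replace (z + a - z)%C with a by ring. lra.
  - replace (w + b - w)%C with b by ring. lra.
Qed.

(** The change to strip coordinates, with the known extension at the origin; u will be 1 or -1
    according to the direction of propagation, and |u| = 1 preserves radii. *)
Lemma open_affine (W : C * C -> Prop) (p q u : C) :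
  open W -> Cmod u = 1 -> open (fun x : C * C => W ((p + u * fst x)%C, (q + snd x)%C)).
Proof.
  intros HW Hu. apply open_C2_intro. intros z w H. simpl in *.
  destruct (open_C2 W _ _ HW H) as [d [Hd H']]. exists d. split; auto. intros z' w' Hz Hw.
  apply H'.
  - replace (p + u * z' - (p + u * z))%C with (u * (z' - z))%C by ring. rewrite Cmod_mult, Hu. lra.
  - replace (q + w' - (q + w))%C with (w' - w)%C by ring. auto.
Qed.

Lemma ex_filterdiff_affine (f : C * C -> C) (p q u z w : C) :
  Cmod u = 1 ->
  ex_filterdiff (K := C_AbsRing) f (locally ((p + u * z)%C, (q + w)%C)) ->
  ex_filterdiff (K := C_AbsRing) (fun x : C * C => f ((p + u * fst x)%C, (q + snd x)%C)) (locally (z, w)).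
Proof.
  intros Hu H. apply ex_filterdiff_C2 in H. apply ex_filterdiff_C2.
  destruct H as (l1 & l2 & H). exists (l1 * u)%C, l2. intros e He.
  destruct (H e He) as [d [Hd Hd']]. exists d. split; auto. intros a b Ha Hb. simpl.
  specialize (Hd' (u * a)%C b ltac:(rewrite Cmod_mult, Hu; lra) Hb).
  rewrite Cmod_mult, Hu, Rmult_1_l in Hd'.
  replace (p + u * (z + a))%C with (p + u * z + u * a)%C by ring.
  replace (q + (w + b))%C with (q + w + b)%C by ring.
  replace (l1 * u * a)%C with (l1 * (u * a))%C by ring. exact Hd'.
Qed.

Lemma class_C_cont (n : nat) (h : C * R -> R) (z : C) (y e : R) :
  class_C n h -> 0 < e -> exists d, 0 < d /\
    forall z' y', Cmod (z' - z)%C < d -> Rabs (y' - y) < d -> Rabs (h (z', y') - h (z, y)) < e.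
Proof.
  intros Hh He.
  assert (Hc : continuous h (z, y)) by (destruct n; apply Hh).
  destruct (Hc (ball (h (z, y)) e)) as [d Hd].
  { exists (mkposreal e He). auto. }
  exists d. split; [apply cond_pos|]. intros z' y' Hz Hy.
  apply (Hd (z', y')). split; [|exact Hy].
  apply (C_NormedModule_mixin_compat1 z z' d Hz).
Qed.

Lemma epigraph_open (n : nat) (h : C * R -> R) : class_C n h -> open (epigraph_domain h).
Proof.
  intros Hh. apply open_C2_intro. intros z w H. unfold epigraph_domain in *. simpl in *.
  destruct (class_C_cont n h z (Im w) ((Re w - h (z, Im w)) / 2) Hh ltac:(lra)) as [d [Hd H']].
  exists (Rmin d ((Re w - h (z, Im w)) / 2)). split; [apply Rmin_pos; lra|].
  intros z' w' Hz Hw.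
  assert (m1 := Rlt_le_trans _ _ _ Hw (Rmin_l _ _)). assert (m2 := Rlt_le_trans _ _ _ Hw (Rmin_r _ _)).
  assert (h1 := Rle_lt_trans _ _ _ (im_le_Cmod _) m1). assert (h2 := Rle_lt_trans _ _ _ (re_le_Cmod _) m2).
  unfold Cminus in h1, h2. rewrite im_plus, im_opp in h1. rewrite re_plus, re_opp in h2.
  specialize (H' z' (Im w') (Rlt_le_trans _ _ _ Hz (Rmin_l _ _)) h1).
  apply Rabs_def2 in H'. apply Rabs_def2 in h2. lra.
Qed.

(** The condition s >= 1 enters through |y|^s <= |y| <= t. The bound is uniform on |y| <= t, which
    gives one deficit for all discs over a strip. *)
Lemma exp_flat_le (s y t : R) : 1 <= s -> 0 < t <= 1 -> Rabs y <= t -> 0 <= exp_flat s y <= exp (- / t).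
Proof.
  intros Hs Ht Hy. unfold exp_flat. destruct (Req_dec_T y 0) as [_|Hy0].
  - split; [lra|left; apply exp_pos].
  - split; [left; apply exp_pos|].
    assert (Hp : 0 < Rabs y) by now apply Rabs_pos_lt.
    assert (HR : Rpower (Rabs y) s <= t).
    { apply Rle_trans with (Rabs y); auto. unfold Rpower.
      rewrite <- (exp_ln (Rabs y)) at 2 by auto.
      assert (ln (Rabs y) <= 0) by (rewrite <- ln_1; apply ln_le; lra).
      assert (Hln : s * ln (Rabs y) <= ln (Rabs y)) by nra.
      destruct Hln as [H'|H']; [left; now apply exp_increasing|right; now rewrite H']. }
    assert (HI : - / Rpower (Rabs y) s <= - / t).
    { apply Ropp_le_contravar, Rinv_le_contravar; auto. apply exp_pos. }
    destruct HI as [HI'|HI']; [left; now apply exp_increasing|right; now rewrite HI'].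
Qed.

(** [radius_gain] expects one function on one open set that contains the discs in Omega as well as
    the larger discs over the left side. G is F on a polydisc in U and f elsewhere; agreement on the
    overlap makes it locally equal to one of the two. *)
Lemma glue_extension (Omega : C * C -> Prop) (f : C * C -> C) (p q : C) :
  open Omega -> holomorphic_on Omega f -> extends_holomorphically_near Omega f (p, q) ->
  exists (r : R) (W : C * C -> Prop) (G : C * C -> C), 0 < r /\ open W /\ holomorphic_on W G /\
    (forall x, Omega x -> W x /\ G x = f x) /\
    (forall z w, Cmod (z - p)%C < r -> Cmod (w - q)%C < r -> W (z, w)).
Proof.
  intros HO Hf (U & F & HU & Hp & HF & E).
  destruct (open_C2 U p q HU Hp) as [r [Hr Hball]].
  pose (B := fun x : C * C => Cmod (fst x - p)%C < r /\ Cmod (snd x - q)%C < r).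
  assert (HB : open B).
  { apply open_C2_intro. intros z w [Hz Hw]. simpl in *.
    exists (Rmin (r - Cmod (z - p)%C) (r - Cmod (w - q)%C)). split; [apply Rmin_pos; lra|].
    intros z' w' Hz' Hw'.
    assert (m1 := Rlt_le_trans _ _ _ Hz' (Rmin_l _ _)). assert (m2 := Rlt_le_trans _ _ _ Hw' (Rmin_r _ _)).
    split; simpl; [generalize (Cmod_dist_triangle z' z p)|generalize (Cmod_dist_triangle w' w q)]; lra. }
  assert (HBU : forall x, B x -> U x).
  { intros [z w] [Hz Hw]. now apply Hball. }
  pose (G := fun x => if excluded_middle_informative (B x) then F x else f x).
  assert (GO : forall x, Omega x -> G x = f x).
  { intros x Hx. unfold G. destruct (excluded_middle_informative (B x)); auto. }
  exists r, (fun x => Omega x \/ B x), G. split; [|split; [|split; [|split]]]; auto.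
  - intros x [Hx|Hx].
    + apply (filter_imp Omega); [tauto|]. now apply HO.
    + apply (filter_imp B); [tauto|]. now apply HB.
  - intros [z w] Hx. destruct (excluded_middle_informative (B (z, w))) as [Hb|Hb].
    + destruct (open_C2 B z w HB Hb) as [d [Hd H]].
      apply (ex_filterdiff_ext_loc F G z w d); auto.
      intros z' w' Hz Hw. unfold G. destruct (excluded_middle_informative (B (z', w'))) as [|n]; auto.
      destruct n; auto.
    + assert (HOx : Omega (z, w)) by tauto.
      destruct (open_C2 Omega z w HO HOx) as [d [Hd H]].
      apply (ex_filterdiff_ext_loc f G z w d); auto.
      intros z' w' Hz Hw. symmetry. apply GO. auto.
  - intros z w Hz Hw. right. now split.
Qed.

(** All requirements ask that 1 / eta be large. With eta = 1 / (4 X) the loss is of order exp(-4 X)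
    and the gain of order exp(-2 pi X l) >= exp(-X), because l <= 1/8 and pi <= 4; the surplus
    exp(-3 X) absorbs the constants. *)
Lemma width_choice (M e beta tau r t l : R) :
  1 <= M -> 0 < e -> 0 < beta <= 1 -> 0 < tau -> 0 < r -> 0 < t -> 0 < l <= / 8 ->
  exists eta A, 0 < eta /\ eta < r /\ eta < t /\ A = M * exp (- / eta) /\ 0 < A /\ A < tau /\
    4 * A / e <= 1 /\
    4 * A / e + beta * exp (- (PI / (2 * eta) * (2 * l))) < beta / 2 * exp (- (PI / (2 * eta) * l)).
Proof.
  intros HM He Hb Htau Hr Ht Hl.
  (* X dominates each summand: 1 / l gives 2 pi X l >= 6 and so E1 <= 1/4, the next two make A small
     against the gain and against tau, and the last two give eta < r and eta < t. *)
  set (X := / l + 16 * M / (e * beta) + M / tau + / r + / t).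
  assert (p1 : 0 < / l) by (apply Rinv_0_lt_compat; lra).
  assert (p2 : 0 < 16 * M / (e * beta)).
  { apply Rdiv_lt_0_compat; [lra|]. apply Rmult_lt_0_compat; lra. }
  assert (p3 : 0 < M / tau) by (apply Rdiv_lt_0_compat; lra).
  assert (p4 : 0 < / r) by now apply Rinv_0_lt_compat.
  assert (p5 : 0 < / t) by now apply Rinv_0_lt_compat.
  assert (HX : 0 < X) by (unfold X; lra).
  exists (/ (4 * X)), (M * exp (- (4 * X))).
  rewrite Rinv_inv.
  replace (PI / (2 * / (4 * X))) with (2 * PI * X) by (field; lra).
  assert (Hpi := PI_4). assert (Hpi3 := PI2_3_2).
  set (Z := exp (- X)).
  assert (HZ : 0 < Z) by apply exp_pos.
  assert (small : forall x, 0 <= x -> exp (- x) * (1 + x) <= 1).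
  { intros x Hx. assert (h := exp_ineq1_le x). assert (h' := exp_pos (- x)).
    replace 1 with (exp (- x) * exp x) at 2 by (rewrite <- exp_plus, Rplus_opp_l; apply exp_0).
    apply Rmult_le_compat_l; lra. }
  assert (S4 := small (4 * X) ltac:(lra)). assert (S3 := small (3 * X) ltac:(lra)).
  assert (HA : 0 < M * exp (- (4 * X))) by (apply Rmult_lt_0_compat; [lra|apply exp_pos]).
  assert (A3 : exp (- (4 * X)) = Z * exp (- (3 * X))).
  { unfold Z. rewrite <- exp_plus. f_equal. ring. }
  set (E1 := exp (- (2 * PI * X * l))).
  assert (HE1 : 0 < E1) by apply exp_pos.
  assert (HE2 : exp (- (2 * PI * X * (2 * l))) = E1 * E1).
  { unfold E1. rewrite <- exp_plus. f_equal. ring. }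
  assert (Xl : 1 <= X * l).
  { rewrite <- (Rinv_l l) by lra. apply Rmult_le_compat_r; [lra|]. unfold X. lra. }
  assert (E1small : E1 <= / 4).
  { assert (h := small (2 * PI * X * l)). fold E1 in h.
    assert (6 <= 2 * PI * X * l) by (replace (2 * PI * X * l) with (2 * PI * (X * l)) by ring; nra).
    specialize (h ltac:(lra)). nra. }
  assert (ZE1 : Z <= E1).
  { unfold Z, E1. assert (2 * PI * X * l <= X).
    { replace (2 * PI * X * l) with (X * (2 * PI * l)) by ring.
      rewrite <- (Rmult_1_r X) at 2. apply Rmult_le_compat_l; [lra|]. nra. }
    destruct (Req_dec (2 * PI * X * l) X) as [->|]; [lra|]. left. apply exp_increasing. lra. }
  (* Half of the available beta / 2 * E1 is spent on this loss; the other half covers beta * E1^2,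
     by E1 <= 1/4. *)
  assert (key : 4 * (M * exp (- (4 * X))) / e < beta / 4 * E1).
  { apply Rlt_le_trans with (beta / 4 * Z); [|apply Rmult_le_compat_l; lra].
    rewrite A3. set (Y := exp (- (3 * X))) in *. assert (HY : 0 < Y) by apply exp_pos.
    assert (HYX : Y * (16 * M / (e * beta)) < 1).
    { apply Rlt_le_trans with (Y * (1 + 3 * X)); [|lra]. apply Rmult_lt_compat_l; auto.
      unfold X. lra. }
    replace (4 * (M * (Z * Y)) / e) with (beta / 4 * Z * (Y * (16 * M / (e * beta)))) by (field; lra).
    rewrite <- (Rmult_1_r (beta / 4 * Z)) at 2. apply Rmult_lt_compat_l; auto.
    apply Rmult_lt_0_compat; lra. }
  split; [apply Rinv_0_lt_compat; lra|].
  split; [rewrite <- (Rinv_inv r) at 1; apply Rinv_lt_contravar; [apply Rmult_lt_0_compat; lra|unfold X; lra]|].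
  split; [rewrite <- (Rinv_inv t) at 1; apply Rinv_lt_contravar; [apply Rmult_lt_0_compat; lra|unfold X; lra]|].
  split; [reflexivity|]. split; [auto|]. split; [|split].
  - assert (h : M / tau * exp (- (4 * X)) < 1).
    { rewrite Rmult_comm. eapply Rlt_le_trans; [|exact S4].
      apply Rmult_lt_compat_l; [apply exp_pos|]. unfold X. lra. }
    apply Rmult_lt_compat_l with (r := tau) in h; auto.
    replace (tau * (M / tau * exp (- (4 * X)))) with (M * exp (- (4 * X))) in h by (field; lra). lra.
  - nra.
  - rewrite HE2. assert (beta * (E1 * E1) <= beta * (/ 4 * E1)).
    { apply Rmult_le_compat_l; [lra|]. apply Rmult_le_compat_r; lra. }
    lra.
Qed.

(* The step l = |a - a'| is limited only by the local constants of h, not by the size of the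
   neighbourhood of a' to which f extends. *)
Lemma local_propagation (s : R) (h : C * R -> R) (n : nat) (f : C * C -> C) (a c : R) :
  1 <= s -> class_C n h -> O_exp_flat s (fun p => RtoC (h p)) ->
  holomorphic_on (epigraph_domain h) f ->
  exists d, 0 < d /\ forall a', Rabs (a - a') < d ->
    extends_holomorphically_near (epigraph_domain h) f (RtoC a', (0, c)) ->
    extends_holomorphically_near (epigraph_domain h) f (RtoC a, (0, c)).
Proof.
  intros Hs Hh HO Hf.
  destruct (HO a c) as (delta & M0 & HM0).
  set (dl := Rmin delta 1). assert (Hdelta := cond_pos delta).
  assert (Hdl : 0 < dl) by (apply Rmin_pos; lra).
  assert (dl1 : dl <= delta) by apply Rmin_l. assert (dl2 : dl <= 1) by apply Rmin_r.
  set (M := Rmax M0 1).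
  assert (HM1 : 1 <= M) by apply Rmax_r. assert (HMM : M0 <= M) by apply Rmax_l.
  assert (hb : forall x y v t, Rabs (x - a) < dl -> Rabs (v - c) < dl -> 0 < t < dl -> Rabs y <= t ->
     h ((x, y), v) <= M * exp (- / t)).
  { intros x y v t Hx Hv Ht Hy.
    assert (H := HM0 x y v ltac:(lra) ltac:(lra) ltac:(lra)).
    rewrite Cmod_R in H. assert (H' := Rle_abs (h (x, y, v))).
    destruct (exp_flat_le s y t Hs ltac:(lra) Hy) as [F1 F2].
    apply Rle_trans with (M * exp_flat s y).
    - assert (M0 * exp_flat s y <= M * exp_flat s y) by (apply Rmult_le_compat_r; auto). lra.
    - apply Rmult_le_compat_l; lra. }
  (* As dl <= 1, this yields l <= 1/8 for [width_choice] and keeps the rectangle of length 2 l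
     inside the box where h is controlled. *)
  exists (dl / 8). split; [lra|]. intros a' Ha' Hext.
  destruct (Req_dec a a') as [<-|Hne]; auto.
  (* A half turn about a' when a < a' puts the target at +l, so one rectangle serves both
     directions. *)
  assert (Hsg : exists sg : R, Rabs sg = 1 /\ sg * sg = 1 /\ a = a' + sg * Rabs (a - a')).
  { destruct (Rle_dec 0 (a - a')) as [Hp|Hp].
    - exists 1. rewrite Rabs_R1, Rabs_pos_eq by auto. lra.
    - exists (- 1). rewrite Rabs_left by lra. rewrite Rabs_left by lra. lra. }
  destruct Hsg as (sg & Hsg1 & Hsg2 & Hsg3).
  set (l := Rabs (a - a')) in *.
  assert (Hl : 0 < l) by (apply Rabs_pos_lt; lra).
  assert (Hu : Cmod (RtoC sg) = 1) by now rewrite Cmod_R.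
  set (q0 := (0, c) : C) in *.
  destruct (glue_extension _ f (RtoC a') q0 (epigraph_open n h Hh) Hf Hext)
    as (r & W & G & Hr & HW & HG & HWO & HWr).
  set (e := dl / 2). assert (He : 0 < e) by (unfold e; lra).
  assert (Hedl : e < dl) by (unfold e; lra).
  (* beta will satisfy exp(2 beta) = 1 + m. If |w - e| <= e exp beta and |w| >= r, then 2 e Re w >=
     |w|^2 - m e^2 >= r^2 / 2, that is, Re w >= tau; and m <= 1 gives |Im w| < 2 e = dl. *)
  set (m := Rmin 1 (r ^ 2 / (2 * e ^ 2))).
  assert (Hr2 : 0 < r ^ 2) by now apply pow_lt. assert (He2 : 0 < e ^ 2) by now apply pow_lt.
  assert (Hm : 0 < m) by (apply Rmin_pos; [lra|apply Rdiv_lt_0_compat; lra]).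
  assert (Hm1 : m <= 1) by apply Rmin_l.
  assert (Hm2 : m * e ^ 2 <= r ^ 2 / 2).
  { replace (r ^ 2 / 2) with (r ^ 2 / (2 * e ^ 2) * e ^ 2) by (field; lra).
    apply Rmult_le_compat_r; [lra|apply Rmin_r]. }
  set (beta := ln (1 + m) / 2).
  assert (Hbeta2 : exp beta * exp beta = 1 + m).
  { rewrite <- exp_plus. unfold beta. replace (ln (1 + m) / 2 + ln (1 + m) / 2) with (ln (1 + m)) by field.
    apply exp_ln. lra. }
  assert (Hbeta : 0 < beta).
  { unfold beta. assert (0 < ln (1 + m)) by (rewrite <- ln_1; apply ln_increasing; lra). lra. }
  assert (Hbeta1 : beta <= 1).
  { assert (H := exp_ineq1_le (2 * beta)). replace (2 * beta) with (beta + beta) in H by ring.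
    rewrite exp_plus in H. lra. }
  set (tau := r ^ 2 / (4 * e)).
  assert (Htau : 0 < tau) by (apply Rdiv_lt_0_compat; lra).
  destruct (width_choice M e beta tau r dl l) as (eta & A & Heta & Hetar & Hetadl & EA & HA & HAtau & HA1 & H3);
    auto; try lra.
  (* For alpha <= 1 one has exp(-alpha) <= 1 - alpha / 2, so the disc of radius e exp(-alpha) about
     e lies in Re w >= 2 A, above the bound A for h on the strip. *)
  set (alpha := 4 * A / e) in *.
  assert (Halpha : 0 <= alpha) by (unfold alpha; apply Rmult_le_pos; [lra|left; now apply Rinv_0_lt_compat]).
  assert (Hexpa : exp (- alpha) <= 1 - alpha / 2).
  { assert (h1 := exp_ineq1_le alpha). assert (h2 := exp_pos (- alpha)).
    assert (h3 : exp (- alpha) * exp alpha = 1) by (rewrite <- exp_plus, Rplus_opp_l; apply exp_0).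
    assert (h4 : exp (- alpha) * (1 + alpha) <= 1) by (rewrite <- h3; apply Rmult_le_compat_l; lra).
    nra. }
  assert (Hrho : e * exp (- alpha) <= e - 2 * A).
  { apply Rle_trans with (e * (1 - alpha / 2)); [apply Rmult_le_compat_l; lra|].
    right. unfold alpha. field. lra. }
  pose (W' := fun x : C * C => W ((RtoC a' + RtoC sg * fst x)%C, (q0 + snd x)%C)).
  pose (G' := fun x : C * C => G ((RtoC a' + RtoC sg * fst x)%C, (q0 + snd x)%C)).
  assert (HW' : open W') by now apply open_affine.
  assert (HG' : holomorphic_on W' G').
  { intros [z w] H. apply ex_filterdiff_affine; auto. }
  assert (coord : forall x y, (RtoC a' + RtoC sg * (x, y))%C = (a' + sg * x, sg * y)).
  { intros x y. unfold Cplus, Cmult, RtoC; simpl. f_equal; ring. }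
  assert (epi : forall x y w, 0 <= x <= 2 * l -> - eta <= y <= eta -> Rabs (Im w) < dl -> A < Re w ->
     epigraph_domain h ((RtoC a' + RtoC sg * (x, y))%C, (q0 + w)%C)).
  { intros x y w Hx Hy Hw1 Hw2. unfold epigraph_domain. simpl fst. simpl snd.
    rewrite coord, re_plus, im_plus. simpl (Re q0). simpl (Im q0).
    eapply Rle_lt_trans; [apply (hb _ _ _ eta)|]; try lra.
    - rewrite Hsg3. replace (a' + sg * x - (a' + sg * l)) with (sg * (x - l)) by ring.
      rewrite Rabs_mult, Hsg1, Rmult_1_l. assert (Rabs (x - l) <= l) by (apply Rabs_le; lra). lra.
    - replace (c + Im w - c) with (Im w) by ring. auto.
    - rewrite Rabs_mult, Hsg1, Rmult_1_l. apply Rabs_le; lra. }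
  assert (distRe : forall w R', Cmod (w - RtoC e)%C <= R' -> e - R' <= Re w /\ Rabs (Im w) <= R').
  { intros w R' Hw. assert (h1 := Rle_trans _ _ _ (re_le_Cmod _) Hw).
    assert (h2 := Rle_trans _ _ _ (im_le_Cmod _) Hw).
    unfold Cminus in h1, h2. rewrite re_plus, re_opp, re_RtoC in h1. rewrite im_plus, im_opp, im_RtoC in h2.
    rewrite Ropp_0, Rplus_0_r in h2. apply Rabs_le_between in h1. split; auto. lra. }
  destruct (radius_gain W' G' l eta e alpha beta) as (r2 & R0 & F & Hr2' & HR0 & HF1 & HF2); auto.
  { intros x y w Hx Hy Hw. apply HWO. destruct (distRe w _ Hw). apply epi; simpl snd; auto; lra. }
  (* Two pieces cover the larger disc over the left side: the polydisc of the given extension, as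
     eta < r, and Omega, where Re w >= tau > A >= h. *)
  { intros y w Hy Hw. destruct (Rlt_dec (Cmod w) r) as [Hwr|Hwr].
    - apply HWr; simpl.
      + replace (RtoC a' + RtoC sg * (0, y) - RtoC a')%C with (RtoC sg * (0, y))%C by ring.
        rewrite Cmod_mult, Hu, Rmult_1_l. eapply Rle_lt_trans; [apply Cmod_le_abs|]. simpl.
        rewrite Rabs_R0, Rplus_0_l. apply Rle_lt_trans with eta; auto. apply Rabs_le; lra.
      + replace (q0 + w - q0)%C with w by ring. auto.
    - apply HWO.
      assert (Hsq : Cmod (w - RtoC e)%C ^ 2 <= (e * exp beta) ^ 2).
      { apply pow_incr. split; auto. apply Cmod_ge_0. }
      replace ((e * exp beta) ^ 2) with (e ^ 2 * (exp beta * exp beta)) in Hsq by ring.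
      rewrite Hbeta2 in Hsq.
      assert (Hwsq : r ^ 2 <= Cmod w ^ 2) by (apply pow_incr; lra).
      rewrite Cmod2_alt in Hsq, Hwsq. unfold Cminus in Hsq.
      rewrite re_plus, im_plus, re_opp, im_opp, re_RtoC, im_RtoC in Hsq.
      apply epi; simpl snd; try lra.
      + assert (Im w ^ 2 < dl ^ 2).
        { replace dl with (2 * e) by (unfold e; field).
          assert (e ^ 2 * (1 + m) <= e ^ 2 * 2) by (apply Rmult_le_compat_l; lra).
          assert (p2 := pow2_ge_0 (Re w + - e)). replace ((2 * e) ^ 2) with (4 * e ^ 2) by ring.
          rewrite Ropp_0, Rplus_0_r in Hsq. lra. }
        rewrite <- (Rabs_pos_eq dl) by lra. apply Rsqr_lt_abs_0. unfold Rsqr. lra.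
      + apply Rlt_le_trans with tau; auto. unfold tau.
        apply Rmult_le_reg_l with (4 * e); [lra|].
        replace (4 * e * (r ^ 2 / (4 * e))) with (r ^ 2) by (field; lra). nra. }
  set (rho := e * exp (- alpha)) in *.
  assert (Hrho0 : 0 < rho) by (apply Rmult_lt_0_compat; auto; apply exp_pos).
  (* |w| < R0 - e puts w within R0 of e; |w| < rho puts e + i Im w in the disc of radius rho about
     e, where F is known to equal G'. *)
  set (r3 := Rmin (R0 - e) rho). assert (Hr3 : 0 < r3) by (apply Rmin_pos; lra).
  assert (r3a : r3 <= R0 - e) by apply Rmin_l. assert (r3b : r3 <= rho) by apply Rmin_r.
  assert (He0 : Cmod (RtoC e) = e) by (rewrite Cmod_R, Rabs_pos_eq; lra).
  pose (V := fun x : C * C => Cmod (fst x - RtoC l)%C < r2 /\ Cmod (snd x) < r3).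
  assert (HV : open V).
  { apply open_C2_intro. intros z w [Hz Hw]. simpl in *.
    exists (Rmin (r2 - Cmod (z - RtoC l)%C) (r3 - Cmod w)). split; [apply Rmin_pos; lra|].
    intros z' w' Hz' Hw'.
    assert (m1 := Rlt_le_trans _ _ _ Hz' (Rmin_l _ _)). assert (m2 := Rlt_le_trans _ _ _ Hw' (Rmin_r _ _)).
    split; simpl.
    - generalize (Cmod_dist_triangle z' z (RtoC l)); lra.
    - generalize (Cmod_minus_ge w' w); lra. }
  assert (Vdisc : forall z w, V (z, w) -> Cmod (w - RtoC e)%C < R0).
  { intros z w [Hz Hw]. simpl in *. generalize (Cmod_triangle_minus w (RtoC e)). lra. }
  (* z -> b + sg z is the inverse of z -> a' + sg z, since sg^2 = 1. *)
  set (b := (- (RtoC sg * RtoC a'))%C).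
  assert (back : forall z, (RtoC a' + RtoC sg * (b + RtoC sg * z))%C = z).
  { intros z. unfold b. replace (RtoC a' + RtoC sg * (- (RtoC sg * RtoC a') + RtoC sg * z))%C
      with (RtoC a' - (RtoC sg * RtoC sg) * RtoC a' + (RtoC sg * RtoC sg) * z)%C by ring.
    rewrite <- RtoC_mult, Hsg2. ring. }
  exists (fun x => V ((b + RtoC sg * fst x)%C, (- q0 + snd x)%C)),
         (fun x => F ((b + RtoC sg * fst x)%C, (- q0 + snd x)%C)).
  split; [now apply open_affine|]. split; [|split].
  - split; simpl.
    + replace (b + RtoC sg * RtoC a - RtoC l)%C with (RtoC 0); [now rewrite Cmod_0|].
      rewrite Hsg3. unfold b. rewrite <- !RtoC_mult, <- RtoC_opp, <- RtoC_plus, <- RtoC_minus. f_equal.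
      replace (- (sg * a') + sg * (a' + sg * l) - l) with ((sg * sg - 1) * l) by ring. rewrite Hsg2. ring.
    + replace (- q0 + q0)%C with (RtoC 0) by ring. now rewrite Cmod_0.
  - intros [z w] Hx. apply ex_filterdiff_affine; auto. apply HF1; [apply Hx|now apply (Vdisc _ _ Hx)].
  - intros [z w] Hx Homega. cbv beta in *. simpl fst in *. simpl snd in *.
    set (ze := (b + RtoC sg * z)%C) in *. set (v := (- q0 + w)%C) in *.
    assert (Hz : z = (RtoC a' + RtoC sg * ze)%C) by (unfold ze; now rewrite back).
    assert (Hw : w = (q0 + v)%C) by (unfold v; ring).
    clearbody ze v.
    rewrite <- (proj2 (HWO _ Homega)). rewrite Hz, Hw. change (F (ze, v) = G' (ze, v)).
    assert (Hv := proj2 Hx). simpl in Hv. assert (Hze := proj1 Hx). simpl in Hze.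
    assert (Hvd := Vdisc _ _ Hx).
    assert (Hre := re_le_Cmod v). assert (Him := im_le_Cmod v).
    apply Rabs_le_between in Hre.
    (* h depends on z_2 only through Im z_2, so Omega is stable under increasing Re z_2. The segment
       from v to e + i Im v thus stays where both F and G' are holomorphic, and the identity theorem
       carries their equality back to v. *)
    assert (up : forall t, Re v <= t -> W' (ze, (t, Im v))).
    { intros t Ht. apply HWO. rewrite Hz, Hw in Homega.
      change (h ((RtoC a' + RtoC sg * ze)%C, Im (q0 + v)%C) < Re (q0 + v)%C) in Homega.
      change (h ((RtoC a' + RtoC sg * ze)%C, Im (q0 + (t, Im v))%C) < Re (q0 + (t, Im v))%C).
      rewrite re_plus, im_plus in *.
      change (Im (t, Im v)) with (Im v). change (Re (t, Im v)) with t. lra. }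
    assert (indisc : forall t, Re v <= t <= e -> Cmod ((t, Im v) - RtoC e)%C < R0).
    { intros t Ht. eapply Rle_lt_trans; [|exact Hvd].
      apply Rsqr_incr_0; [|apply Cmod_ge_0|apply Cmod_ge_0].
      rewrite !Rsqr_pow2, !Cmod2_alt. unfold Cminus. rewrite !re_plus, !im_plus.
      change (Im (t, Im v)) with (Im v). change (Re (t, Im v)) with t.
      rewrite re_opp, re_RtoC. nra. }
    apply Ceq_minus. replace v with ((Re v, Im v) : C) by (destruct v; reflexivity).
    apply (identity_segment (fun u => F (ze, u) - G' (ze, u))%C (Im v) (Re v) e).
    + unfold rho, e in *. lra.
    + intros t Ht. destruct (open_C2 W' ze (t, Im v) HW' (up t (proj1 Ht))) as [d1 [Hd1 Hd1']].
      assert (Hi := indisc t Ht).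
      exists (Rmin d1 (R0 - Cmod ((t, Im v) - RtoC e)%C)). split; [apply Rmin_pos; lra|].
      intros u Hu'. assert (m1 := Rlt_le_trans _ _ _ Hu' (Rmin_l _ _)).
      assert (m2 := Rlt_le_trans _ _ _ Hu' (Rmin_r _ _)).
      apply (cdiff_minus (fun u => F (ze, u)) (fun u => G' (ze, u))).
      * apply (holomorphic_cdiff2 (fun x => x = (ze, u)) F ze u); auto.
        intros x ->. apply HF1; auto.
        generalize (Cmod_dist_triangle u (t, Im v) (RtoC e)). lra.
      * apply (holomorphic_cdiff2 W' G' ze u); auto. apply Hd1'; auto. now rewrite Cmod_refl_0.
    + exists (rho - Rabs (Im v)). split; [lra|]. intros u Hu'. rewrite HF2; auto; [ring|].
      assert (Cmod ((e, Im v) - RtoC e)%C <= Rabs (Im v)).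
      { eapply Rle_trans; [apply Cmod_le_abs|]. simpl. rewrite Rplus_opp_r, Rabs_R0, Ropp_0, Rplus_0_r. lra. }
      generalize (Cmod_dist_triangle u (e, Im v) (RtoC e)). lra.
Qed.

Lemma extends_nearby (Omega : C * C -> Prop) (f : C * C -> C) (a : R) (q : C) :
  extends_holomorphically_near Omega f (RtoC a, q) ->
  exists d, 0 < d /\ forall a', Rabs (a' - a) < d -> extends_holomorphically_near Omega f (RtoC a', q).
Proof.
  intros (U & F & HU & Ha & H). destruct (open_C2 U _ _ HU Ha) as [d [Hd Hd']].
  exists d. split; auto. intros a' Ha'. exists U, F. split; auto. split; auto.
  apply Hd'; [|now rewrite Cmod_refl_0]. now rewrite <- RtoC_minus, Cmod_R.
Qed.

Theorem theorem2p6 :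
  forall (s : R) (h : C * R -> R) (c : R),
    1 <= s ->
    class_C 3 h ->
    (forall j : nat, (j <= 2)%nat ->
       O_exp_flat s (d_z1_iter j (fun p => RtoC (h p)))) ->
    propagator_of_holomorphic_extendibility (epigraph_domain h) (real_line c).
Proof.
  intros s h c Hs Hh HO f Hf z1 L1 Hext zo Lo.
  pose (E := fun x : R => extends_holomorphically_near (epigraph_domain h) f (RtoC x, (0, c))).
  assert (form : forall z, real_line c z -> z = (RtoC (Re (fst z)), (0, c))).
  { intros [[x y] [u v]] (H1 & H2 & H3). simpl in *. now subst. }
  rewrite (form z1 L1) in Hext. rewrite (form zo Lo).
  set (x1 := Re (fst z1)) in *. set (xo := Re (fst zo)) in *.
  change (E x1) in Hext. change (E xo).
  (* Transfer is required between any two points of a subinterval, in both directions, so the order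
     of x1 and xo does not matter. *)
  pose (Q := fun x (_ : R) s => forall t t', x <= t <= x + s * Rabs (xo - x1) ->
     x <= t' <= x + s * Rabs (xo - x1) -> E t -> E t').
  assert (Habs := Rabs_pos (xo - x1)).
  assert (H : Q (Rmin x1 xo) 0 1).
  { apply (box_bisection Q (Rabs (xo - x1)) 0 (Rmin x1 xo) 0); try lra.
    - intros x y0 u Hu h1 h2 h3 h4 H1 H2 h5 h6 t t' Ht Ht' Hz. unfold Q in *.
      assert (0 <= u / 2 * Rabs (xo - x1)) by (apply Rmult_le_pos; lra).
      set (m := x + u / 2 * Rabs (xo - x1)) in *.
      replace (m + u / 2 * Rabs (xo - x1)) with (x + u * Rabs (xo - x1)) in * by (unfold m; field).
      assert (E m).
      { destruct (Rle_dec t m); [apply (H1 t)|apply (H2 t)]; auto; unfold m in *; lra. }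
      destruct (Rle_dec t' m); [apply (H1 m)|apply (H2 m)]; auto; unfold m in *; lra.
    - intros p q Hp Hq.
      destruct (local_propagation s h 3 f p c Hs Hh (HO 0%nat (Nat.le_0_l _)) Hf) as [d1 [Hd1 H1]].
      (* If f extends at p, it extends at all nearby points; if not, it extends at no point within
         d1, because [local_propagation] would carry the extension to p. *)
      destruct (classic (E p)) as [Hp1|Hp1].
      + destruct (extends_nearby _ f p _ Hp1) as [d2 [Hd2 H2]].
        exists (d2 / (Rabs (xo - x1) + 1)). split; [apply Rdiv_lt_0_compat; lra|].
        intros x y u Hu h1 h2 h3 h4 Hx h5 t t' Ht Ht' _. apply H2.
        assert (u * (Rabs (xo - x1) + 1) < d2).
        { apply Rlt_le_trans with (d2 / (Rabs (xo - x1) + 1) * (Rabs (xo - x1) + 1)).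
          - apply Rmult_lt_compat_r; lra.
          - right. field. lra. }
        apply Rabs_def1; lra.
      + exists (d1 / (Rabs (xo - x1) + 1)). split; [apply Rdiv_lt_0_compat; lra|].
        intros x y u Hu h1 h2 h3 h4 Hx h5 t t' Ht Ht' HE. exfalso. apply Hp1.
        apply (H1 t); auto.
        assert (u * (Rabs (xo - x1) + 1) < d1).
        { apply Rlt_le_trans with (d1 / (Rabs (xo - x1) + 1) * (Rabs (xo - x1) + 1)).
          - apply Rmult_lt_compat_r; lra.
          - right. field. lra. }
        apply Rabs_def1; lra. }
  apply (H x1 xo); auto; rewrite Rmult_1_l; unfold Rmin, Rabs;
    destruct (Rle_dec x1 xo); destruct (Rcase_abs (xo - x1)); lra.
Qed.
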